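(* Consider an iterated Ore extension $S=k[x_1,\ldots,x_t;\delta_2,\ldots,\delta_t]$ with identity automorphisms $\sigma_i=1$ and filtered derivations $\delta_i$. There is an iterated twisted product resolution $K_\bullet$ that is a free resolution of $S$ as a bimodule over itself: $$K_n=S\otimes\textstyle\bigwedge^nV\otimes S$$ for $V=\mathrm{Span}_k\{x_1,\ldots,x_t\}$, with differentials given by (for $1\le l_1<\cdots<l_n\le t$) $$\begin{aligned} d_n(&1\otimes x_{l_1}\wedge\cdots\wedge x_{l_n}\otimes 1)\\ &=\sum_{1\le i\le n}(-1)^{i+1}\big(x_{l_i}\otimes x_{l_1}\wedge\cdots\wedge\hat{x}_{l_i}\wedge\cdots\wedge x_{l_n}\otimes 1-1\otimes x_{l_1}\wedge\cdots\wedge\hat{x}_{l_i}\wedge\cdots\wedge x_{l_n}\otimes x_{l_i}\big)\\ &\quad+\sum_{1\le i<j\le n}(-1)^j\otimes x_{l_1}\wedge\cdots\wedge x_{l_{i-1}}\wedge\bar\delta_{l_j}(x_{l_i})\wedge x_{l_{i+1}}\wedge\cdots\wedge\hat{x}_{l_j}\wedge\cdots\wedge x_{l_n}\otimes 1, \end{aligned}$$ where $\bar\delta_{l_j}(x_{l_i})$ is the image of $\delta_{l_j}(x_{l_i})$ under the projection $k\oplus V\to V$, and hats denote omitted factors.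
   Context: Throughout, $k$ is a field of arbitrary characteristic, $\otimes=\otimes_k$, algebras are associative unital $k$-algebras, $m_A,m_B$ denote multiplication maps, and $1$ denotes identity maps. Ore extensions: for a $k$-algebra $R$ and a derivation $\delta$ of $R$ ($\delta(rs)=\delta(r)s+r\delta(s)$), $R[x;1,\delta]$ is the algebra with underlying vector space $R[x]$ and multiplication determined by that of $R$ and $k[x]$ and the relation $xr=rx+\delta(r)$ for $r\in R$. The iterated Ore extension $k[x_1,\ldots,x_t;\delta_2,\ldots,\delta_t]$ is $(\cdots(k[x_1][x_2;1,\delta_2])\cdots)[x_t;1,\delta_t]=k\langle x_1,\ldots,x_t\rangle/(x_jx_i-x_ix_j-\delta_j(x_i):1\le i<j\le t)$; as a vector space it is $k[x_1,\ldots,x_t]$. It is assumed that $S$ is a filtered algebra with $\deg(x_i)=1$ for all $i$; then each $\delta_j$ is a filtered map, i.e. $\delta_j(x_i)\in k\oplus\mathrm{Span}_k\{x_1,\ldots,x_{j-1}\}$ for $i<j$. The algebra $S$ is the twisted tensor product $A\otimes_\tau B$ with $A=k[x_1,\ldots,x_{t-1};\delta_2,\ldots,\delta_{t-1}]$, $B=k[x_t]$, and $\tau:B\otimes A\to A\otimes B$ the twisting map determined by $\tau(x_t\otimes a)=a\otimes x_t+\delta_t(a)\otimes 1$. Twisted tensor products: a twisting map is a bijective $k$-linear map $\tau:B\otimes A\to A\otimes B$ with $\tau(1_B\otimes a)=a\otimes 1_B$, $\tau(b\otimes 1_A)=1_A\otimes b$, and $\tau(m_B\otimes m_A)=(m_A\otimes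 m_B)(1\otimes\tau\otimes 1)(\tau\otimes\tau)(1\otimes\tau\otimes 1)$; $A\otimes_\tau B$ is $A\otimes B$ with multiplication $(m_A\otimes m_B)(1\otimes\tau\otimes 1)$. Compatibility: an $A$-bimodule $P$ with structure map $\rho:A\otimes P\otimes A\to P$ is compatible with $\tau$ via a bijective $k$-linear map $\tau_{B,P}:B\otimes P\to P\otimes B$ if $\tau_{B,P}(m_B\otimes 1)=(1\otimes m_B)(\tau_{B,P}\otimes 1)(1\otimes\tau_{B,P})$ and $\tau_{B,P}(1\otimes\rho)=(\rho\otimes 1)(1\otimes 1\otimes\tau)(1\otimes\tau_{B,P}\otimes 1)(\tau\otimes 1\otimes 1)$. A $B$-bimodule $Q$ with structure map $\rho:B\otimes Q\otimes B\to Q$ is compatible with $\tau$ via a bijective $k$-linear map $\tau_{Q,A}:Q\otimes A\to A\otimes Q$ if $\tau_{Q,A}(1\otimes m_A)=(m_A\otimes 1)(1\otimes\tau_{Q,A})(\tau_{Q,A}\otimes 1)$ and $\tau_{Q,A}(\rho\otimes 1)=(1\otimes\rho)(\tau\otimes 1\otimes 1)(1\otimes\tau_{Q,A}\otimes 1)(1\otimes 1\otimes\tau)$. In particular $A$ and $B$ are compatible with $\tau$ via $\tau$ itself. Projective bimodule resolutions $P_\bullet$ of $A$ and $Q_\bullet$ of $B$ are compatible with $\tau$ if each term is compatible with $\tau$ via maps $\tau_{B,P_i}$ (resp. $\tau_{Q_j,A}$) forming a $k$-linear chain map lifting $\tau$. Twisted product complex: for compatible resolutions $P_\bullet$ of $A$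 and $Q_\bullet$ of $B$, it is the total complex with $n$th term $\bigoplus_{i+j=n}P_i\otimes Q_j$ and differential $d_i\otimes 1+(-1)^i\,1\otimes d_j$ on $P_i\otimes Q_j$, each $P_i\otimes Q_j$ being an $A\otimes_\tau B$-bimodule via $(\rho_{A,P_i}\otimes\rho_{B,Q_j})(1\otimes 1\otimes\tau\otimes 1\otimes 1)(1\otimes\tau_{B,P_i}\otimes\tau_{Q_j,A}\otimes 1):(A\otimes B)\otimes P_i\otimes Q_j\otimes(A\otimes B)\to P_i\otimes Q_j$; it is augmented to $A\otimes_\tau B$. Iterated twisted product resolution: for $t=1$, the Koszul resolution $0\to k[x_1]\otimes\mathrm{Span}_k\{x_1\}\otimes k[x_1]\xrightarrow{d_1}k[x_1]\otimes k[x_1]\xrightarrow{m}k[x_1]\to 0$, $d_1(1\otimes x_1\otimes 1)=x_1\otimes 1-1\otimes x_1$, $m$ multiplication; for $t\ge 2$, (up to isomorphism of complexes of $S$-bimodules) the twisted product complex of an iterated twisted product resolution of $A=k[x_1,\ldots,x_{t-1};\delta_2,\ldots,\delta_{t-1}]$ and the Koszul resolution (same form, with $x_t$ in place of $x_1$) of $B=k[x_t]$, for some choice of maps making both compatible with $\tau$. *)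

(* Defs.v *)
From HB Require Import structures.
From mathcomp Require Import all_boot all_order all_algebra.
From mathcomp Require Import boolp.

Set Implicit Arguments.
Unset Strict Implicit.
Unset Printing Implicit Defensive.

Import GRing.Theory.
Local Open Scope ring_scope.
Local Open Scope quotient_scope.

(* [univ C] is the target of the universal map [ugen : X -> univ C] among the
   maps of the class [C] from [X] to [k]-vector spaces: formal linear
   combinations of elements of [X], modulo those relations that hold under
   every map of the class [C].  It is used below for tensor products ([C] =
   bilinear maps) and exterior powers ([C] = alternating multilinear maps). *)
Section UniversalModule.
Variables (k : fieldType) (X : choiceType).
Variable C : forall W : lmodType k, (X -> W) -> Prop.

Definition ueval (W : lmodType k) (f : X -> W) (s : seq (k * X)) : W :=
  \sum_(cx <- s) cx.1 *: f cx.2.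

Definition ueq (s s' : seq (k * X)) : bool :=
  `[< forall (W : lmodType k) (f : X -> W), C f -> ueval f s = ueval f s' >].

Lemma ueq_refl : reflexive ueq.
Proof. by move=> s; apply/asboolP. Qed.

Lemma ueq_sym : symmetric ueq.
Proof.
by move=> s s'; apply/asboolP/asboolP => h W f Cf; rewrite h.
Qed.

Lemma ueq_trans : transitive ueq.
Proof.
move=> s2 s1 s3 /asboolP h12 /asboolP h23; apply/asboolP => W f Cf.
by rewrite h12 ?h23.
Qed.

Canonical ueq_equiv := EquivRel ueq ueq_refl ueq_sym ueq_trans.

Definition univ_carrier := {eq_quot ueq}.
HB.instance Definition _ := Choice.on univ_carrier.
HB.instance Definition _ := EqQuotient.on univ_carrier.

Definition ulift (W : lmodType k) (f : X -> W) (x : univ_carrier) : W :=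
  ueval f (repr x).

Lemma ulift_pi (W : lmodType k) (f : X -> W) s : C f -> ulift f (\pi_univ_carrier s) = ueval f s.
Proof.
move=> Cf; rewrite /ulift; case: piP => s' /eqmodP /asboolP h.
by rewrite h.
Qed.

Lemma univ_sep (x y : univ_carrier) :
  (forall (W : lmodType k) (f : X -> W), C f -> ulift f x = ulift f y) -> x = y.
Proof.
move=> h; rewrite -[x]reprK -[y]reprK; apply/eqmodP/asboolP => W f Cf.
exact: h.
Qed.

Definition uadd (x y : univ_carrier) : univ_carrier := \pi_univ_carrier (repr x ++ repr y).
Definition uzero : univ_carrier := \pi_univ_carrier [::].
Definition uscale (c : k) (x : univ_carrier) : univ_carrier :=
  \pi_univ_carrier [seq (c * s.1, s.2) | s <- repr x].
Definition uopp := uscale (-1).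

Lemma ulift_add (W : lmodType k) (f : X -> W) x y :
  C f -> ulift f (uadd x y) = ulift f x + ulift f y.
Proof. by move=> Cf; rewrite ulift_pi // /ueval big_cat. Qed.

Lemma ulift_zero (W : lmodType k) (f : X -> W) : C f -> ulift f uzero = 0.
Proof. by move=> Cf; rewrite ulift_pi // /ueval big_nil. Qed.

Lemma ulift_scale (W : lmodType k) (f : X -> W) c x :
  C f -> ulift f (uscale c x) = c *: ulift f x.
Proof.
move=> Cf; rewrite ulift_pi // /ulift /ueval big_map scaler_sumr.
by apply: eq_bigr => i _; rewrite scalerA.
Qed.

Let uE := (ulift_add, ulift_zero, ulift_scale).

Fact uaddA : associative uadd.
Proof. by move=> x y z; apply: univ_sep => W f Cf; rewrite !uE // addrA. Qed.
Fact uaddC : commutative uadd.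
Proof. by move=> x y; apply: univ_sep => W f Cf; rewrite !uE // addrC. Qed.
Fact uadd0 : left_id uzero uadd.
Proof. by move=> x; apply: univ_sep => W f Cf; rewrite !uE // add0r. Qed.
Fact uaddN : left_inverse uzero uopp uadd.
Proof.
by move=> x; apply: univ_sep => W f Cf; rewrite !uE // scaleN1r addNr.
Qed.
HB.instance Definition _ :=
  GRing.isZmodule.Build univ_carrier uaddA uaddC uadd0 uaddN.

Fact uscaleA a b x : uscale a (uscale b x) = uscale (a * b) x.
Proof. by apply: univ_sep => W f Cf; rewrite !uE // scalerA. Qed.
Fact uscale1 : left_id 1 uscale.
Proof. by move=> x; apply: univ_sep => W f Cf; rewrite !uE // scale1r. Qed.
Fact uscaleDr : right_distributive uscale +%R.
Proof. by move=> a x y; apply: univ_sep => W f Cf; rewrite !uE // scalerDr. Qed.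
Fact uscaleDl x : {morph uscale^~ x : a b / a + b}.
Proof. by move=> a b; apply: univ_sep => W f Cf; rewrite !uE // scalerDl. Qed.
HB.instance Definition _ := GRing.Zmodule_isLmodule.Build k univ_carrier
  uscaleA uscale1 uscaleDr uscaleDl.

Definition univ : lmodType k := univ_carrier.

Definition ugen (x : X) : univ := \pi_univ_carrier [:: (1, x)].

Lemma ulift_linear (W : lmodType k) (f : X -> W) :
  C f -> linear (ulift f : univ -> W).
Proof. by move=> Cf c x y; rewrite !uE. Qed.

Lemma ulift_gen (W : lmodType k) (f : X -> W) x :
  C f -> ulift f (ugen x) = f x.
Proof. by move=> Cf; rewrite ulift_pi // /ueval big_seq1 scale1r. Qed.

Lemma univ_span (x : univ) :
  exists s : seq (k * X), x = \sum_(cx <- s) cx.1 *: ugen cx.2.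
Proof.
exists (repr (x : univ_carrier)); apply: univ_sep => W f Cf.
pose g : {linear univ -> W} :=
  HB.pack (ulift f : univ -> W) (GRing.isLinear.Build _ _ _ _ _ (ulift_linear Cf)).
have -> : ulift f x = \sum_(cx <- repr (x : univ_carrier)) cx.1 *: f cx.2 by [].
rewrite -[RHS]/(g _) linear_sum.
by apply: eq_bigr => i _; rewrite linearZ [g _]ulift_gen.
Qed.

Lemma univ_ext (W : lmodType k) (f g : {linear univ -> W}) :
  (forall x, f (ugen x) = g (ugen x)) -> f =1 g.
Proof.
move=> h x; have [s ->] := univ_span x; rewrite !linear_sum.
by apply: eq_bigr => i _; rewrite !linearZ h.
Qed.

End UniversalModule.

Arguments ugen {k X C} x.

Section Bilinear.
Variable k : fieldType.
Implicit Types U V W : lmodType k.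

Definition bilin U V W (f : U -> V -> W) : Prop :=
  (forall v, linear (fun u => f u v)) /\ (forall u, linear (f u)).

Definition tensor U V : lmodType k :=
  @univ k (U * V)%type (fun W f => bilin (fun u v => f (u, v))).

Definition tpure U V (u : U) (v : V) : tensor U V := ugen (u, v).

(* The linear map [tensor U V -> W] induced by [f], meaningful when [f] is
   bilinear. *)
Definition tlift U V W (f : U -> V -> W) (x : tensor U V) : W :=
  ulift (fun uv : U * V => f uv.1 uv.2) x.

Lemma tlift_linear U V W (f : U -> V -> W) : bilin f -> linear (tlift f).
Proof. by move=> bf; apply: ulift_linear. Qed.

Lemma tlift_pure U V W (f : U -> V -> W) u v :
  bilin f -> tlift f (tpure u v) = f u v.
Proof. by move=> bf; rewrite /tlift ulift_gen. Qed.

Lemma tpure_bilin U V : bilin (@tpure U V).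
Proof.
split=> [v c u u'|u c v v']; apply: univ_sep => W f [fl fr];
  rewrite (ulift_linear (C := fun W f => bilin (fun u v => f (u, v)))) //;
  by rewrite !(ulift_gen (C := fun W f => bilin (fun u v => f (u, v)))) //
    ?fl ?fr.
Qed.

Lemma tensor_ext U V W (f g : {linear tensor U V -> W}) :
  (forall u v, f (tpure u v) = g (tpure u v)) -> f =1 g.
Proof. by move=> h; apply: univ_ext => -[u v]; apply: h. Qed.

Lemma bilin_comp U V W W' (g : {linear W -> W'}) (f : U -> V -> W) :
  bilin f -> bilin (fun u v => g (f u v)).
Proof.
case=> fl fr.
by split=> [v c u u'|u c v v']; rewrite ?fl ?fr linearP.
Qed.

Lemma bilin_pre U V U' V' W (a : {linear U' -> U}) (b : {linear V' -> V})
    (f : U -> V -> W) :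
  bilin f -> bilin (fun u v => f (a u) (b v)).
Proof.
by case=> fl fr; split=> [v c u u'|u c v v']; rewrite linearP ?fl ?fr.
Qed.

End Bilinear.

Notation "U ⊗ V" := (tensor U V) (at level 40, left associativity).
Notation "u ⊗ₜ v" := (tpure u v) (at level 40, left associativity).

Section TensorMaps.
Variable k : fieldType.
Implicit Types U V W : lmodType k.

Definition tmap U V U' V' (f : U -> U') (g : V -> V') : U ⊗ V -> U' ⊗ V' :=
  tlift (fun u v => f u ⊗ₜ g v).

Section TmapLinear.
Variables (U V U' V' : lmodType k).
Variables (f : {linear U -> U'}) (g : {linear V -> V'}).

Fact tmap_bilin : bilin (fun u v => f u ⊗ₜ g v).
Proof. exact: bilin_pre (tpure_bilin _ _). Qed.
HB.instance Definition _ := GRing.isLinear.Build k _ _ _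
  (tmap f g) (tlift_linear tmap_bilin).

Lemma tmap_pure u v : tmap f g (u ⊗ₜ v) = f u ⊗ₜ g v.
Proof. exact: tlift_pure tmap_bilin. Qed.
End TmapLinear.

Fact tassoc_in_bilin U V W (u : U) :
  bilin (fun (v : V) (w : W) => u ⊗ₜ v ⊗ₜ w).
Proof.
have [h1 h2] := tpure_bilin (tensor U V) W; have [_ h3] := tpure_bilin U V.
by split=> [w c v v'|v]; [rewrite h3 h1 | exact: h2].
Qed.

Fact tassocV_in_bilin U V W (w : W) :
  bilin (fun (u : U) (v : V) => u ⊗ₜ (v ⊗ₜ w)).
Proof.
have [h1 h2] := tpure_bilin U (tensor V W); have [h3 _] := tpure_bilin V W.
by split=> [v|u c v v']; [exact: h1 | rewrite h3 h2].
Qed.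

Definition tassoc U V W : U ⊗ (V ⊗ W) -> (U ⊗ V) ⊗ W :=
  tlift (fun u => tlift (fun v w => u ⊗ₜ v ⊗ₜ w)).
Definition tassocV U V W : (U ⊗ V) ⊗ W -> U ⊗ (V ⊗ W) :=
  tlift (fun x w => tlift (fun u v => u ⊗ₜ (v ⊗ₜ w)) x).

Fact lin_comb W (a c : k) (x x' y y' : W) :
  c *: (a *: x + y) + (a *: x' + y') = a *: (c *: x + x') + (c *: y + y').
Proof. by rewrite !scalerDr !scalerA [c * a]mulrC addrACA. Qed.

Definition mk_linear U W (f : U -> W) (hf : linear f) : {linear U -> W} :=
  HB.pack f (GRing.isLinear.Build k U W _ f hf).

Fact tassoc_bilin U V W :
  bilin (fun (u : U) => tlift (fun (v : V) (w : W) => u ⊗ₜ v ⊗ₜ w)).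
Proof.
split=> [x c u u'|u]; last exact (tlift_linear (tassoc_in_bilin V W u)).
pose g (u : U) := mk_linear (tlift_linear (tassoc_in_bilin V W u)).
change (g (c *: u + u') x = c *: g u x + g u' x).
have hg : linear (fun x => c *: g u x + g u' x).
  by move=> a y z; rewrite !(linearP (g _)); apply: lin_comb.
move: x; apply: (tensor_ext (f := g _) (g := mk_linear hg)) => v w /=.
rewrite !tlift_pure; do ?exact: tassoc_in_bilin.
have [h1 h2] := tpure_bilin (tensor U V) W; have [h3 _] := tpure_bilin U V.
by rewrite h3 h1.
Qed.

Fact tassocV_bilin U V W :
  bilin (fun x (w : W) => tlift (fun (u : U) (v : V) => u ⊗ₜ (v ⊗ₜ w)) x).
Proof.
split=> [w|x c w w']; first exact (tlift_linear (tassocV_in_bilin U V w)).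
pose g (w : W) := mk_linear (tlift_linear (tassocV_in_bilin U V w)).
change (g (c *: w + w') x = c *: g w x + g w' x).
have hg : linear (fun x => c *: g w x + g w' x).
  by move=> a y z; rewrite !(linearP (g _)); apply: lin_comb.
move: x; apply: (tensor_ext (f := g _) (g := mk_linear hg)) => u v /=.
rewrite !tlift_pure; do ?exact: tassocV_in_bilin.
have [h1 h2] := tpure_bilin U (tensor V W); have [_ h3] := tpure_bilin V W.
by rewrite h3 h2.
Qed.

HB.instance Definition _ U V W := GRing.isLinear.Build k _ _ _
  (@tassoc U V W) (tlift_linear (tassoc_bilin U V W)).
HB.instance Definition _ U V W := GRing.isLinear.Build k _ _ _
  (@tassocV U V W) (tlift_linear (tassocV_bilin U V W)).

Lemma tassoc_pure U V W (u : U) (v : V) (w : W) :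
  tassoc (u ⊗ₜ (v ⊗ₜ w)) = u ⊗ₜ v ⊗ₜ w.
Proof.
rewrite /tassoc tlift_pure; last exact: tassoc_bilin.
by rewrite tlift_pure //; apply: tassoc_in_bilin.
Qed.

Lemma tassocV_pure U V W (u : U) (v : V) (w : W) :
  tassocV (u ⊗ₜ v ⊗ₜ w) = u ⊗ₜ (v ⊗ₜ w).
Proof.
rewrite /tassocV tlift_pure; last exact: tassocV_bilin.
by rewrite tlift_pure //; apply: tassocV_in_bilin.
Qed.

(* The map [1 ⊗ f ⊗ 1], for [f : V ⊗ W -> V' ⊗ W'], with bracketing adapted
   to compositions with [tmap]. *)
Definition tmid U V W V' W' X (f : V ⊗ W -> V' ⊗ W') :
    (U ⊗ V) ⊗ (W ⊗ X) -> (U ⊗ V') ⊗ (W' ⊗ X) :=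
  @tassoc U V' (W' ⊗ X) \o
  tmap idfun (@tassocV V' W' X \o tmap f idfun \o @tassoc V W X) \o
  @tassocV U V (W ⊗ X).

Section TmidLinear.
Variables (U V W V' W' X : lmodType k) (f : {linear V ⊗ W -> V' ⊗ W'}).
HB.instance Definition _ := GRing.Linear.on (@tmid U V W V' W' X f).
End TmidLinear.

End TensorMaps.

Section Exterior.
Variables (k : fieldType) (n : nat) (V : lmodType k).

Definition ffun_upd (v : {ffun 'I_n -> V}) (i : 'I_n) (x : V) :=
  [ffun j => if j == i then x else v j].

Definition alternating (W : lmodType k) (f : {ffun 'I_n -> V} -> W) : Prop :=
  (forall (v : {ffun 'I_n -> V}) i, linear (fun x => f (ffun_upd v i x))) /\
  (forall (v : {ffun 'I_n -> V}) i j, i != j -> v i = v j -> f v = 0).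

Definition extpow : lmodType k := @univ k {ffun 'I_n -> V} alternating.

Definition wedge (v : 'I_n -> V) : extpow := ugen [ffun i => v i].

Lemma wedge_alternating : alternating (fun v : {ffun 'I_n -> V} => wedge v).
Proof.
have wE (W : lmodType k) (f : {ffun 'I_n -> V} -> W) (v : {ffun 'I_n -> V}) :
    alternating f -> ulift f (wedge v) = f v.
  move=> af; rewrite /wedge (ulift_gen (C := alternating)) //.
  by congr f; apply/ffunP => i; rewrite ffunE.
split=> [v i c x y|v i j ij eq_v]; apply: univ_sep => W f af.
  rewrite (ulift_linear (C := alternating)) // !wE //.
  by case: af => fl _; rewrite fl.
rewrite wE // (ulift_zero (C := alternating)) //.
by case: af => _ f0; apply: f0 ij eq_v.
Qed.

Lemma extpow_lift (W : lmodType k) (f : {ffun 'I_n -> V} -> W) :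
  alternating f ->
  exists g : {linear extpow -> W}, forall v : {ffun 'I_n -> V}, g (wedge v) = f v.
Proof.
move=> af; exists (mk_linear (ulift_linear (C := alternating) af)) => v /=.
rewrite /wedge (ulift_gen (C := alternating)) //.
by congr f; apply/ffunP => i; rewrite ffunE.
Qed.

End Exterior.

Section Span.
Variables (k : fieldType) (t : nat) (E : lmodType k) (x : 'I_t -> E).

Definition in_span : {pred E} :=
  [pred v | `[< exists c : 'I_t -> k, v = \sum_i c i *: x i >]].

Fact in_span_closed : submod_closed in_span.
Proof.
split=> [|a u v /asboolP[c ->] /asboolP[c' ->]]; apply/asboolP.
  by exists (fun=> 0); rewrite big1 // => i _; rewrite scale0r.
exists (fun i => a * c i + c' i).
rewrite scaler_sumr -big_split; apply: eq_bigr => i _.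
by rewrite scalerA scalerDl.
Qed.
HB.instance Definition _ := GRing.isSubmodClosed.Build k E in_span
  in_span_closed.

Record span_type := Span { span_val :> E; _ : span_val \in in_span }.
HB.instance Definition _ := [isSub for span_val].
HB.instance Definition _ := [Choice of span_type by <:].
HB.instance Definition _ := [SubChoice_isSubLmodule of span_type by <:].

Definition kspan : lmodType k := span_type.

Fact span_gen_in i : x i \in in_span.
Proof.
apply/asboolP; exists (fun j => (j == i)%:R).
rewrite (bigD1 i) //= eqxx scale1r big1 ?addr0 // => j /negPf ->.
exact: scale0r.
Qed.

Definition span_gen (i : 'I_t) : kspan := Span (span_gen_in i).

End Span.

Record derivation (k : fieldType) (R : algType k) := Derivation {
  der_map :> {linear R -> R};
  der_leibniz : forall r s, der_map (r * s) = der_map r * s + r * der_map s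
}.

Section OreExtension.
Variables (k : fieldType) (R : algType k) (δ : derivation R).

Definition ore_carrier : Type := {poly R}.
HB.instance Definition _ := GRing.Zmodule.copy ore_carrier {poly R}.

(* Left multiplication by [x]: the relation [x r = r x + δ r] gives
   [x (\sum_j r_j x^j) = \sum_j r_j x^(j+1) + \sum_j (δ r_j) x^j]. *)
Definition ore_mulx (q : {poly R}) : {poly R} := q * 'X + map_poly δ q.

Definition ore_mul (p q : ore_carrier) : ore_carrier :=
  \sum_(i < size (p : {poly R})) (p : {poly R})`_i *: iter i ore_mulx q.

Definition ore_one : ore_carrier := (1 : {poly R}).

Definition ore_scale (c : k) (p : ore_carrier) : ore_carrier :=
  (c%:A : R) *: (p : {poly R}).

Fact der1 : δ 1 = 0.
Proof.
have := der_leibniz δ 1 1; rewrite !mulr1 mul1r => /esym/eqP.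
by rewrite -subr_eq0 addrK => /eqP.
Qed.

Fact ore_mulx_is_additive : additive ore_mulx.
Proof. by move=> p q; rewrite /ore_mulx mulrBl raddfB opprD addrACA. Qed.
HB.instance Definition _ := GRing.isAdditive.Build _ _ ore_mulx
  ore_mulx_is_additive.

Fact ore_mulxZ r q : ore_mulx (r *: q) = r *: ore_mulx q + δ r *: q.
Proof.
rewrite /ore_mulx scalerDr -scalerAl -addrA; congr (_ + _).
apply/polyP => i; rewrite !(coefD, coefZ, coef_map) /= der_leibniz.
exact: addrC.
Qed.

Fact ore_iterD i p q :
  iter i ore_mulx (p + q) = iter i ore_mulx p + iter i ore_mulx q.
Proof. by elim: i => //= i ->; rewrite raddfD. Qed.

Fact ore_iter1 i : iter i ore_mulx 1 = 'X^i.
Proof.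
elim: i => //= i ->; rewrite /ore_mulx -exprSr -[RHS]addr0; congr (_ + _).
apply/polyP => j; rewrite coef_map /= coefXn coef0.
by case: eqP => _; rewrite ?der1 ?raddf0.
Qed.

Fact ore_iterZ i (c : k) q :
  iter i ore_mulx (c%:A *: q) = c%:A *: iter i ore_mulx q.
Proof.
elim: i => //= i ->; rewrite ore_mulxZ.
have -> : δ c%:A = 0 by rewrite linearZ /= der1 scaler0.
by rewrite scale0r addr0.
Qed.

Fact ore_mul_wide n (p q : {poly R}) : (size p <= n)%N ->
  ore_mul p q = \sum_(i < n) p`_i *: iter i ore_mulx q.
Proof.
move=> le_pn; rewrite /ore_mul (big_ord_widen n (fun i => p`_i *: iter i ore_mulx q)) //.
rewrite big_mkcond; apply: eq_bigr => i _; case: ltnP => // le_pi.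
by rewrite nth_default // scale0r.
Qed.

Fact ore_mulDl : left_distributive ore_mul +%R.
Proof.
move=> p q r; pose n := maxn (size (p : {poly R})) (size (q : {poly R})).
have hp : (size (p : {poly R}) <= n)%N by apply: leq_maxl.
have hq : (size (q : {poly R}) <= n)%N by apply: leq_maxr.
have hpq : (size ((p + q)%R : {poly R}) <= n)%N.
  exact: leq_trans (size_polyD _ _) _.
rewrite (ore_mul_wide _ hp) (ore_mul_wide _ hq) (ore_mul_wide _ hpq).
rewrite -big_split; apply: eq_bigr => i _.
by rewrite coefD scalerDl.
Qed.

Fact ore_mulDr : right_distributive ore_mul +%R.
Proof.
move=> p q r; rewrite /ore_mul -big_split; apply: eq_bigr => i _.
by rewrite ore_iterD scalerDr.
Qed.

Fact ore_mul1r : left_id ore_one ore_mul.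
Proof.
move=> q; rewrite /ore_mul /ore_one size_poly1 big_ord1 coef1 /=.
exact: scale1r.
Qed.

Fact ore_mulr1 : right_id ore_one ore_mul.
Proof.
move=> p; rewrite /ore_mul /ore_one -[RHS](coefK (p : {poly R})) poly_def.
by apply: eq_bigr => i _; rewrite ore_iter1.
Qed.

Fact ore_scale_mull r (p q : {poly R}) :
  ore_mul (r *: p) q = r *: ore_mul p q.
Proof.
rewrite (ore_mul_wide _ (size_scale_leq r p)) (ore_mul_wide _ (leqnn _)).
by rewrite scaler_sumr; apply: eq_bigr => i _; rewrite coefZ scalerA.
Qed.

Fact ore_mul_mulX (p q : {poly R}) :
  ore_mul (p * 'X) q = ore_mul p (ore_mulx q).
Proof.
have h : (size (p * 'X)%R <= (size p).+1)%N.
  by rewrite (leq_trans (size_polyMleq _ _)) // size_polyX addn2.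
rewrite (ore_mul_wide _ h) big_ord_recl coefMX /= scale0r add0r.
by apply: eq_bigr => i _; rewrite coefMX /= -iterSr.
Qed.

Fact ore_mulx_mul (p q : {poly R}) :
  ore_mulx (ore_mul p q) = ore_mul (ore_mulx p) q.
Proof.
have hm : (size (map_poly δ p) <= size p)%N by apply: size_poly.
rewrite {2}/ore_mulx [RHS]ore_mulDl ore_mul_mulX (ore_mul_wide _ hm).
rewrite [X in _ = X + _]/ore_mul -big_split raddf_sum.
by apply: eq_bigr => i _; rewrite [LHS]ore_mulxZ coef_map -iterS iterSr.
Qed.

Fact ore_mulA : associative ore_mul.
Proof.
move=> p q r; apply/esym; rewrite [ore_mul p q]/ore_mul.
have h0 : ore_mul 0 r = 0 by rewrite /ore_mul size_poly0 big_ord0.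
rewrite (big_morph (ore_mul^~ r) (fun x y => ore_mulDl x y r) h0).
apply: eq_bigr => i _; rewrite ore_scale_mull; congr (_ *: _).
by elim: (i : nat) => //= j IH; rewrite -ore_mulx_mul IH.
Qed.

Fact ore_one_neq0 : ore_one != 0.
Proof. exact: oner_neq0. Qed.

HB.instance Definition _ := GRing.Zmodule_isNzRing.Build ore_carrier
  ore_mulA ore_mul1r ore_mulr1 ore_mulDl ore_mulDr ore_one_neq0.

Fact ore_scaleA a b p : ore_scale a (ore_scale b p) = ore_scale (a * b) p.
Proof. by rewrite /ore_scale scalerA -scalerAl mul1r scalerA. Qed.
Fact ore_scale1 : left_id 1 ore_scale.
Proof. by move=> p; rewrite /ore_scale !scale1r. Qed.
Fact ore_scaleDr : right_distributive ore_scale +%R.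
Proof. by move=> a p q; apply: scalerDr. Qed.
Fact ore_scaleDl p : {morph ore_scale^~ p : a b / a + b}.
Proof. by move=> a b; rewrite /ore_scale !scalerDl. Qed.
HB.instance Definition _ := GRing.Zmodule_isLmodule.Build k ore_carrier
  ore_scaleA ore_scale1 ore_scaleDr ore_scaleDl.

Fact ore_scaleAl (a : k) (p q : ore_carrier) : a *: (p * q) = (a *: p) * q.
Proof. by rewrite [RHS]ore_scale_mull. Qed.
HB.instance Definition _ := GRing.Lmodule_isLalgebra.Build k ore_carrier
  ore_scaleAl.

Fact ore_scaleAr (a : k) (p q : ore_carrier) : a *: (p * q) = p * (a *: q).
Proof.
rewrite [LHS]scaler_sumr; apply: eq_bigr => i _.
apply: etrans (congr1 (GRing.scale _) (esym (ore_iterZ i a q))).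
rewrite [RHS]scalerA [LHS]scalerA; congr (_ *: _).
by rewrite -scalerAl -scalerAr mul1r mulr1.
Qed.
HB.instance Definition _ := GRing.Lalgebra_isAlgebra.Build k ore_carrier
  ore_scaleAr.

Definition ore : algType k := ore_carrier.

Definition ore_inc (r : R) : ore := (r%:P : {poly R}).
Definition ore_x : ore := ('X : {poly R}).

Fact ore_mul_X (q : {poly R}) : ore_mul 'X q = ore_mulx q.
Proof.
have /= := ore_mul_mulX 1 q; rewrite mul1r => ->.
exact: (ore_mul1r (ore_mulx q)).
Qed.

Fact ore_mul_C r (q : {poly R}) : ore_mul r%:P q = r *: q.
Proof.
by have := ore_scale_mull r 1 q; rewrite -mul_polyC mulr1 => ->; rewrite ore_mul1r.
Qed.

Lemma ore_rel (r : R) : ore_x * ore_inc r = ore_inc r * ore_x + ore_inc (δ r).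
Proof.
apply: etrans (ore_mul_X _) _.
rewrite /ore_mulx map_polyC mul_polyC; congr (_ + _).
by apply: esym; apply: ore_mul_C.
Qed.

Fact ore_inc_linear : linear ore_inc.
Proof.
move=> c r s; rewrite /ore_inc polyCD; congr (_ + _).
by rewrite -[in LHS](mul1r r) scalerAl polyCM mul_polyC.
Qed.
HB.instance Definition _ := GRing.isLinear.Build k R ore _ ore_inc
  ore_inc_linear.

Lemma ore_incM r s : ore_inc (r * s) = ore_inc r * ore_inc s.
Proof.
by apply: esym; apply: etrans (ore_mul_C _ _) _; rewrite -mul_polyC -polyCM.
Qed.

Lemma ore_monomial (r : R) (i : nat) :
  ore_inc r * ore_x ^+ i = (r *: 'X^i : {poly R}).
Proof.
have hX : ore_x ^+ i = ('X^i : {poly R}) :> ore_carrier.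
  elim: i => [|i IH]; first by rewrite !expr0.
  rewrite exprS; apply: etrans (ore_mul_X _) _; rewrite IH -[RHS]ore_iter1.
  by rewrite -ore_iter1.
rewrite hX; exact: ore_mul_C.
Qed.

End OreExtension.

(* An algebra with generators [x_1, ..., x_t], indexed from [0], together with
   the images [ga_der j i] in it of the elements [δ_j(x_i)], for [i < j]. *)
Record gen_alg (k : fieldType) (t : nat) := GenAlg {
  ga_alg :> algType k;
  ga_x : 'I_t -> ga_alg;
  ga_der : 'I_t -> 'I_t -> ga_alg
}.

Section IteratedOre.
Variable k : fieldType.

Definition gen_poly : gen_alg k 1 :=
  @GenAlg k 1 {poly k} (fun=> 'X) (fun _ _ => 0).

Definition gen_ore t (A : gen_alg k t) (δ : derivation A) : gen_alg k t.+1 :=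
  @GenAlg k t.+1 (ore δ)
    (fun i => if unlift ord_max i is Some i' then ore_inc δ (ga_x A i')
              else ore_x δ)
    (fun j i => match unlift ord_max j, unlift ord_max i with
                | Some j', Some i' => ore_inc δ (ga_der A j' i')
                | None, Some i' => ore_inc δ (δ (ga_x A i'))
                | _, None => 0
                end).

Inductive filtered_iterated_ore : forall t, gen_alg k t -> Prop :=
| FilteredPoly : filtered_iterated_ore gen_poly
| FilteredOre t (A : gen_alg k t) (δ : derivation A) :
    filtered_iterated_ore A ->
    (forall i : 'I_t, exists (c : k) (v : kspan (ga_x A)),
       δ (ga_x A i) = c%:A + val v) ->
    filtered_iterated_ore (gen_ore δ).

End IteratedOre.

Section Bimodules.
Variables (k : fieldType) (A : algType k).

Fact amul_bilin : bilin (fun a b : A => a * b).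
Proof.
split=> [b c a a'|a c b b']; first by rewrite mulrDl scalerAl.
by rewrite mulrDr scalerAr.
Qed.

Definition amul : A ⊗ A -> A := tlift (fun a b : A => a * b).
HB.instance Definition _ := GRing.isLinear.Build k _ _ _ amul
  (tlift_linear amul_bilin).

Fact amul_lr_linear (a b : A) : linear (fun x => a * x * b).
Proof. by move=> c x y; rewrite mulrDr mulrDl -scalerAr -scalerAl. Qed.

Lemma amul_pure a b : amul (a ⊗ₜ b) = a * b.
Proof. exact: tlift_pure amul_bilin. Qed.

(* The structure map [bim_act] is the map [ρ : A ⊗ P ⊗ A -> P] that sends
   [a ⊗ p ⊗ b] to [a p b]; the two axioms say that the left and right actions
   are unital, associative and commute with each other. *)
Record bimodule := Bimodule {
  bim_mod :> lmodType k;
  bim_act : {linear (A ⊗ bim_mod) ⊗ A -> bim_mod};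
  bim_act1 : forall p, bim_act (1 ⊗ₜ p ⊗ₜ 1) = p;
  bim_actA : forall a b p b' a',
    bim_act (a ⊗ₜ bim_act (b ⊗ₜ p ⊗ₜ b') ⊗ₜ a') =
    bim_act ((a * b) ⊗ₜ p ⊗ₜ (b' * a'))
}.

Arguments bim_act {_}.

Definition bim_hom (M N : bimodule) (f : {linear M -> N}) : Prop :=
  forall a m b, f (bim_act (a ⊗ₜ m ⊗ₜ b)) = bim_act (a ⊗ₜ f m ⊗ₜ b).

Definition bim_projective (M : bimodule) : Prop :=
  forall (N N' : bimodule) (g : {linear N -> N'}) (f : {linear M -> N'}),
    bim_hom g -> bim_hom f -> (forall y, exists x, g x = y) ->
    exists h : {linear M -> N}, bim_hom h /\ forall m, g (h m) = f m.

Definition bim_free (M : bimodule) : Prop :=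
  exists (I : Type) (e : I -> M), forall (N : bimodule) (f : I -> N),
    exists h : {linear M -> N},
      [/\ bim_hom h, forall i, h (e i) = f i &
          forall h' : {linear M -> N}, bim_hom h' ->
            (forall i, h' (e i) = f i) -> h' =1 h].

(* Complexes [... -> M 1 -> M 0 -> A] of bimodules with terms [M]. *)
Record acomplex (M : nat -> bimodule) := AComplex {
  cdif : forall n, {linear M n.+1 -> M n};
  caug : {linear M 0 -> A};
  cdif_hom : forall n, bim_hom (cdif n);
  caug_hom : forall a m b,
    caug (bim_act (a ⊗ₜ m ⊗ₜ b)) = a * caug m * b;
  cdif_cdif : forall n x, cdif n (cdif n.+1 x) = 0;
  caug_cdif : forall x, caug (cdif 0 x) = 0
}.

Definition resolution (M : nat -> bimodule) (K : acomplex M) : Prop :=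
  [/\ forall a, exists x, caug K x = a,
      forall x, caug K x = 0 -> exists y, cdif K 0 y = x &
      forall n x, cdif K n x = 0 -> exists y, cdif K n.+1 y = x].

Definition projective_resolution M (K : acomplex M) : Prop :=
  resolution K /\ forall n, bim_projective (M n).

Definition free_resolution M (K : acomplex M) : Prop :=
  resolution K /\ forall n, bim_free (M n).

Definition acomplex_iso M N (K : acomplex M) (L : acomplex N) : Prop :=
  exists φ : forall n, {linear M n -> N n},
    [/\ forall n, bijective (φ n), forall n, bim_hom (φ n),
        forall n x, φ n (cdif K n x) = cdif L n (φ n.+1 x) &
        forall x, caug L (φ 0%N x) = caug K x].

Definition tpurer (U V : lmodType k) (v : V) : {linear U -> U ⊗ V} :=
  mk_linear ((tpure_bilin U V).1 v).
Definition tpurel (U V : lmodType k) (u : U) : {linear V -> U ⊗ V} :=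
  mk_linear ((tpure_bilin U V).2 u).

Lemma bim_act0 (M : bimodule) (a b : A) : bim_act (a ⊗ₜ (0 : M) ⊗ₜ b) = 0.
Proof. exact: (linear0 (bim_act \o tpurer (A ⊗ M) b \o tpurel M a)). Qed.

Lemma tensor3_ext (U V W X : lmodType k) (f g : {linear U ⊗ V ⊗ W -> X}) :
  (forall u v w, f (u ⊗ₜ v ⊗ₜ w) = g (u ⊗ₜ v ⊗ₜ w)) -> f =1 g.
Proof.
move=> h; apply: tensor_ext => x w; move: x.
apply: (tensor_ext (f := f \o tpurer _ w) (g := g \o tpurer _ w)) => u v.
exact: h.
Qed.

Section FreeBimodule.
Variable W : lmodType k.
Let M := A ⊗ W ⊗ A.

Definition free_act : (A ⊗ M) ⊗ A -> M :=
  tmap (tmap amul idfun) amul \o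
  @tassocV k (A ⊗ A ⊗ W) A A \o
  tmap (tmap (@tassoc k A A W) idfun \o @tassoc k A (A ⊗ W) A) idfun.
HB.instance Definition _ := GRing.Linear.on free_act.

Lemma free_act_pure a b w b' a' :
  free_act (a ⊗ₜ (b ⊗ₜ w ⊗ₜ b') ⊗ₜ a') = (a * b) ⊗ₜ w ⊗ₜ (b' * a').
Proof.
rewrite /free_act /=.
by do 4?rewrite !(tmap_pure, tassoc_pure, tassocV_pure, amul_pure) /=.
Qed.

Definition free_act_at a b : {linear M -> M} :=
  free_act \o tpurer (A ⊗ M) b \o tpurel M a.

Fact free_act1 p : free_act (1 ⊗ₜ p ⊗ₜ 1) = p.
Proof.
move: p; apply: (tensor3_ext (f := free_act_at 1 1) (g := idfun)) => a w b.
by rewrite /= free_act_pure mul1r mulr1.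
Qed.

Fact free_actA a b p b' a' :
  free_act (a ⊗ₜ free_act (b ⊗ₜ p ⊗ₜ b') ⊗ₜ a') =
  free_act ((a * b) ⊗ₜ p ⊗ₜ (b' * a')).
Proof.
move: p; apply: (tensor3_ext (f := free_act_at a a' \o free_act_at b b')
  (g := free_act_at (a * b) (b' * a'))) => u w v.
by rewrite /= !free_act_pure !mulrA.
Qed.

Definition free_bimodule : bimodule :=
  @Bimodule M free_act free_act1 free_actA.
End FreeBimodule.

Definition env_act : (A ⊗ (A ⊗ A)) ⊗ A -> A ⊗ A :=
  tmap amul amul \o @tassocV k (A ⊗ A) A A \o tmap (@tassoc k A A A) idfun.
HB.instance Definition _ := GRing.Linear.on env_act.

Lemma env_act_pure a b b' a' :
  env_act (a ⊗ₜ (b ⊗ₜ b') ⊗ₜ a') = (a * b) ⊗ₜ (b' * a').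
Proof.
rewrite /env_act /=.
by do 4?rewrite !(tmap_pure, tassoc_pure, tassocV_pure, amul_pure) /=.
Qed.

Definition env_act_at a b : {linear A ⊗ A -> A ⊗ A} :=
  env_act \o tpurer (A ⊗ (A ⊗ A)) b \o tpurel (A ⊗ A) a.

Fact env_act1 p : env_act (1 ⊗ₜ p ⊗ₜ 1) = p.
Proof.
move: p; apply: (tensor_ext (f := env_act_at 1 1) (g := idfun)) => a b.
by rewrite /= env_act_pure mul1r mulr1.
Qed.

Fact env_actA a b p b' a' :
  env_act (a ⊗ₜ env_act (b ⊗ₜ p ⊗ₜ b') ⊗ₜ a') =
  env_act ((a * b) ⊗ₜ p ⊗ₜ (b' * a')).
Proof.
move: p; apply: (tensor_ext (f := env_act_at a a' \o env_act_at b b')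
  (g := env_act_at (a * b) (b' * a'))) => u v.
by rewrite /= !env_act_pure !mulrA.
Qed.

Definition env_bimodule : bimodule :=
  @Bimodule (A ⊗ A) env_act env_act1 env_actA.

Definition zero_act : A ⊗ 'rV[k]_0 ⊗ A -> 'rV[k]_0 := fun=> 0.
Fact zero_act_linear : linear zero_act.
Proof. by move=> c x y; rewrite scaler0 addr0. Qed.
HB.instance Definition _ := GRing.isLinear.Build k _ _ _ zero_act
  zero_act_linear.
Fact zero_act1 p : zero_act (1 ⊗ₜ p ⊗ₜ 1) = p.
Proof. by rewrite [p]thinmx0. Qed.

Definition zero_bimodule : bimodule :=
  @Bimodule 'rV[k]_0 zero_act zero_act1 (fun _ _ _ _ _ => erefl).

End Bimodules.

Arguments bim_act {_ _ _}.
Arguments free_bimodule {k} A W.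

Section Koszul.
Variable k : fieldType.
Let B : algType k := {poly k}.
Let V : lmodType k := kspan (fun _ : 'I_1 => 'X : B).

Definition koszul_mod (n : nat) : bimodule B :=
  match n with
  | 0 => env_bimodule B
  | 1 => free_bimodule B V
  | _ => zero_bimodule B
  end.

Definition koszul_mulr : B ⊗ V -> B := @amul k B \o tmap idfun val.
HB.instance Definition _ := GRing.Linear.on koszul_mulr.
Definition koszul_mull : V ⊗ B -> B := @amul k B \o tmap val idfun.
HB.instance Definition _ := GRing.Linear.on koszul_mull.

(* [b ⊗ x ⊗ b'] is mapped to [b x ⊗ b' - b ⊗ x b']. *)
Definition koszul_d1 : {linear koszul_mod 1 -> koszul_mod 0} :=
  tmap koszul_mulr idfun \- (tmap idfun koszul_mull \o @tassocV k B V B).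

Definition koszul_dif (n : nat) :
    {linear koszul_mod n.+1 -> koszul_mod n} :=
  if n is 0 then koszul_d1 else \0.

Lemma koszul_d1_pure b (v : V) b' :
  koszul_d1 (b ⊗ₜ v ⊗ₜ b') = (b * val v) ⊗ₜ b' - b ⊗ₜ (val v * b').
Proof.
rewrite /koszul_d1 /=; do 4?rewrite !(tmap_pure, tassocV_pure) /=.
have -> : koszul_mulr (b ⊗ₜ v) = b * val v.
  apply: etrans (amul_pure _ _); congr amul; exact: tmap_pure.
have -> // : koszul_mull (v ⊗ₜ b') = val v * b'.
apply: etrans (amul_pure _ _); congr amul; exact: tmap_pure.
Qed.

Fact koszul_dif_hom n : bim_hom (koszul_dif n).
Proof.
case: n => [|n] a m b; last by rewrite [RHS]bim_act0.
move: m; apply: (tensor3_ext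
  (f := koszul_d1 \o free_act_at V a b)
  (g := env_act_at a b \o koszul_d1)) => b1 v b2.
apply: etrans (congr1 koszul_d1 (free_act_pure a b1 v b2 b)) _.
apply: etrans (koszul_d1_pure _ _ _) _; apply: esym.
apply: etrans (congr1 (env_act_at a b) (koszul_d1_pure b1 v b2)) _.
by rewrite linearB /= !env_act_pure !mulrA.
Qed.

Definition koszul_aug : {linear koszul_mod 0 -> B} := @amul k B.

Fact koszul_aug_hom a m b :
  koszul_aug (bim_act (a ⊗ₜ m ⊗ₜ b)) = a * koszul_aug m * b.
Proof.
move: m; apply: (tensor_ext (f := koszul_aug \o env_act_at a b)
  (g := mk_linear (amul_lr_linear a b) \o koszul_aug)) => u v /=.
by rewrite env_act_pure !amul_pure !mulrA.
Qed.

Fact koszul_dif_dif n x : koszul_dif n (koszul_dif n.+1 x) = 0.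
Proof. by case: n x => [|n] x //; apply: (linear0 koszul_d1). Qed.

Fact koszul_aug_dif x : koszul_aug (koszul_dif 0 x) = 0.
Proof.
move: x; apply: (tensor3_ext (f := koszul_aug \o koszul_d1) (g := \0)).
move=> b v b'; apply: etrans (congr1 koszul_aug (koszul_d1_pure b v b')) _.
by rewrite linearB /= !amul_pure mulrA subrr.
Qed.

Definition koszul : acomplex koszul_mod :=
  AComplex koszul_dif_hom koszul_aug_hom koszul_dif_dif koszul_aug_dif.

End Koszul.

Section Twisting.
Variables (k : fieldType) (A B : algType k).
Variable τ : {linear B ⊗ A -> A ⊗ B}.

Record twisting : Prop := {
  twist_bij : bijective τ;
  twist1l : forall a : A, τ (1 ⊗ₜ a) = a ⊗ₜ 1;
  twist1r : forall b : B, τ (b ⊗ₜ 1) = 1 ⊗ₜ b;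
  twist_mul : forall z : (B ⊗ B) ⊗ (A ⊗ A),
    τ (tmap (@amul k B) (@amul k A) z) =
    (tmap (@amul k A) (@amul k B) \o tmid τ \o tmap τ τ \o tmid τ) z
}.

Definition twisted_mul : (A ⊗ B) ⊗ (A ⊗ B) -> A ⊗ B :=
  tmap (@amul k A) (@amul k B) \o tmid τ.

(* [ψ] identifies [T] with the twisted tensor product of [A] and [B]. *)
Definition twisted_tensor_iso (T : algType k) (ψ : {linear A ⊗ B -> T}) :=
  [/\ bijective ψ, ψ (1 ⊗ₜ 1) = 1 &
      forall u v, ψ (twisted_mul (u ⊗ₜ v)) = ψ u * ψ v].

(* Here and below [σ] is the map [τ_{B,P}] (resp. [τ_{Q,A}]) of a compatible
   bimodule.  The identities are those of maps on [B ⊗ B ⊗ P] and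
   [B ⊗ A ⊗ P ⊗ A] (resp. [Q ⊗ A ⊗ A] and [B ⊗ Q ⊗ B ⊗ A]), with explicit
   associativity isomorphisms. *)
Record compatible_l (P : bimodule A) (σ : {linear B ⊗ P -> P ⊗ B}) : Prop := {
  compl_bij : bijective σ;
  compl_mul : forall z : B ⊗ B ⊗ P,
    σ (tmap (@amul k B) idfun z) =
    (tmap idfun (@amul k B) \o @tassocV k P B B \o tmap σ idfun \o
     @tassoc k B P B \o tmap idfun σ \o @tassocV k B B P) z;
  compl_act : forall z : (B ⊗ A) ⊗ (P ⊗ A),
    σ ((tmap idfun (bim_act \o @tassoc k A P A) \o
        @tassocV k B A (P ⊗ A)) z) =
    (tmap bim_act idfun \o @tassoc k (A ⊗ P) A B \o tmap idfun τ \o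
     tmid σ \o tmap τ idfun) z
}.

Record compatible_r (Q : bimodule B) (σ : {linear Q ⊗ A -> A ⊗ Q}) : Prop := {
  compr_bij : bijective σ;
  compr_mul : forall z : Q ⊗ (A ⊗ A),
    σ (tmap idfun (@amul k A) z) =
    (tmap (@amul k A) idfun \o @tassoc k A A Q \o tmap idfun σ \o
     @tassocV k A Q A \o tmap σ idfun \o @tassoc k Q A A) z;
  compr_act : forall z : (B ⊗ Q) ⊗ (B ⊗ A),
    σ ((tmap bim_act idfun \o @tassoc k (B ⊗ Q) B A) z) =
    (tmap idfun (bim_act \o @tassoc k B Q B) \o
     @tassocV k A B (Q ⊗ B) \o tmap τ idfun \o tmid σ \o
     tmap idfun τ) z
}.

Record compatible_resolution_l (P : nat -> bimodule A) (K : acomplex P)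
    (σ : forall i, {linear B ⊗ P i -> P i ⊗ B}) : Prop := {
  crl_res : projective_resolution K;
  crl_compat : forall i, compatible_l (σ i);
  crl_dif : forall i z,
    σ i (tmap idfun (cdif K i) z) = tmap (cdif K i) idfun (σ i.+1 z);
  crl_aug : forall z, τ (tmap idfun (caug K) z) = tmap (caug K) idfun (σ 0%N z)
}.

Record compatible_resolution_r (Q : nat -> bimodule B) (K : acomplex Q)
    (σ : forall j, {linear Q j ⊗ A -> A ⊗ Q j}) : Prop := {
  crr_res : projective_resolution K;
  crr_compat : forall j, compatible_r (σ j);
  crr_dif : forall j z,
    σ j (tmap (cdif K j) idfun z) = tmap idfun (cdif K j) (σ j.+1 z);
  crr_aug : forall z, τ (tmap (caug K) idfun z) = tmap idfun (caug K) (σ 0%N z)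
}.

End Twisting.

Section TwistedProduct.
Variables (k : fieldType) (A B : algType k).
Variable τ : {linear B ⊗ A -> A ⊗ B}.
Variables (P : nat -> bimodule A) (Q : nat -> bimodule B).

(* The direct sum of the finitely many [P i ⊗ Q j] with [i + j = n], as a
   product: an element is the family of its components. *)
Record total (n : nat) := Total {
  total_at : forall i j : nat, (i + j)%N = n -> P i ⊗ Q j
}.

HB.instance Definition _ n := gen_eqMixin (total n).
HB.instance Definition _ n := gen_choiceMixin (total n).

Lemma total_ext n (x y : total n) :
  (forall i j (e : (i + j)%N = n), total_at x e = total_at y e) -> x = y.
Proof.
case: x y => [x] [y] /= h; congr Total.
by apply: functional_extensionality_dep => i;
  apply: functional_extensionality_dep => j;
  apply: functional_extensionality_dep => e; apply: h.
Qed.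

Section TotalModule.
Variable n : nat.
Definition total_zero : total n := Total (fun _ _ _ => 0).
Definition total_opp (x : total n) : total n :=
  Total (fun i j e => - @total_at n x i j e).
Definition total_add (x y : total n) : total n :=
  Total (fun i j e => @total_at n x i j e + @total_at n y i j e).
Definition total_scale (c : k) (x : total n) : total n :=
  Total (fun i j e => c *: @total_at n x i j e).

Fact total_addA : associative total_add.
Proof. by move=> x y z; apply: total_ext => i j e; apply: addrA. Qed.
Fact total_addC : commutative total_add.
Proof. by move=> x y; apply: total_ext => i j e; apply: addrC. Qed.
Fact total_add0 : left_id total_zero total_add.
Proof. by move=> x; apply: total_ext => i j e; apply: add0r. Qed.
Fact total_addN : left_inverse total_zero total_opp total_add.
Proof. by move=> x; apply: total_ext => i j e; apply: addNr. Qed.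
HB.instance Definition _ := GRing.isZmodule.Build (total n)
  total_addA total_addC total_add0 total_addN.

Fact total_scaleA a b x : total_scale a (total_scale b x) = total_scale (a * b) x.
Proof. by apply: total_ext => i j e; apply: scalerA. Qed.
Fact total_scale1 : left_id 1 total_scale.
Proof. by move=> x; apply: total_ext => i j e; apply: scale1r. Qed.
Fact total_scaleDr : right_distributive total_scale +%R.
Proof. by move=> a x y; apply: total_ext => i j e; apply: scalerDr. Qed.
Fact total_scaleDl x : {morph total_scale^~ x : a b / a + b}.
Proof. by move=> a b; apply: total_ext => i j e; apply: scalerDl. Qed.
HB.instance Definition _ := GRing.Zmodule_isLmodule.Build k (total n)
  total_scaleA total_scale1 total_scaleDr total_scaleDl.
End TotalModule.

Variables (KP : acomplex P) (KQ : acomplex Q).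

Fact total_eqS i j n : (i + j)%N = n -> (i + j.+1)%N = n.+1.
Proof. by move=> <-; apply: addnS. Qed.

(* The component in [P i ⊗ Q j] receives [d ⊗ 1] from [P (i + 1) ⊗ Q j] and
   [(-1)^i (1 ⊗ d)] from [P i ⊗ Q (j + 1)]. *)
Definition total_dif n (x : total n.+1) : total n :=
  Total (fun i j e =>
    tmap (cdif KP i) idfun (@total_at _ x i.+1 j (congr1 S e)) +
    (-1) ^+ i *: tmap idfun (cdif KQ j) (@total_at _ x i j.+1 (total_eqS e))).

Definition total_aug (x : total 0) : A ⊗ B :=
  tmap (caug KP) (caug KQ) (@total_at _ x 0 0 erefl).

Variable σP : forall i, {linear B ⊗ P i -> P i ⊗ B}.
Variable σQ : forall j, {linear Q j ⊗ A -> A ⊗ Q j}.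

(* The action of the twisted tensor product of [A] and [B] on [P i ⊗ Q j]:
   the composite of [1 ⊗ σP ⊗ σQ ⊗ 1], [1 ⊗ 1 ⊗ τ ⊗ 1 ⊗ 1] and [ρ ⊗ ρ]. *)
Definition twisted_act i j :
    (A ⊗ B) ⊗ (P i ⊗ Q j) ⊗ (A ⊗ B) -> P i ⊗ Q j :=
  tmap bim_act bim_act \o
  tmap idfun (@tassoc k B (Q j) B) \o
  @tassoc k (A ⊗ P i) A (B ⊗ (Q j ⊗ B)) \o
  tmap idfun (@tassocV k A B (Q j ⊗ B) \o tmap τ idfun \o tmid (σQ j)) \o
  @tassocV k (A ⊗ P i) (B ⊗ Q j) (A ⊗ B) \o
  tmap (tmid (σP i)) idfun.

Definition total_act n (u : A ⊗ B) (x : total n) (v : A ⊗ B) : total n :=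
  Total (fun i j e => twisted_act (u ⊗ₜ @total_at _ x i j e ⊗ₜ v)).

(* [L] is isomorphic, as an augmented complex of [T]-bimodules, to the twisted
   product complex of [KP] and [KQ], where [ψ] identifies the twisted tensor
   product of [A] and [B] with [T]. *)
Definition is_twisted_product (T : algType k) (ψ : {linear A ⊗ B -> T})
    (X : nat -> bimodule T) (L : acomplex X) : Prop :=
  exists φ : forall n, {linear X n -> total n},
    [/\ forall n, bijective (φ n),
        forall n u x v,
          φ n (bim_act (ψ u ⊗ₜ x ⊗ₜ ψ v)) = total_act u (φ n x) v,
        forall n x, φ n (cdif L n x) = total_dif (φ n.+1 x) &
        forall x, caug L x = ψ (total_aug (φ 0%N x))].

End TwistedProduct.

Section IteratedTwistedProduct.
Variable k : fieldType.

Definition ore_eval (A : algType k) (δ : derivation A) : {poly k} -> ore δ :=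
  horner_alg (ore_x δ).

Fact ore_eval_linear A δ : linear (@ore_eval A δ).
Proof.
move=> c p q; rewrite /ore_eval rmorphD -mul_polyC rmorphM; congr (_ + _).
apply: etrans (congr1 ( *%R^~ _) (horner_algC _ _)) _.
by rewrite -scalerAl mul1r.
Qed.
HB.instance Definition _ A δ := GRing.isLinear.Build k _ _ _ (@ore_eval A δ)
  (@ore_eval_linear A δ).

(* The map [a ⊗ b(x) |-> a b(x)] from [A ⊗ k[x]] to [A[x; 1, δ]]. *)
Definition ore_psi (A : algType k) (δ : derivation A) :
    {linear A ⊗ {poly k} -> ore δ} :=
  @amul k (ore δ) \o tmap (ore_inc δ) (ore_eval δ).

Inductive iterated_twisted_product :
    forall t (S : gen_alg k t) (X : nat -> bimodule S), acomplex X -> Prop :=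
| ITPKoszul (X : nat -> bimodule (gen_poly k)) (K : acomplex X) :
    acomplex_iso K (koszul k) ->
    iterated_twisted_product K
| ITPTwist t (A : gen_alg k t) (δ : derivation A)
    (P : nat -> bimodule A) (KP : acomplex P)
    (τ : {linear {poly k} ⊗ A -> A ⊗ {poly k}})
    (σP : forall i, {linear {poly k} ⊗ P i -> P i ⊗ {poly k}})
    (σQ : forall j, {linear koszul_mod k j ⊗ A -> A ⊗ koszul_mod k j})
    (X : nat -> bimodule (gen_ore δ)) (K : acomplex X) :
    iterated_twisted_product KP ->
    twisting τ ->
    (forall a : A, τ ('X ⊗ₜ a) = a ⊗ₜ 'X + δ a ⊗ₜ 1) ->
    twisted_tensor_iso τ (ore_psi δ) ->
    compatible_resolution_l τ KP σP ->
    compatible_resolution_r τ (koszul k) σQ ->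
    is_twisted_product τ KP (koszul k) σP σQ (ore_psi δ) K ->
    iterated_twisted_product K.

End IteratedTwistedProduct.

(* Main.v *)
(* Any two elements of [V] commute in [S] up to an element of [k + V], so [V]
   carries a bracket, and [S ⊗ Λ V ⊗ S] the Chevalley-Eilenberg differential
   determined by [d (p ∧ u) = d p ∧ u + (-1)^n Θ_u p], where
   [Θ_u p = u p - p u - D_u p] and [D_u] extends the inner derivation of [u].
   For [S = A[x; 1, δ]] the derivation [δ] extends to a derivation [D] of the
   complex of [A]; the maps [τ_(B,P)] and [τ_(Q,A)] move powers of [x] past [P]
   and [A] by the rule [x p = p x + D p].  Writing [Λ V_S = Λ V ⊕ Λ V ∧ x], the
   summand without (with) [x] is identified with the column of degree 0 (1) of
   the twisted product with the Koszul complex of [k[x]], and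
   [Θ_x p = x p - p x - D p] becomes its Koszul differential.  Exactness follows
   by induction from [k]-linear contracting homotopies of the two factors. *)
Require Import Defs.
From HB Require Import structures.
From mathcomp Require Import all_boot all_order all_algebra all_fingroup.
From mathcomp Require Import boolp.
Import GRing.Theory.
Local Open Scope ring_scope.
Set Implicit Arguments.
Unset Strict Implicit.
Unset Printing Implicit Defensive.

(** The constants in the relations never matter: [k] is central, so they cancel in commutators, and
    since [k] and [V] are independent in [S] the bracket is determined by the commutators. Its
    identities are read off from [S]; the Jacobi identity is the case of an inner derivation in the
    rule for derivations that preserve [k + V]. A map out of an exterior power is defined by
    recursion on the last factor, at the price of one alternation check; for the differential this
    check rests on [[u, u] = 0]. The maps [τ_(B,P)] and [τ_(Q,A)] are instances of one construction,
    determined by an endomorphism [D] and by the two actions of the variable. The compatibility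
    axioms come from its naturality and its behaviour on tensor products; its bijectivity is the
    reason why each [P_i ⊗ Q_j] with [j ≤ 1] is again of the form [S ⊗ Λ^i V ⊗ S]. Homotopies are
    preferred to exactness because they can be tensored directly. They enter the same induction as
    the twisted product property, since compatibility presupposes that the complex of [A] is a
    projective resolution. *)

Section AbelianReflection.
Variable V : zmodType.
Inductive zexp := ZVar of nat | ZAdd of zexp & zexp | ZOpp of zexp | ZZero.
Fixpoint zeval (env : seq V) e : V :=
  match e with
  | ZVar i => nth 0 env i
  | ZAdd e1 e2 => zeval env e1 + zeval env e2
  | ZOpp e => - zeval env e
  | ZZero => 0
  end.
Fixpoint zcoef (i : nat) e : int :=
  match e with
  | ZVar j => if j == i then 1 else 0
  | ZAdd e1 e2 => zcoef i e1 + zcoef i e2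
  | ZOpp e => - zcoef i e
  | ZZero => 0
  end.
Lemma zevalE env e : zeval env e = \sum_(i < size env) env`_i *~ zcoef i e.
Proof.
elim: e => [j|e1 h1 e2 h2|e h|] /=.
- case: (ltnP j (size env)) => hj.
    rewrite (bigD1 (Ordinal hj)) //= eqxx mulr1z big1 ?addr0 // => i /eqP ne.
    by case: eqP => // e; case: ne; apply: val_inj.
  (* A variable beyond the environment has the default value [0], and no index of the sum equals
     it. *)
  rewrite nth_default // big1 // => i _; case: eqP => // e.
  by have := ltn_ord i; rewrite -e ltnNge hj.
- by rewrite h1 h2 -big_split; apply: eq_bigr => i _; rewrite mulrzDr.
- by rewrite h -sumrN; apply: eq_bigr => i _; rewrite mulrNz.
- by rewrite big1.
Qed.
(** By [zevalE] a value depends only on the integer coefficients of the atoms, so the hypothesis is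
    a boolean to be checked by computation. *)
Lemma zmod_dec env e1 e2 :
  all (fun i => zcoef i e1 == zcoef i e2) (iota 0 (size env)) ->
  zeval env e1 = zeval env e2.
Proof.
move=> h; rewrite !zevalE; apply: eq_bigr => i _.
by move/allP/(_ (i : nat)): h => /(_ _)/eqP -> //; rewrite mem_iota ltn_ord.
Qed.
End AbelianReflection.

(* Atoms are compared up to conversion: the same operation may be reached along
   different paths of the algebraic hierarchy. *)
Ltac zindex x env := match env with
  | cons x _ => constr:(0%N)
  | cons ?y _ => let _ := match goal with _ => unify x y end in constr:(0%N)
  | cons _ ?l => let n := zindex x l in constr:(S n) end.
Ltac zcollect t env := match t with
  | (?a + ?b)%R => let env := zcollect a env in zcollect b env
  | (- ?a)%R => zcollect a env
  | 0%R => env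
  | _ => match goal with
    | _ => let n := zindex t env in env
    | _ => constr:(cons t env) end
  end.
Ltac zreify t env := match t with
  | (?a + ?b)%R => let x := zreify a env in let y := zreify b env in constr:(ZAdd x y)
  | (- ?a)%R => let x := zreify a env in constr:(ZOpp x)
  | 0%R => constr:(ZZero)
  | _ => let n := zindex t env in constr:(ZVar n)
  end.
Ltac abelian := match goal with |- @eq ?T ?l ?r =>
    let env := zcollect l (@nil T) in let env := zcollect r env in
    let e1 := zreify l env in let e2 := zreify r env in
    exact: (@zmod_dec _ env e1 e2 (erefl true)) end.

(** * Tensor calculus *)

(* [mk_linear] and [tlift] reduce too eagerly under [simpl]; these opaque
   variants are used through [linE] and [blift_pure]. *)
Fact lin_ex (k : fieldType) (U W : lmodType k) (f : U -> W) (hf : linear f) :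
  {g : {linear U -> W} | g =1 f}.
Proof. by exists (mk_linear hf). Qed.
Definition lin k U W f hf := sval (@lin_ex k U W f hf).
Lemma linE (k : fieldType) (U W : lmodType k) (f : U -> W) (hf : linear f) :
  lin hf =1 f.
Proof. exact: svalP (lin_ex hf). Qed.

#[global] Opaque tensor univ tpure.

(* Rewriting with the generic [linearD] etc. is prohibitively slow here. *)
Section LinearRewriting.
Variables (k : fieldType) (U V : lmodType k) (f : {linear U -> V}).
Lemma linD x y : f (x + y) = f x + f y. Proof. exact: linearD. Qed.
Lemma linB x y : f (x - y) = f x - f y. Proof. exact: linearB. Qed.
Lemma linN x : f (- x) = - f x. Proof. exact: linearN. Qed.
Lemma lin0 : f 0 = 0. Proof. exact: linear0. Qed.
Lemma linZ c x : f (c *: x) = c *: f x. Proof. exact: linearZZ. Qed.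
Lemma linP c x y : f (c *: x + y) = c *: f x + f y. Proof. exact: linearP. Qed.
End LinearRewriting.

Section TensorCalculus.
Variable k : fieldType.
Implicit Types U V W : lmodType k.

Lemma tpureDl U V (v : V) : {morph (fun u : U => u ⊗ₜ v) : x y / x + y}.
Proof. exact: (linearD (tpurer U v)). Qed.
Lemma tpureDr U V (u : U) : {morph (fun v : V => u ⊗ₜ v) : x y / x + y}.
Proof. exact: (linearD (tpurel V u)). Qed.
Lemma tpureZl U V (v : V) c (u : U) : (c *: u) ⊗ₜ v = c *: (u ⊗ₜ v).
Proof. exact: (linearZZ (tpurer U v) _ _). Qed.
Lemma tpureZr U V (u : U) c (v : V) : u ⊗ₜ (c *: v) = c *: (u ⊗ₜ v).
Proof. exact: (linearZZ (tpurel V u) _ _). Qed.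
Lemma tpure0l U V (v : V) : (0 : U) ⊗ₜ v = 0.
Proof. exact: (linear0 (tpurer U v)). Qed.
Lemma tpure0r U V (u : U) : u ⊗ₜ (0 : V) = 0.
Proof. exact: (linear0 (tpurel V u)). Qed.
Lemma tpureNl U V (v : V) (u : U) : (- u) ⊗ₜ v = - (u ⊗ₜ v).
Proof. exact: (linearN (tpurer U v)). Qed.
Lemma tpureNr U V (v : V) (u : U) : u ⊗ₜ (- v) = - (u ⊗ₜ v).
Proof. exact: (linearN (tpurel V u)). Qed.
Lemma tpureBl U V (v : V) (x y : U) : (x - y) ⊗ₜ v = x ⊗ₜ v - y ⊗ₜ v.
Proof. by rewrite tpureDl tpureNl. Qed.
Lemma tpureBr U V (u : U) (x y : V) : u ⊗ₜ (x - y) = u ⊗ₜ x - u ⊗ₜ y.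
Proof. by rewrite tpureDr tpureNr. Qed.
Lemma tpure_sumr U V (u : U) I (r : seq I) (P : pred I) (F : I -> V) :
  u ⊗ₜ (\sum_(i <- r | P i) F i) = \sum_(i <- r | P i) u ⊗ₜ F i.
Proof. exact: (linear_sum (tpurel V u)). Qed.
Lemma tpure_suml U V (v : V) I (r : seq I) (P : pred I) (F : I -> U) :
  (\sum_(i <- r | P i) F i) ⊗ₜ v = \sum_(i <- r | P i) F i ⊗ₜ v.
Proof. exact: (linear_sum (tpurer U v)). Qed.

Definition tpureD := (tpureDl, tpureDr).
Definition tpureZ := (tpureZl, tpureZr).
Definition tpureB := (tpureBl, tpureBr, tpureNl, tpureNr).
Definition tpure0 := (tpure0l, tpure0r).

(** Pure tensors contain [0] and are stable under scalars, so closure under sums is enough. *)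
Lemma tensor_ind U V (Pr : U ⊗ V -> Prop) :
  (forall u v, Pr (u ⊗ₜ v)) -> (forall x y, Pr x -> Pr y -> Pr (x + y)) ->
  forall z, Pr z.
Proof.
move=> h1 h2 z; have [s ->] := univ_span z.
elim: s => [|[c [u v]] s IH].
  by rewrite big_nil -(tpure0r V (0 : U)); apply: h1.
rewrite big_cons /=; apply: h2 IH.
by rewrite -[ugen _]/(u ⊗ₜ v) -tpureZl.
Qed.

Definition blift U V W (f : U -> V -> W) (bf : bilin f) : {linear U ⊗ V -> W} :=
  lin (tlift_linear bf).

Lemma blift_pure U V W (f : U -> V -> W) (bf : bilin f) u v :
  blift bf (u ⊗ₜ v) = f u v.
Proof. by rewrite linE tlift_pure. Qed.

Fact tswap_bilin U V : bilin (fun (u : U) (v : V) => v ⊗ₜ u).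
Proof. by split=> [v c x y|u c x y]; rewrite tpureD tpureZ. Qed.
Definition tswap U V : {linear U ⊗ V -> V ⊗ U} := blift (@tswap_bilin U V).
Lemma tswap_pure U V (u : U) (v : V) : tswap U V (u ⊗ₜ v) = v ⊗ₜ u.
Proof. exact: blift_pure. Qed.

End TensorCalculus.

Arguments bim_act : simpl never.

Ltac add_shuffle := repeat first [ reflexivity
  | rewrite [LHS]addrACA; apply: (f_equal2 +%R) ].
(** For additivity steps in which the goal is the sum of [h1] and [h2] only up to the order of the
    summands. *)
Ltac add_split h1 h2 :=
  match type of h1 with ?lx = ?rx => match type of h2 with ?ly = ?ry =>
    transitivity (lx + ly); [ first [abelian | symmetry; add_shuffle]
      | transitivity (rx + ry);
        [ exact (f_equal2 +%R h1 h2) | first [abelian | add_shuffle] ]]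
  end end.

(* Reduces an equation between linear functions of the tensor [z] to the case
   of a pure tensor. *)
Tactic Notation "tind" constr(z) "as" simple_intropattern(u) simple_intropattern(v) :=
  move: z; refine (tensor_ind _ _);
   [ intros u v | intros ? ?; rewrite /= ?(tpureDl, tpureDr, linD) /=;
     let h1 := fresh in let h2 := fresh in intros h1 h2;
     first [ exact: (f_equal2 +%R h1 h2) | by add_split h1 h2 | idtac ]].

#[global] Opaque lin blift tswap.

Section TensorBij.
Variable k : fieldType.
Implicit Types U V W : lmodType k.

Lemma tassocK U V W : cancel (@tassoc k U V W) (@tassocV k U V W).
Proof.
move=> z; tind z as u x; tind x as v w.
by rewrite tassoc_pure tassocV_pure.
Qed.

Lemma tassocVK U V W : cancel (@tassocV k U V W) (@tassoc k U V W).
Proof.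
move=> z; tind z as x w; tind x as u v.
by rewrite tassocV_pure tassoc_pure.
Qed.

Lemma tassoc_bij U V W : bijective (@tassoc k U V W).
Proof. exists (@tassocV k U V W); [exact: tassocK | exact: tassocVK]. Qed.
Lemma tassocV_bij U V W : bijective (@tassocV k U V W).
Proof. exists (@tassoc k U V W); [exact: tassocVK | exact: tassocK]. Qed.

Lemma can_linear U V (f : {linear U -> V}) g :
  cancel f g -> cancel g f -> linear g.
Proof. by move=> fK gK c x y; apply: (can_inj fK); rewrite linearP !gK. Qed.

Lemma tmap_bij U V U' V' (f : {linear U -> U'}) (g : {linear V -> V'}) :
  bijective f -> bijective g -> bijective (tmap f g).
Proof.
case=> f' fK f'K [g' gK g'K].
pose f1 := lin (can_linear fK f'K).
pose g1 := lin (can_linear gK g'K).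
exists (tmap f1 g1) => z; tind z as u v.
  by rewrite !tmap_pure !linE fK gK.
by rewrite !tmap_pure !linE f'K g'K.
Qed.

Lemma inj_surj_bij (X Y : Type) (f : X -> Y) :
  injective f -> (forall y, exists x, f x = y) -> bijective f.
Proof.
move=> fI fS; pose g y := sval (cid (fS y)).
have gK : cancel g f by move=> y; rewrite /g; case: cid.
by exists g => // x; apply: fI; rewrite gK.
Qed.

Lemma bij_inj_surj (X Y : Type) (f : X -> Y) :
  bijective f -> injective f /\ (forall y, exists x, f x = y).
Proof. by case=> g fK gK; split=> [|y]; [exact: can_inj fK | exists (g y)]. Qed.

End TensorBij.

Section PolyEval.
Variables (k : fieldType) (Z : lmodType k) (L : {linear Z -> Z}).

(** This is [p(L) z], for the [k[x]]-module structure on [Z] in which [x] acts as [L]. It yields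
    maps out of [k[x]] that are prescribed by the effect of [x] alone. *)
Definition peval (p : {poly k}) (z : Z) : Z :=
  \sum_(i < size p) p`_i *: iter i L z.

Lemma peval_wide n (p : {poly k}) z : (size p <= n)%N ->
  peval p z = \sum_(i < n) p`_i *: iter i L z.
Proof.
move=> le_pn; rewrite /peval (big_ord_widen n (fun i => p`_i *: iter i L z)) //.
rewrite big_mkcond; apply: eq_bigr => i _; case: ltnP => // le_pi.
by rewrite nth_default // scale0r.
Qed.

Lemma peval_bilin : bilin peval.
Proof.
split=> [z c p q|p c z z'].
  pose n := maxn (size (c *: p + q)) (maxn (size p) (size q)).
  rewrite !(@peval_wide n) ?leq_max ?leqnn ?orbT // scaler_sumr -big_split.
  by apply: eq_bigr => i _; rewrite coefD coefZ scalerDl scalerA.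
have hi i x y : iter i L (c *: x + y) = c *: iter i L x + iter i L y.
  by elim: i => //= i ->; rewrite linearP.
rewrite /peval scaler_sumr -big_split; apply: eq_bigr => i _.
by rewrite hi scalerDr !scalerA mulrC.
Qed.

Lemma pevalC c z : peval c%:P z = c *: z.
Proof.
by rewrite (@peval_wide 1) ?size_polyC ?leq_b1 // big_ord1 coefC.
Qed.

Lemma peval1 z : peval 1 z = z.
Proof. by rewrite -[1]/(1%:P) pevalC scale1r. Qed.

Lemma pevalXl p z : peval ('X * p) z = L (peval p z).
Proof.
have h : (size ('X * p)%R <= (size p).+1)%N.
  by rewrite (leq_trans (size_polyMleq _ _)) // size_polyX.
rewrite (peval_wide _ h) big_ord_recl coefXM /= scale0r add0r /peval linear_sum.
by apply: eq_bigr => i _; rewrite linearZ coefXM.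
Qed.

Lemma pevalDr p z z' : peval p (z + z') = peval p z + peval p z'.
Proof. by have := peval_bilin.2 p 1 z z'; rewrite !scale1r. Qed.
Lemma pevalZr c p z : peval p (c *: z) = c *: peval p z.
Proof.
rewrite /peval scaler_sumr; apply: eq_bigr => i _.
have -> : iter i L (c *: z) = c *: iter i L z.
  by elim: (i : nat) => //= j ->; rewrite linearZ.
by rewrite !scalerA mulrC.
Qed.

End PolyEval.

Lemma poly_Xind (k : fieldType) (Pr : {poly k} -> Prop) :
  Pr 1 -> (forall p, Pr p -> Pr ('X * p)) ->
  (forall c p q, Pr p -> Pr q -> Pr (c *: p + q)) -> forall p, Pr p.
Proof.
move=> h1 hX hD; have h0 : Pr 0.
  by rewrite -(addNr 1) -scaleN1r; apply: hD.
have hC c : Pr c%:P by rewrite -alg_polyC -[_%:A]addr0; apply: hD.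
elim/poly_ind => // p c IH.
by rewrite -[p * _]scale1r; apply: hD => //; rewrite mulrC; apply: hX.
Qed.

Section TensorSum.
Variable k : fieldType.
Implicit Types U V W : lmodType k.

(** The Leibniz rule on a tensor product: a variable that enters from the left acts by [D] on the
    first factor, or passes it and acts by [E] on the second. *)
Definition tsum U V (D : {linear U -> U}) (E : {linear V -> V}) :
    {linear U ⊗ V -> U ⊗ V} :=
  lin (linearP (tmap D idfun \+ tmap idfun E)).

Lemma tsum_pure U V (D : {linear U -> U}) (E : {linear V -> V}) u v :
  tsum D E (u ⊗ₜ v) = D u ⊗ₜ v + u ⊗ₜ E v.
Proof. by rewrite linE /= !tmap_pure. Qed.

End TensorSum.

#[global] Opaque tsum.

Ltac tsimp := do ?[progress rewrite ?(tmap_pure, tassoc_pure, tassocV_pure,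
  tswap_pure, tsum_pure, tpureDl, tpureDr, linD) /=].

(** * Moving a variable past a module with an endomorphism *)

Section Sigma.
Variable k : fieldType.
Let B : algType k := {poly k}.

(* [s : Q ⊗ M -> M ⊗ Q] is determined by the actions [xl] and [xr] of the
   variable on the two sides of [Q], by the set [G] of generators of [Q], and
   by the endomorphism [D] of [M] that the variable induces. *)
Definition is_sigma (Q : lmodType k) (xl xr : {linear Q -> Q}) (G : Q -> Prop)
    (M : lmodType k) (D : {linear M -> M}) (s : {linear Q ⊗ M -> M ⊗ Q}) :=
  [/\ forall q m, s (xl q ⊗ₜ m) = tsum D xl (s (q ⊗ₜ m)),
      forall q m, s (xr q ⊗ₜ m) = tsum D xr (s (q ⊗ₜ m)) &
      forall g m, G g -> s (g ⊗ₜ m) = m ⊗ₜ g].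

(** The principle [xm_ind] gives uniqueness of the map [s] of [is_sigma]. Existence is a field
    because no presentation of the module is at hand; it is supplied case by case, for all [M] and
    [D]. *)
Record xmod := XMod {
  xm :> lmodType k;
  xl : {linear xm -> xm};
  xr : {linear xm -> xm};
  xgen : xm -> Prop;
  xm_ind : forall Pr : xm -> Prop,
    Pr 0 -> (forall c x y, Pr x -> Pr y -> Pr (c *: x + y)) ->
    (forall g, xgen g -> Pr g) -> (forall q, Pr q -> Pr (xl q)) ->
    (forall q, Pr q -> Pr (xr q)) -> forall q, Pr q;
  xm_sigma : forall (M : lmodType k) (D : {linear M -> M}),
    exists s, is_sigma xl xr xgen D s
}.

Arguments xl {_}.
Arguments xr {_}.
Arguments xgen {_}.
Variable Q : xmod.
Section OneModule.
Variables (M : lmodType k) (D : {linear M -> M}).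

Definition sigma : {linear Q ⊗ M -> M ⊗ Q} := sval (cid (@xm_sigma Q M D)).
Let sP := svalP (cid (@xm_sigma Q M D)).
Lemma sigma_xl q m : sigma (xl q ⊗ₜ m) = tsum D (@xl Q) (sigma (q ⊗ₜ m)).
Proof. by case: sP => h _ _; apply: h. Qed.
Lemma sigma_xr q m : sigma (xr q ⊗ₜ m) = tsum D (@xr Q) (sigma (q ⊗ₜ m)).
Proof. by case: sP => _ h _; apply: h. Qed.
Lemma sigma_gen g m : xgen g -> sigma (g ⊗ₜ m) = m ⊗ₜ g.
Proof. by case: sP => _ _ h; apply: h. Qed.
End OneModule.

Section Natural.
Variables (M N : lmodType k) (D : {linear M -> M}) (D' : {linear N -> N}).
Variable f : {linear M -> N}.
Hypothesis fD : forall m, f (D m) = D' (f m).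

Lemma tsum_nat (x : {linear Q -> Q}) z :
  tsum D' x (tmap f idfun z) = tmap f idfun (tsum D x z).
Proof.
by tind z as u q; tsimp; rewrite fD.
Qed.

(** Both sides obey the same recursion in the element of [Q], because [f] intertwines [D] and
    [D']. *)
Lemma sigma_nat z : sigma D' (tmap idfun f z) = tmap f idfun (sigma D z).
Proof.
tind z as q m; rewrite tmap_pure /=.
move: q m; apply: xm_ind.
- by move=> m; rewrite !tpure0 !lin0.
- by move=> c x y hx hy m; rewrite !(tpureD, tpureZ, linD, linZ) hx hy.
- by move=> g hg m; rewrite !sigma_gen ?tmap_pure.
- by move=> q hq m; rewrite !sigma_xl hq tsum_nat.
- by move=> q hq m; rewrite !sigma_xr hq tsum_nat.
Qed.
End Natural.

Lemma sigma_D (M : lmodType k) (D : {linear M -> M}) z :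
  sigma D (tmap idfun D z) = tmap D idfun (sigma D z).
Proof. exact: sigma_nat. Qed.

Section Tensor.
Variables (M N : lmodType k) (D : {linear M -> M}) (D' : {linear N -> N}).

(** To pass [m ⊗ n] is to pass [m] and then [n]. With [sigma_nat] for a multiplication or an action
    map, this gives compatibility axioms. *)
Lemma sigma_tensor q m n :
  sigma (tsum D D') (q ⊗ₜ (m ⊗ₜ n)) =
  tassoc (tmap idfun (sigma D') (tassocV (sigma D (q ⊗ₜ m) ⊗ₜ n))).
Proof.
(* One step of the recursion for the right-hand side, with a general [x] that covers both [xl] and
   [xr]. *)
have key (x : {linear Q -> Q}) :
    (forall q n, sigma D' (x q ⊗ₜ n) = tsum D' x (sigma D' (q ⊗ₜ n))) ->
    forall z n, tassoc (tmap idfun (sigma D') (tassocV (tsum D x z ⊗ₜ n))) =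
    tsum (tsum D D') x (tassoc (tmap idfun (sigma D') (tassocV (z ⊗ₜ n)))).
  move=> hx z n'; tind z as m' q'.
  tsimp; rewrite hx.
  move: (sigma D' (q' ⊗ₜ n')) => y; tind y as n1 q1.
  by tsimp; rewrite addrA.
move: q m n; apply: xm_ind.
- by move=> m n; rewrite !(tpure0, lin0).
- by move=> c x y hx hy m n; rewrite !(tpureD, tpureZ, linD, linZ) hx hy.
- by move=> g hg m n; rewrite !sigma_gen // tassocV_pure tmap_pure /= sigma_gen
     // tassoc_pure.
- by move=> q hq m n; rewrite !sigma_xl hq -key // => *; rewrite sigma_xl.
- by move=> q hq m n; rewrite !sigma_xr hq -key // => *; rewrite sigma_xr.
Qed.
End Tensor.

Section Bijective.
Variables (M : lmodType k) (D : {linear M -> M}).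
Let D' : {linear M -> M} := lin (linearP (\- D : {linear M -> M})).

(* The inverse is obtained by replacing [D] by [- D] and flipping the tensors. *)
Lemma sigma_bij : bijective (sigma D).
Proof.
have D'E m : D' m = - D m by rewrite linE.
have DD' m : D (D' m) = D' (D m) by rewrite !D'E linN.
have [nu nuE] : exists nu : {linear M ⊗ Q -> Q ⊗ M},
    forall m q, nu (m ⊗ₜ q) = tswap _ _ (sigma D' (q ⊗ₜ m)).
  by exists (tswap _ _ \o sigma D' \o tswap _ _) => m q; rewrite /= tswap_pure.
have nuD z : nu (tmap D idfun z) = tmap idfun D (nu z).
  tind z as m q; rewrite tmap_pure !nuE /=.
  rewrite -[q ⊗ₜ D m](tmap_pure idfun D) (sigma_nat DD').
  by move: (sigma _ _) => y; tind y as a b; tsimp.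
have nux (x : {linear Q -> Q}) z :
    (forall q m, sigma D' (x q ⊗ₜ m) = tsum D' x (sigma D' (q ⊗ₜ m))) ->
    nu (tsum D x z) = tmap x idfun (nu z).
  move=> hx; have -> : tsum D x z = tmap D idfun z + tmap idfun x z.
    by rewrite linE.
  rewrite linD nuD; tind z as m q; rewrite tmap_pure !nuE /= hx.
  move: (sigma _ _) => y; tind y as a b; tsimp.
  by rewrite D'E tpureNr addNKr.
have snu (x : {linear Q -> Q}) z :
    (forall q m, sigma D (x q ⊗ₜ m) = tsum D x (sigma D (q ⊗ₜ m))) ->
    sigma D (tmap x idfun z) = tsum D x (sigma D z).
  by move=> hx; tind z as q m; rewrite tmap_pure hx.
have snux (x : {linear Q -> Q}) m q :
    (forall q m, sigma D' (x q ⊗ₜ m) = tsum D' x (sigma D' (q ⊗ₜ m))) ->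
    (forall q m, sigma D (x q ⊗ₜ m) = tsum D x (sigma D (q ⊗ₜ m))) ->
    sigma D (nu (m ⊗ₜ x q)) = tmap idfun x (sigma D (nu (m ⊗ₜ q))).
  move=> hx' hx.
  have -> : m ⊗ₜ x q = tsum D x (m ⊗ₜ q) - tmap D idfun (m ⊗ₜ q).
    by tsimp; rewrite addrC addKr.
  rewrite linB nux // linB nuD sigma_D snu //.
  by rewrite linE /= addrC addKr.
exists nu => z.
  tind z as q m; move: q m; apply: xm_ind.
  - by move=> m; rewrite !(tpure0, lin0).
  - by move=> c x y hx hy m; rewrite !(tpureD, tpureZ, linD, linZ) hx hy.
  - by move=> g hg m; rewrite sigma_gen // nuE sigma_gen // tswap_pure.
  - by move=> q hq m; rewrite sigma_xl nux ?hq ?tmap_pure // => *; rewrite sigma_xl.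
  - by move=> q hq m; rewrite sigma_xr nux ?hq ?tmap_pure // => *; rewrite sigma_xr.
tind z as m q; move: q m; apply: xm_ind.
- by move=> m; rewrite !(tpure0, lin0).
- by move=> c x y hx hy m; rewrite !(tpureD, tpureZ, linD, linZ) hx hy.
- by move=> g hg m; rewrite nuE sigma_gen // tswap_pure sigma_gen.
- by move=> q hq m; rewrite snux ?hq ?tmap_pure // => *; rewrite (sigma_xl, sigma_xr).
- by move=> q hq m; rewrite snux ?hq ?tmap_pure // => *; rewrite (sigma_xl, sigma_xr).
Qed.
End Bijective.
End Sigma.
Arguments xl {k _}.
Arguments xr {k _}.
Arguments xgen {k _}.
Arguments sigma {k} Q {M} D.

(** Naturality in [Q]. The image of a generator need not be a generator (the Koszul differential
    sends [1 ⊗ x ⊗ 1] to [x ⊗ 1 - 1 ⊗ x]), so it is only asked to pass [m] unchanged. *)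
Lemma sigma_natQ (k : fieldType) (Q Q' : xmod k) (f : {linear Q -> Q'}) :
  (forall q, f (xl q) = xl (f q)) -> (forall q, f (xr q) = xr (f q)) ->
  forall (M : lmodType k) (D : {linear M -> M}),
  (forall g m, xgen g -> sigma Q' D (f g ⊗ₜ m) = m ⊗ₜ f g) ->
  forall z, sigma Q' D (tmap f idfun z) = tmap idfun f (sigma Q D z).
Proof.
move=> fl fr M D fg z; tind z as q m; rewrite tmap_pure /=.
have tsum_f (x : {linear Q -> Q}) (x' : {linear Q' -> Q'}) y :
    (forall q, f (x q) = x' (f q)) ->
    tmap idfun f (tsum D x y) = tsum D x' (tmap idfun f y).
  by move=> hx; tind y as a b; tsimp; rewrite hx.
move: q m; apply: xm_ind.
- by move=> m; rewrite !(tpure0, lin0).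
- by move=> c x y hx hy m; rewrite !(tpureD, tpureZ, linD, linZ) hx hy.
- by move=> g hg m; rewrite fg // sigma_gen // tmap_pure.
- by move=> q hq m; rewrite fl !sigma_xl hq (tsum_f _ xl).
- by move=> q hq m; rewrite fr !sigma_xr hq (tsum_f _ xr).
Qed.

(* The tensor products below are over abstract modules in place of [k[x]]:
   rewriting in tensor products over the concrete algebra is prohibitively slow. *)
Section SigmaExistence.
Variables (k : fieldType) (B W M : lmodType k).
Variables (X : {linear B -> B}) (e : B) (D : {linear M -> M}).
Variable t : {linear B ⊗ M -> M ⊗ B}.
Hypothesis tX : forall b m, t (X b ⊗ₜ m) = tsum D X (t (b ⊗ₜ m)).
Hypothesis tD : forall b m, t (b ⊗ₜ D m) = tmap D idfun (t (b ⊗ₜ m)).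
Hypothesis t1 : forall m, t (e ⊗ₜ m) = m ⊗ₜ e.

(** In [b ⊗ b'] the factor [b'] passes [m] first, then [b] does, both by [t]. When the variable acts
    on [b'] it leaves a term with [D] that [b] still has to pass; this is where [tD] enters. *)
Lemma sigma_ex2 : exists s,
  is_sigma (tmap X idfun) (tmap idfun X) (fun b : B ⊗ B => b = e ⊗ₜ e) D s.
Proof.
have [s sE] : exists s : {linear (B ⊗ B) ⊗ M -> M ⊗ (B ⊗ B)},
    forall y b m, s (y ⊗ₜ b ⊗ₜ m) =
      tassocV (tmap t idfun (tassoc (y ⊗ₜ t (b ⊗ₜ m)))).
  exists (@tassocV k M B B \o tmap t idfun \o @tassoc k B M B \o tmap idfun t \o
    @tassocV k B B M) => y b m.
  by rewrite /=; tsimp.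
exists s; split.
- move=> z m; tind z as b b'; rewrite /= tmap_pure !sE /=.
  move: (t (b' ⊗ₜ m)) => y; tind y as m1 b1; tsimp; rewrite tX.
  by move: (t _) => y; tind y as m2 b2; tsimp.
- move=> z m; tind z as b b'; rewrite /= tmap_pure !sE /= tX.
  move: (t (b' ⊗ₜ m)) => y; tind y as m1 b1; tsimp; rewrite tD.
  by move: (t _) => y; tind y as m2 b2; tsimp.
- by move=> _ m ->; rewrite sE t1; tsimp; rewrite t1; tsimp.
Qed.

(** As in [sigma_ex2], with the elements of [W] passing [m] by the plain flip. *)
Lemma sigma_ex3 : exists s,
  is_sigma (tmap (tmap X idfun) idfun) (tmap idfun X)
    (fun q : B ⊗ W ⊗ B => exists w, q = e ⊗ₜ w ⊗ₜ e) D s.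
Proof.
have [s1 s1E] : exists s1 : {linear (B ⊗ W) ⊗ M -> M ⊗ (B ⊗ W)},
    forall b w m, s1 (b ⊗ₜ w ⊗ₜ m) = tassocV (t (b ⊗ₜ m) ⊗ₜ w).
  exists (@tassocV k M B W \o tmap t idfun \o @tassoc k B M W \o
    tmap idfun (tswap W M) \o @tassocV k B W M) => b w m.
  by rewrite /=; tsimp.
have [s sE] : exists s : {linear (B ⊗ W ⊗ B) ⊗ M -> M ⊗ (B ⊗ W ⊗ B)},
    forall y b m, s (y ⊗ₜ b ⊗ₜ m) =
      tassocV (tmap s1 idfun (tassoc (y ⊗ₜ t (b ⊗ₜ m)))).
  exists (@tassocV k M (B ⊗ W) B \o tmap s1 idfun \o
    @tassoc k (B ⊗ W) M B \o tmap idfun t \o @tassocV k (B ⊗ W) B M) => y b m.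
  by rewrite /=; tsimp.
exists s; split.
- move=> z m; tind z as y b'; rewrite /= tmap_pure !sE /=.
  move: (t (b' ⊗ₜ m)) => z; tind z as m1 b1; tind y as b w.
  tsimp; rewrite !s1E tX.
  by move: (t _) => y; tind y as m2 b2; tsimp.
- move=> z m; tind z as y b'; rewrite /= tmap_pure !sE /= tX.
  move: (t (b' ⊗ₜ m)) => z; tind z as m1 b1; tind y as b w.
  tsimp; rewrite !s1E tD.
  by move: (t _) => y; tind y as m2 b2; tsimp.
- by move=> _ m [w ->]; rewrite sE t1; tsimp; rewrite s1E t1; tsimp.
Qed.

End SigmaExistence.

Section BimoduleActions.
Variables (k : fieldType) (A : algType k) (M : bimodule A).
Definition bim_l (a : A) : {linear M -> M} :=
  lin (linearP (@bim_act k A M \o tpurer _ 1 \o tpurel M a)).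
Definition bim_r (a : A) : {linear M -> M} :=
  lin (linearP (@bim_act k A M \o tpurer _ a \o tpurel M 1)).
Lemma bim_lE a m : bim_l a m = bim_act (a ⊗ₜ m ⊗ₜ 1). Proof. exact: linE. Qed.
Lemma bim_rE a m : bim_r a m = bim_act (1 ⊗ₜ m ⊗ₜ a). Proof. exact: linE. Qed.
Lemma bim_lrE a m b : bim_act (a ⊗ₜ m ⊗ₜ b) = bim_l a (bim_r b m).
Proof. by rewrite bim_lE bim_rE bim_actA !mulr1. Qed.
Lemma bim_lrC a m b : bim_l a (bim_r b m) = bim_r b (bim_l a m).
Proof. by rewrite -bim_lrE bim_lE bim_rE bim_actA !mul1r. Qed.
Lemma bim_l1 m : bim_l 1 m = m. Proof. by rewrite bim_lE bim_act1. Qed.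
Lemma bim_r1 m : bim_r 1 m = m. Proof. by rewrite bim_rE bim_act1. Qed.
Lemma bim_lM a b m : bim_l (a * b) m = bim_l a (bim_l b m).
Proof. by rewrite !bim_lE bim_actA mulr1. Qed.
Lemma bim_rM a b m : bim_r (a * b) m = bim_r b (bim_r a m).
Proof. by rewrite !bim_rE bim_actA mulr1. Qed.
Lemma bim_l_bilin : bilin bim_l.
Proof.
split=> [m c a b|a c m m']; last by rewrite linD linZ.
by rewrite !bim_lE !(tpureD, tpureZ) linD linZ.
Qed.
Lemma bim_r_bilin : bilin bim_r.
Proof.
split=> [m c a b|a c m m']; last by rewrite linD linZ.
by rewrite !bim_rE !(tpureD, tpureZ) linD linZ.
Qed.
End BimoduleActions.
#[global] Opaque bim_l bim_r.

(** * The polynomial ring and its Koszul modules as instances of [xmod] *)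

Section Modules.
Variable k : fieldType.
Let B : algType k := {poly k}.

Definition mulX : {linear B -> B} := lin ((amul_bilin B).2 'X).
Lemma mulXE b : mulX b = 'X * b. Proof. exact: linE. Qed.

Fact poly_xmod_ind (Pr : B -> Prop) :
  Pr 0 -> (forall c x y, Pr x -> Pr y -> Pr (c *: x + y)) ->
  (forall g, g = 1 -> Pr g) -> (forall q, Pr q -> Pr (mulX q)) ->
  (forall q, Pr q -> Pr (mulX q)) -> forall q, Pr q.
Proof.
move=> _ hD h1 hX _; apply: poly_Xind => //; first exact: h1.
by move=> p; rewrite -mulXE; apply: hX.
Qed.

Fact poly_xmod_bilin (M : lmodType k) (D : {linear M -> M}) :
  bilin (fun b (m : M) => peval (tsum D mulX) b (m ⊗ₜ (1 : B))).
Proof.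
split=> [m c x y|b c x y]; first by rewrite (peval_bilin _).1.
by rewrite tpureD tpureZ pevalDr pevalZr.
Qed.

(** The map sends [b ⊗ m] to the polynomial [b] in the operator [D ⊗ 1 + 1 ⊗ x], applied to [m ⊗ 1].
    For [M = A] and [D = δ] it is the twisting map of the Ore extension. *)
Fact poly_xmod_sigma (M : lmodType k) (D : {linear M -> M}) :
  exists s, is_sigma mulX mulX (fun b : B => b = 1) D s.
Proof.
exists (blift (poly_xmod_bilin D)); split=> [b m|b m|_ m ->]; rewrite !blift_pure.
- by rewrite mulXE pevalXl.
- by rewrite mulXE pevalXl.
- by rewrite peval1.
Qed.

Definition poly_xmod : xmod k := XMod poly_xmod_ind poly_xmod_sigma.

Fact tau_ex (M : lmodType k) (D : {linear M -> M}) :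
  exists t : {linear B ⊗ M -> M ⊗ B},
  [/\ forall b m, t (mulX b ⊗ₜ m) = tsum D mulX (t (b ⊗ₜ m)),
      forall b m, t (b ⊗ₜ D m) = tmap D idfun (t (b ⊗ₜ m)) &
      forall m, t (1 ⊗ₜ m) = m ⊗ₜ 1].
Proof.
exists (sigma poly_xmod D); split=> [b m|b m|m].
- exact: (sigma_xl (Q := poly_xmod)).
- by rewrite -(tmap_pure idfun D) (sigma_D (Q := poly_xmod)).
- exact: (sigma_gen (Q := poly_xmod)).
Qed.

Let poly_env_l : {linear B ⊗ B -> B ⊗ B} := tmap mulX idfun.
Let poly_env_r : {linear B ⊗ B -> B ⊗ B} := tmap idfun mulX.

Fact poly_env_ind (Pr : B ⊗ B -> Prop) :
  Pr 0 -> (forall c x y, Pr x -> Pr y -> Pr (c *: x + y)) ->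
  (forall g, g = 1 ⊗ₜ 1 -> Pr g) -> (forall q, Pr q -> Pr (poly_env_l q)) ->
  (forall q, Pr q -> Pr (poly_env_r q)) -> forall q, Pr q.
Proof.
move=> h0 hD hg hl hr; apply: tensor_ind; last first.
  by move=> x y hx hy; rewrite -[x]scale1r; apply: hD.
move=> b b'; elim/poly_Xind: b => [|p IH|c p q hp hq]; last 2 first.
- by rewrite -[_ * _]mulXE -(tmap_pure _ idfun); apply: hl.
- by rewrite tpureD tpureZ; apply: hD.
elim/poly_Xind: b' => [|p IH|c p q hp hq]; first exact: hg.
- by rewrite -[_ * _]mulXE -(tmap_pure idfun); apply: hr.
- by rewrite tpureD tpureZ; apply: hD.
Qed.

Section Middle.
Variable W : lmodType k.
Let Q := B ⊗ W ⊗ B.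
Let poly_free_l : {linear Q -> Q} := tmap (tmap mulX idfun) idfun.
Let poly_free_r : {linear Q -> Q} := tmap idfun mulX.
Definition poly_free_gen (q : Q) := exists w, q = 1 ⊗ₜ w ⊗ₜ 1.

Fact poly_free_ind (Pr : Q -> Prop) :
  Pr 0 -> (forall c x y, Pr x -> Pr y -> Pr (c *: x + y)) ->
  (forall g, poly_free_gen g -> Pr g) -> (forall q, Pr q -> Pr (poly_free_l q)) ->
  (forall q, Pr q -> Pr (poly_free_r q)) -> forall q, Pr q.
Proof.
move=> h0 hD hg hl hr.
have hD1 x y : Pr x -> Pr y -> Pr (x + y).
  by move=> hx hy; rewrite -[x]scale1r; apply: hD.
apply: tensor_ind => // bw b'; move: bw; apply: tensor_ind; last first.
  by move=> x y hx hy; rewrite tpureD; apply: hD1.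
move=> b w; elim/poly_Xind: b => [|p IH|c p q hp hq]; last 2 first.
- by rewrite -[_ * _]mulXE -[_ ⊗ₜ w](tmap_pure mulX idfun) -(tmap_pure _ idfun); apply: hl.
- by rewrite !(tpureD, tpureZ); apply: hD.
elim/poly_Xind: b' => [|p IH|c p q hp hq]; first by apply: hg; exists w.
- by rewrite -[_ * _]mulXE -(tmap_pure idfun); apply: hr.
- by rewrite tpureD tpureZ; apply: hD.
Qed.

End Middle.

Definition koszul_gen (n : nat) : koszul_mod k n -> Prop :=
  match n with
  | 0 => fun q => q = 1 ⊗ₜ 1
  | 1 => fun q => exists w, q = 1 ⊗ₜ w ⊗ₜ 1
  | _ => fun=> False
  end.

Fact koszul0_l q : bim_l (koszul_mod k 0) 'X q = poly_env_l q.
Proof.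
rewrite bim_lE; tind q as u v.
apply: etrans (env_act_pure _ _ _ _) _; by rewrite /poly_env_l /= tmap_pure mulXE mulr1.
Qed.
Fact koszul0_r q : bim_r (koszul_mod k 0) 'X q = poly_env_r q.
Proof.
rewrite bim_rE; tind q as u v.
apply: etrans (env_act_pure _ _ _ _) _; by rewrite /poly_env_r /= tmap_pure mulXE mul1r [_ * 'X]mulrC.
Qed.
Fact koszul1_l q : bim_l (koszul_mod k 1) 'X q = tmap (tmap mulX idfun) idfun q.
Proof.
rewrite bim_lE; tind q as z v; tind z as u w.
apply: etrans (free_act_pure _ _ _ _ _) _; by rewrite tmap_pure /= tmap_pure /= mulXE mulr1.
Qed.
Fact koszul1_r q : bim_r (koszul_mod k 1) 'X q = tmap idfun mulX q.
Proof.
rewrite bim_rE; tind q as z v; tind z as u w.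
apply: etrans (free_act_pure _ _ _ _ _) _; by rewrite /= tmap_pure /= mulXE mul1r [_ * 'X]mulrC.
Qed.

Fact koszul_ind n (Pr : koszul_mod k n -> Prop) :
  Pr 0 -> (forall c x y, Pr x -> Pr y -> Pr (c *: x + y)) ->
  (forall g, koszul_gen g -> Pr g) -> (forall q, Pr q -> Pr (bim_l _ 'X q)) ->
  (forall q, Pr q -> Pr (bim_r _ 'X q)) -> forall q, Pr q.
Proof.
case: n Pr => [|[|n]] Pr h0 hD hg hl hr; last by move=> q; rewrite [q]thinmx0.
  by apply: poly_env_ind => // q hq; [rewrite -koszul0_l|rewrite -koszul0_r]; auto.
apply: poly_free_ind => // q hq.
  by rewrite -[_ q]koszul1_l; apply: hl.
by rewrite -[_ q]koszul1_r; apply: hr.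
Qed.

Fact eq_sigma (Q : lmodType k) (xl xr xl' xr' : {linear Q -> Q}) G
    (M : lmodType k) (D : {linear M -> M}) s :
  xl =1 xl' -> xr =1 xr' -> is_sigma xl' xr' G D s -> is_sigma xl xr G D s.
Proof.
move=> el er [hl hr hg].
have eqt (x x' : {linear Q -> Q}) z : x =1 x' -> tsum D x z = tsum D x' z.
  by move=> e; tind z as a b; rewrite !tsum_pure e.
by split=> // q m; [rewrite el hl (eqt _ _ _ el) | rewrite er hr (eqt _ _ _ er)].
Qed.

Fact koszul_sigma n (M : lmodType k) (D : {linear M -> M}) :
  exists s, is_sigma (bim_l (koszul_mod k n) 'X) (bim_r _ 'X) (@koszul_gen n) D s.
Proof.
case: n => [|[|n]].
- have [t [tX tD t1]] := tau_ex D; have [s hs] := sigma_ex2 tX tD t1.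
  exists s; apply: eq_sigma hs; [exact: koszul0_l | exact: koszul0_r].
- have [t [tX tD t1]] := tau_ex D.
  have [s hs] := sigma_ex3 (kspan (fun _ : 'I_1 => 'X : B)) tX tD t1.
  exists s; apply: eq_sigma hs; [exact: koszul1_l | exact: koszul1_r].
- by exists \0; split=> //= q m; rewrite lin0.
Qed.

Definition xkoszul n : xmod k := XMod (@koszul_ind n) (@koszul_sigma n).

End Modules.

Lemma tmid_pure (k : fieldType) (U V W V' W' X : lmodType k)
    (f : {linear V ⊗ W -> V' ⊗ W'}) (u : U) v w (x : X) :
  tmid f ((u ⊗ₜ v) ⊗ₜ (w ⊗ₜ x)) = tassoc (u ⊗ₜ tassocV (f (v ⊗ₜ w) ⊗ₜ x)).
Proof. by rewrite /tmid /=; tsimp. Qed.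

(* The properties of [k[x]] used below; abstracting from the concrete algebra
   keeps the calculations in tensor products feasible. *)
Record xalg (k : fieldType) := XAlg {
  xalg_alg :> algType k;
  xalg_X : xalg_alg;
  xalg_ind : forall Pr : xalg_alg -> Prop,
    Pr 1 -> (forall b, Pr b -> Pr (xalg_X * b)) ->
    (forall c x y, Pr x -> Pr y -> Pr (c *: x + y)) -> forall b, Pr b;
  xalg_comm : forall b, xalg_X * b = b * xalg_X;
  xalg_sigma : forall (M : lmodType k) (D : {linear M -> M}), exists s,
    is_sigma (lin ((amul_bilin xalg_alg).2 xalg_X))
      (lin ((amul_bilin xalg_alg).2 xalg_X)) (fun b => b = 1) D s
}.

Definition poly_xalg (k : fieldType) : xalg k :=
  @XAlg k {poly k} 'X (@poly_Xind k) (fun b => mulrC _ _) (@poly_xmod_sigma k).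

(** * The twisting map and the compatibility of bimodules with it *)

Section Compatibility.
Variables (k : fieldType) (B : xalg k).
Let X : B := xalg_X B.
Definition xmul : {linear B -> B} := lin ((amul_bilin B).2 X).
Lemma xmulE b : xmul b = X * b. Proof. exact: linE. Qed.

Fact xreg_ind (Pr : B -> Prop) :
  Pr 0 -> (forall c x y, Pr x -> Pr y -> Pr (c *: x + y)) ->
  (forall g, g = 1 -> Pr g) -> (forall q, Pr q -> Pr (xmul q)) ->
  (forall q, Pr q -> Pr (xmul q)) -> forall q, Pr q.
Proof.
move=> _ hD h1 hX _; apply: xalg_ind => //; first exact: h1.
by move=> b; rewrite -xmulE; apply: hX.
Qed.
Definition xreg : xmod k := XMod xreg_ind (@xalg_sigma k B).

Section Left.
Variables (M : lmodType k) (D : {linear M -> M}).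
Definition sigmaB : {linear B ⊗ M -> M ⊗ B} := sigma xreg D.
Lemma sigmaB_X b m : sigmaB ((X * b) ⊗ₜ m) = tsum D xmul (sigmaB (b ⊗ₜ m)).
Proof. by rewrite -xmulE; apply: (sigma_xl (Q := xreg)). Qed.
Lemma sigmaB1 m : sigmaB (1 ⊗ₜ m) = m ⊗ₜ 1.
Proof. exact: (sigma_gen (Q := xreg)). Qed.
Lemma sigmaB_D z : sigmaB (tmap idfun D z) = tmap D idfun (sigmaB z).
Proof. exact: (sigma_D (Q := xreg)). Qed.
Lemma sigmaB_bij : bijective sigmaB.
Proof. exact: (@sigma_bij k xreg M D). Qed.

Lemma sigmaB_mul b b' m :
  sigmaB ((b * b') ⊗ₜ m) =
  tmap idfun (@amul k B) (tassocV (tmap sigmaB idfun (tassoc (b ⊗ₜ sigmaB (b' ⊗ₜ m))))).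
Proof.
elim/xalg_ind: b => [|b IH|c b1 b2 h1 h2].
- rewrite mul1r; move: (sigmaB _) => y; tind y as m1 b1.
  by tsimp; rewrite sigmaB1; tsimp; rewrite amul_pure mul1r.
- rewrite -mulrA sigmaB_X {}IH; move: (sigmaB (b' ⊗ₜ m)) => y; tind y as m1 b1.
  tsimp; rewrite sigmaB_X; move: (sigmaB _) => y; tind y as m2 b2.
  by tsimp; rewrite !amul_pure !xmulE mulrA.
- by rewrite mulrDl -scalerAl !(tpureD, tpureZ, linD, linZ) h1 h2.
Qed.
End Left.

Lemma sigmaB_nat (M N : lmodType k) (D : {linear M -> M}) (D' : {linear N -> N})
    (f : {linear M -> N}) : (forall m, f (D m) = D' (f m)) ->
  forall z, sigmaB D' (tmap idfun f z) = tmap f idfun (sigmaB D z).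
Proof. exact: (sigma_nat (Q := xreg)). Qed.

Variables (A : algType k) (δ : derivation A).
Let τ := sigmaB δ.

Lemma amul_der z : amul (tsum δ δ z) = δ (amul z).
Proof. by tind z as a b; tsimp; rewrite !amul_pure der_leibniz. Qed.

Lemma sigmaB_tensor (M N : lmodType k) (D : {linear M -> M}) (D' : {linear N -> N}) b m n :
  sigmaB (tsum D D') (b ⊗ₜ (m ⊗ₜ n)) =
  tassoc (tmap idfun (sigmaB D') (tassocV (sigmaB D (b ⊗ₜ m) ⊗ₜ n))).
Proof. exact: (sigma_tensor (Q := xreg)). Qed.

Lemma twistingP : twisting τ.
Proof.
split=> [|a|b|z]; first exact: sigmaB_bij.
- exact: sigmaB1.
- elim/xalg_ind: b => [|b IH|c b1 b2 h1 h2]; first exact: sigmaB1.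
  + by rewrite /τ sigmaB_X -/τ IH tsum_pure der1 tpure0l add0r xmulE.
  + by rewrite !(tpureD, tpureZ) linD linZ h1 h2.
- tind z as bb aa; tind bb as b b'; tind aa as a a'.
  rewrite tmap_pure /= [amul (b ⊗ₜ b')]amul_pure.
  (* The Leibniz rule says that the multiplication of [A] intertwines [tsum δ δ] with [δ], so
     naturality applies to it. *)
  rewrite -[_ ⊗ₜ amul _](tmap_pure idfun) (sigmaB_nat amul_der) /=.
  rewrite sigmaB_mul sigmaB_tensor tmid_pure -/τ.
  move: (τ (b' ⊗ₜ a)) => y; tind y as a1 b1; tsimp.
  move: (τ (b1 ⊗ₜ a')) => y; tind y as a2 b2; tsimp.
  rewrite sigmaB_tensor -/τ; move: (τ (b ⊗ₜ a1)) => y; tind y as a3 b3; tsimp.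
  rewrite tmid_pure; move: (τ (b3 ⊗ₜ a2)) => y; tind y as a4 b4.
  by tsimp; rewrite !amul_pure.
Qed.

Section LeftModule.
Variables (P : bimodule A) (D : {linear P -> P}).
Hypothesis DP : forall a p a',
  D (bim_act (a ⊗ₜ p ⊗ₜ a')) = bim_act (δ a ⊗ₜ p ⊗ₜ a') +
    bim_act (a ⊗ₜ D p ⊗ₜ a') + bim_act (a ⊗ₜ p ⊗ₜ δ a').

(** By [DP] the structure map of [P] intertwines the Leibniz extension of [δ], [D], [δ] with [D];
    the action axiom is then naturality followed by [sigmaB_tensor]. *)
Lemma compatible_lP : compatible_l τ (sigmaB D).
Proof.
split; first exact: sigmaB_bij.
  move=> z; tind z as bb p; tind bb as b b'.
  by rewrite tmap_pure /= amul_pure sigmaB_mul; tsimp.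
move=> z; tind z as ba pa; tind ba as b a; tind pa as p a'.
rewrite /= tassocV_pure [tmap idfun (_ \o _) _]tmap_pure /= tassoc_pure.
rewrite -[b ⊗ₜ bim_act _](tmap_pure idfun).
have h z : bim_act (tsum (tsum δ D) δ z) = D (bim_act z).
  tind z as ap a1; tind ap as a2 p1.
  by rewrite DP; tsimp.
rewrite (sigmaB_nat h) !sigmaB_tensor [tmap τ _ _]tmap_pure -/τ /=.
move: (τ (b ⊗ₜ a)) => y; tind y as a1 b1; tsimp; rewrite tmid_pure.
by move: (sigmaB D _) => y; tind y as p1 b2; tsimp.
Qed.
End LeftModule.

Section RightModule.
Variables (Q : bimodule B) (gen : Q -> Prop).
Hypothesis gen_ind : forall Pr : Q -> Prop,
  Pr 0 -> (forall c x y, Pr x -> Pr y -> Pr (c *: x + y)) ->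
  (forall g, gen g -> Pr g) -> (forall q, Pr q -> Pr (bim_l _ X q)) ->
  (forall q, Pr q -> Pr (bim_r _ X q)) -> forall q, Pr q.
Hypothesis gen_sigma : forall (M : lmodType k) (D : {linear M -> M}),
  exists s, is_sigma (bim_l Q X) (bim_r Q X) gen D s.
Let xQ : xmod k := XMod gen_ind gen_sigma.

Definition sigmaQ : {linear Q ⊗ A -> A ⊗ Q} := sigma xQ δ.
Lemma sigmaQ_l q a : sigmaQ (bim_l _ X q ⊗ₜ a) = tsum δ (bim_l _ X) (sigmaQ (q ⊗ₜ a)).
Proof. exact: (sigma_xl (Q := xQ)). Qed.
Lemma sigmaQ_r q a : sigmaQ (bim_r _ X q ⊗ₜ a) = tsum δ (bim_r _ X) (sigmaQ (q ⊗ₜ a)).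
Proof. exact: (sigma_xr (Q := xQ)). Qed.
Lemma sigmaQ_der q a : sigmaQ (q ⊗ₜ δ a) = tmap δ idfun (sigmaQ (q ⊗ₜ a)).
Proof. by rewrite -(tmap_pure idfun); apply: (sigma_D (Q := xQ)). Qed.

Lemma compatible_rP : compatible_r τ sigmaQ.
Proof.
split; first exact: (@sigma_bij k xQ A δ).
  move=> z; tind z as q aa; tind aa as a a'.
  by rewrite [LHS](sigma_nat (Q := xQ) amul_der) (sigma_tensor (Q := xQ)) /=; tsimp.
move=> z; tind z as bq ba; tind bq as b q; tind ba as b' a.
rewrite /= [tassoc (_ ⊗ₜ (_ ⊗ₜ _))]tassoc_pure [tmap bim_act _ _]tmap_pure /=.
rewrite [tmap idfun τ _]tmap_pure /= bim_lrE.
(* The action of [b] and [c] on [y], with [b] moved past [A] by [τ]. Its behaviour under [X] and [δ]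
   gives the action axiom by induction, first on [b] and then on [b']. *)
pose G b y c : A ⊗ Q := tmap idfun (bim_act \o @tassoc k B Q B)
  (tassocV (tmap τ idfun (tassoc (b ⊗ₜ tassocV (y ⊗ₜ c))))).
have G1 y c : G 1 y c = tmap idfun (bim_r _ c) y.
  rewrite /G; tind y as a1 q1; tsimp; rewrite /τ sigmaB1; tsimp.
  by rewrite bim_lrE bim_l1.
have GX b1 y c : G (X * b1) y c = tsum δ (bim_l _ X) (G b1 y c).
  rewrite /G; tind y as a1 q1; tsimp; rewrite /τ sigmaB_X -/τ.
  move: (τ _) => z; tind z as a2 b2; tsimp.
  by rewrite !bim_lrE xmulE bim_lM.
have Gd b1 y c : G b1 (tmap δ idfun y) c = tmap δ idfun (G b1 y c).
  rewrite /G; tind y as a1 q1; tsimp.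
  rewrite -[b1 ⊗ₜ δ a1](tmap_pure idfun δ) [τ (tmap _ _ _)]sigmaB_D -/τ.
  by move: (τ _) => z; tind z as a2 b2; tsimp.
have Gc b1 y c : G b1 y (xmul c) = tmap idfun (bim_r _ X) (G b1 y c).
  rewrite /G; tind y as a1 q1; tsimp.
  move: (τ _) => z; tind z as a2 b2; tsimp.
  by rewrite !bim_lrE -bim_lrC xmulE xalg_comm bim_rM.
have Gl q1 : sigmaQ (bim_l Q b q1 ⊗ₜ a) = G b (sigmaQ (q1 ⊗ₜ a)) 1.
  elim/xalg_ind: (b : B) => [|b1 IH|c b1 b2 h1 h2].
  - rewrite G1 bim_l1; move: (sigmaQ _) => y; tind y as a1 q2; tsimp.
    by rewrite bim_r1.
  - by rewrite bim_lM sigmaQ_l IH GX.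
  - rewrite (bim_l_bilin Q).1 /G !(tpureD, tpureZ, linD, linZ) -!/(G _ _ _).
    by rewrite h1 h2.
elim/xalg_ind: b' => [|b1 IH|c b1 b2 h1 h2].
- by rewrite bim_r1 Gl /τ sigmaB1 tmid_pure.
(* Right actions compose in the opposite order, so [X] has to stand at the end of [b']. *)
- rewrite xalg_comm bim_rM bim_lrC sigmaQ_r IH -xalg_comm sigmaB_X -/τ.
  move: (τ (b1 ⊗ₜ a)) => z; tind z as a1 b2.
  rewrite [tsum δ xmul _]tsum_pure tpureDr !linD /= !tmid_pure -!/(G b _ _).
  by rewrite Gc sigmaQ_der Gd linE.
- by rewrite (bim_r_bilin Q).1 !(tpureD, tpureZ, linD, linZ) h1 h2.
Qed.
End RightModule.

End Compatibility.

(** * Exterior powers *)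

(** A recursion in which a stage can be continued only if it is [good]. In the uses below [good] is
    the alternation condition that lets the next map pass to the exterior power. *)
Lemma rec_family (T : nat -> Type) (t0 : T 0%N) (good : forall n, T n -> Prop)
    (rel : forall n, T n -> T n.+1 -> Prop) :
  good 0%N t0 ->
  (forall n t, good n t -> exists t', good n.+1 t' /\ rel n t t') ->
  exists f : forall n, T n, f 0%N = t0 /\ forall n, rel n (f n) (f n.+1).
Proof.
move=> h0 hS; pose step n (x : {t | good n t}) : {t | good n.+1 t} :=
  let c := cid (hS n (sval x) (svalP x)) in exist _ (sval c) (svalP c).1.
pose f := nat_rect (fun n => {t | good n t}) (exist _ t0 h0) step.
exists (fun n => sval (f n)); split=> // n /=.
by case: cid => t [gt rt] /=.
Qed.

Section ExteriorTheory.
Variables (k : fieldType) (V : lmodType k).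
Implicit Types (n : nat) (u : V).
Notation Λ n := (extpow n V).

Definition upd n (v : 'I_n -> V) i x : 'I_n -> V := fun j => if j == i then x else v j.

Lemma eq_wedge n (v v' : 'I_n -> V) : v =1 v' -> wedge v = wedge v'.
Proof. by move=> e; rewrite /wedge; congr ugen; apply/ffunP => i; rewrite !ffunE. Qed.

Lemma wedge_updP n (v : 'I_n -> V) i c x y :
  wedge (upd v i (c *: x + y)) = c *: wedge (upd v i x) + wedge (upd v i y).
Proof.
have := (@wedge_alternating k n V).1 [ffun j => v j] i c x y.
have e z : wedge (ffun_upd [ffun j => v j] i z) = wedge (upd v i z).
  by apply: eq_wedge => j; rewrite /upd !ffunE.
by rewrite !e.
Qed.

Lemma wedge_updD n (v : 'I_n -> V) i x y :
  wedge (upd v i (x + y)) = wedge (upd v i x) + wedge (upd v i y).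
Proof. by rewrite -[x in LHS]scale1r wedge_updP scale1r. Qed.

Lemma wedge_alt n (v : 'I_n -> V) i j : i != j -> v i = v j -> wedge v = 0.
Proof.
move=> ij e; have := (@wedge_alternating k n V).2 [ffun j => v j] i j ij.
rewrite !ffunE => /(_ e) <-.
by apply: eq_wedge => m; rewrite ffunE.
Qed.

(** Polarization of [W (v i + v j) (v i + v j) = 0], valid in every characteristic. *)
Lemma wedge_tperm n (v : 'I_n -> V) i j : i != j ->
  wedge (v \o tperm i j) = - wedge v.
Proof.
move=> ij; pose W x y := wedge (upd (upd v i x) j y).
have W0 x : W x x = 0.
  by apply: (@wedge_alt n _ i j) => //; rewrite /upd eqxx (negPf ij) eqxx.
have WDl x y z : W (x + y) z = W x z + W y z.
  have swap a b : W a b = wedge (upd (upd v j b) i a).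
    apply: eq_wedge => m; rewrite /upd.
    by case: eqP => // -> ; rewrite eq_sym (negPf ij).
  by rewrite !swap wedge_updD.
have WDr x y z : W z (x + y) = W z x + W z y by rewrite /W wedge_updD.
have := W0 (v i + v j); rewrite WDl !WDr !W0 addr0 add0r => /eqP.
rewrite addrC addr_eq0 => /eqP.
have -> : W (v i) (v j) = wedge v.
  apply: eq_wedge => m; rewrite /upd.
  by case: eqP => [->|] //; case: eqP => [->|].
move=> <-; apply: eq_wedge => m; rewrite /upd /=.
case: tpermP => [->|->|/eqP/negPf hi /eqP/negPf hj].
- by rewrite (negPf ij) eqxx.
- by rewrite eqxx.
- by rewrite hi hj.
Qed.

(** Vectors are appended at the end, so that the last variable of the Ore tower becomes the last
    factor of a wedge. *)
Definition snoc n (v : 'I_n -> V) u : 'I_n.+1 -> V :=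
  fun i => if unlift ord_max i is Some j then v j else u.

Lemma snoc_lift n (v : 'I_n -> V) u i : snoc v u (lift ord_max i) = v i.
Proof. by rewrite /snoc liftK. Qed.
Lemma snoc_max n (v : 'I_n -> V) u : snoc v u ord_max = u.
Proof. by rewrite /snoc unlift_none. Qed.
Lemma snoc_eta n (v : 'I_n.+1 -> V) : snoc (v \o lift ord_max) (v ord_max) =1 v.
Proof. by move=> i; case: (unliftP ord_max i) => [j ->|->]; rewrite ?snoc_lift ?snoc_max. Qed.

Lemma snoc_upd n (v : 'I_n -> V) u i x :
  snoc (upd v i x) u =1 upd (snoc v u) (lift ord_max i) x.
Proof.
move=> j; rewrite /upd; case: (unliftP ord_max j) => [m ->|->].
  by rewrite !snoc_lift (inj_eq lift_inj).
by rewrite !snoc_max (negPf (neq_lift _ _)).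
Qed.

Lemma alternatingI n (W : lmodType k) (f : ('I_n -> V) -> W) :
  (forall v v', v =1 v' -> f v = f v') ->
  (forall v i c x y, f (upd v i (c *: x + y)) = c *: f (upd v i x) + f (upd v i y)) ->
  (forall v i j, i != j -> v i = v j -> f v = 0) ->
  alternating (fun v : {ffun 'I_n -> V} => f v).
Proof.
move=> fe fl f0; split=> [v i c x y|v i j]; last exact: f0.
have e z : f (ffun_upd v i z) = f (upd v i z) by apply: fe => j; rewrite ffunE.
by rewrite !e.
Qed.

Lemma ext_lift_ex n (W : lmodType k) (f : ('I_n -> V) -> W) :
  (forall v v', v =1 v' -> f v = f v') ->
  (forall v i c x y, f (upd v i (c *: x + y)) = c *: f (upd v i x) + f (upd v i y)) ->
  (forall v i j, i != j -> v i = v j -> f v = 0) ->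
  exists h : {linear Λ n -> W}, forall v, h (wedge v) = f v.
Proof.
move=> fe fl f0; have [h hE] := extpow_lift (alternatingI fe fl f0).
exists h => v; rewrite -(@eq_wedge _ [ffun i => v i]) ?hE; last by move=> i; rewrite ffunE.
by apply: fe => i; rewrite ffunE.
Qed.

Fact rmul_ex n u : exists h : {linear Λ n -> Λ n.+1},
  forall v, h (wedge v) = wedge (snoc v u).
Proof.
apply: ext_lift_ex => [v v' e|v i c x y|v i j ij e].
- by apply: eq_wedge => i; rewrite /snoc; case: unlift.
- by rewrite !(eq_wedge (snoc_upd _ _ _ _)) wedge_updP.
- apply: (@wedge_alt _ _ (lift ord_max i) (lift ord_max j)).
    by rewrite (inj_eq lift_inj).
  by rewrite !snoc_lift.
Qed.
Definition rmul n u : {linear Λ n -> Λ n.+1} := sval (cid (rmul_ex n u)).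
Lemma rmul_wedge n u (v : 'I_n -> V) : rmul n u (wedge v) = wedge (snoc v u).
Proof. exact: svalP (cid (rmul_ex n u)) v. Qed.

#[local] Opaque rmul.

Lemma ext_wedge_ind n (Pr : Λ n -> Prop) :
  Pr 0 -> (forall c x y, Pr x -> Pr y -> Pr (c *: x + y)) ->
  (forall v, Pr (wedge v)) -> forall z, Pr z.
Proof.
move=> h0 hD hw z; have [s ->] := univ_span z.
elim: s => [|[c v] s IH]; first by rewrite big_nil.
rewrite big_cons /=; apply: hD => //.
have -> : ugen v = wedge v; last exact: hw.
by rewrite /wedge; congr ugen; apply/ffunP => i; rewrite ffunE.
Qed.

Lemma ext0_ind (Pr : Λ 0 -> Prop) (e : 'I_0 -> V) :
  (forall c, Pr (c *: wedge e)) -> forall z, Pr z.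
Proof.
move=> h z; have [c ->] : exists c : k, z = c *: wedge e; last exact: h.
elim/ext_wedge_ind: z => [|c x y [a ->] [b ->]|v].
- by exists 0; rewrite scale0r.
- by exists (c * a + b); rewrite scalerDl scalerA.
- by exists 1; rewrite scale1r; apply: eq_wedge => -[].
Qed.

Lemma wedge_rmul n (v : 'I_n.+1 -> V) :
  wedge v = rmul n (v ord_max) (wedge (v \o lift ord_max)).
Proof. by rewrite rmul_wedge; apply: eq_wedge => i; rewrite snoc_eta. Qed.

Lemma ext_ind n (Pr : Λ n.+1 -> Prop) :
  (forall x y, Pr x -> Pr y -> Pr (x + y)) ->
  (forall u w, Pr (rmul n u w)) -> forall z, Pr z.
Proof.
move=> hD hr z.
(* Multiples are included because [ext_wedge_ind] needs them; on [rmul n u w] a scalar is absorbed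
   by [w]. *)
suff : Pr z /\ forall c, Pr (c *: z) by case.
elim/ext_wedge_ind: z => [|c x y [h1 h1'] [h2 h2']|v].
- have h : Pr 0 by rewrite -(lin0 (rmul n 0)); apply: hr.
  by split=> [|c]; rewrite ?scaler0.
- by split=> [|a]; [|rewrite scalerDr scalerA]; apply: hD.
- by rewrite wedge_rmul; split=> [|c]; rewrite -?linZ; apply: hr.
Qed.

Lemma rmulP n c u u' w : rmul n (c *: u + u') w = c *: rmul n u w + rmul n u' w.
Proof.
elim/ext_wedge_ind: w => [|a x y h1 h2|v].
- by rewrite !lin0 addr0.
- rewrite ![rmul _ _ (_ + _)]linD ![rmul _ _ (a *: _)]linZ h1 h2 !scalerDr !scalerA.
  by rewrite [c * a]mulrC addrACA.
- have e x : rmul n x (wedge v) = wedge (upd (snoc v 0) ord_max x).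
    rewrite rmul_wedge; apply: eq_wedge => i; rewrite /upd.
    case: (unliftP ord_max i) => [j ->|->]; last by rewrite eqxx snoc_max.
    by rewrite [_ == _]eq_sym (negPf (neq_lift _ _)) !snoc_lift.
  by rewrite !e wedge_updP.
Qed.
Lemma rmulD n u u' w : rmul n (u + u') w = rmul n u w + rmul n u' w.
Proof. by have := rmulP 1 u u' w; rewrite !scale1r. Qed.
Lemma rmul0 n w : rmul n 0 w = 0.
Proof. by apply: (addrI (rmul n 0 w)); rewrite -rmulD !addr0. Qed.
Lemma rmulZ n c u w : rmul n (c *: u) w = c *: rmul n u w.
Proof. by have := rmulP c u 0 w; rewrite rmul0 !addr0. Qed.

Lemma rmul_rmul n u w : rmul n.+1 u (rmul n u w) = 0.
Proof.
elim/ext_wedge_ind: w => [|c x y h1 h2|v].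
- by rewrite !lin0.
- by rewrite !linD ![rmul _ _ (c *: _)]linZ h1 h2 scaler0 addr0.
- rewrite !rmul_wedge; apply: (@wedge_alt _ _ (lift ord_max ord_max) ord_max).
    by rewrite eq_sym neq_lift.
  by rewrite snoc_lift !snoc_max.
Qed.

Lemma rmulC n u u' w : rmul n.+1 u (rmul n u' w) = - rmul n.+1 u' (rmul n u w).
Proof.
have := rmul_rmul (u + u') w; rewrite !rmulD !linD !rmul_rmul addr0 add0r => /eqP.
by rewrite addr_eq0 => /eqP.
Qed.

(** The alternation condition for a map defined by its last vector. In degree [0] there is no second
    vector that could repeat it. *)
Definition ralt n (W : lmodType k) : (V -> Λ n -> W) -> Prop :=
  match n with
  | 0 => fun _ => True
  | m.+1 => fun g => forall u w, g u (rmul m u w) = 0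
  end.

(** A transposition brings [v i] to the last place, and its sign is absorbed by [w]. *)
Lemma wedge_last n (v : 'I_n.+1 -> V) i : exists w, wedge v = rmul n (v i) w.
Proof.
case: (eqVneq i ord_max) => [->|hi]; first by rewrite wedge_rmul; eexists.
exists (- wedge ((v \o tperm i ord_max) \o lift ord_max)).
by rewrite linN -[LHS]opprK -(wedge_tperm _ hi) wedge_rmul /= tpermR.
Qed.

(** The universal property of the exterior power, as a recursion on the last factor. A repetition
    among the first [n] vectors is killed by their wedge; one that involves the last vector is
    brought by [wedge_last] to the form covered by [ralt]. *)
Lemma rlift_ex n (W : lmodType k) (g : V -> Λ n -> W) :
  bilin g -> ralt g ->
  exists h : {linear Λ n.+1 -> W}, forall u w, h (rmul n u w) = g u w.
Proof.
move=> [gl gr] ga.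
have g0 u : g u 0 = 0.
  by have := gr u (-1) 0 0; rewrite !scaleN1r oppr0 addr0 addNr.
have last0 (v : 'I_n -> V) i : g (v i) (wedge v) = 0.
  case: n g ga v i {gl gr g0} => [|n] g ga v i; first by case: i.
  by have [w ->] := wedge_last v i; apply: ga.
pose f (v : 'I_n.+1 -> V) := g (v ord_max) (wedge (v \o lift ord_max)).
have fe v v' : v =1 v' -> f v = f v'.
  by move=> e; rewrite /f e; congr g; apply: eq_wedge => m; apply: e.
have max_lift (m : 'I_n) : (ord_max == lift ord_max m) = false.
  exact: negPf (neq_lift _ _).
have [h hE] : exists h : {linear Λ n.+1 -> W}, forall v, h (wedge v) = f v.
  apply: ext_lift_ex => // [v i c x y|v i j].
  - rewrite /f /upd; case: (unliftP ord_max i) => [m ->|->].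
      rewrite max_lift; have e z : wedge (upd v (lift ord_max m) z \o lift ord_max) =
          wedge (upd (v \o lift ord_max) m z).
        by apply: eq_wedge => j; rewrite /upd /= (inj_eq lift_inj).
      by rewrite !e wedge_updP gr.
    rewrite eqxx; have e z : wedge (upd v ord_max z \o lift ord_max) =
          wedge (v \o lift ord_max).
      by apply: eq_wedge => j; rewrite /upd /= eq_sym max_lift.
    by rewrite !e gl.
  - rewrite /f; case: (unliftP ord_max i) => [a ->|->];
      case: (unliftP ord_max j) => [b ->|->] ij e.
    + by rewrite (@wedge_alt _ (v \o lift ord_max) a b) ?g0 // -(inj_eq (@lift_inj _ ord_max)).
    + by rewrite -e -[v _]/((v \o lift ord_max) a) last0.
    + by rewrite e -[v _]/((v \o lift ord_max) b) last0.
    + by rewrite eqxx in ij.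
exists h => u w; elim/ext_wedge_ind: w => [|c x y h1 h2|v].
- by rewrite !lin0 g0.
- by rewrite ![rmul _ _ (_ + _)]linD [rmul _ _ (c *: _)]linZ linD linZ h1 h2 gr.
- rewrite rmul_wedge hE /f snoc_max; congr g; apply: eq_wedge => i.
  by rewrite /= snoc_lift.
Qed.

Section Derivation.
Variable f : {linear V -> V}.

Fact extD_ex : exists D : forall n, {linear Λ n -> Λ n},
  D 0%N = \0 /\ forall n u w,
  D n.+1 (rmul n u w) = rmul n u (D n w) + rmul n (f u) w.
Proof.
pose g n (h : {linear Λ n -> Λ n}) u w := rmul n u (h w) + rmul n (f u) w.
apply: (@rec_family (fun n => {linear Λ n -> Λ n}) \0 (fun n h => ralt (g n h))
  (fun n h h' => forall u w, h' (rmul n u w) = g n h u w)) => // n h gh.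
have [|h' hE] := @rlift_ex n _ (g n h) _ gh.
  split=> [w c u u'|u c w w']; rewrite /g.
    by rewrite linD linZ !rmulP scalerDr addrACA.
  by rewrite linD linZ ![rmul _ _ (_ + _)]linD ![rmul _ _ (c *: _)]linZ scalerDr addrACA.
exists h'; split=> // u w.
(* One term contains [u] twice; the other two differ by exchanging [u] and [f u] and cancel. *)
by rewrite /g hE /g linD rmul_rmul add0r rmulC addNr.
Qed.

(* The derivation of the exterior algebra extending [f]. *)
Definition extD := sval (cid extD_ex).
Lemma extD0 w : extD 0 w = 0. Proof. by rewrite /extD; case: cid => D [/= ->]. Qed.
Lemma extD_rmul n u w :
  extD n.+1 (rmul n u w) = rmul n u (extD n w) + rmul n (f u) w.
Proof. by rewrite /extD; case: cid => D [/= _ ->]. Qed.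
End Derivation.

Lemma extD_lin (f g h : {linear V -> V}) c : (forall v, h v = c *: f v + g v) ->
  forall n w, extD h n w = c *: extD f n w + extD g n w.
Proof.
move=> hE; elim=> [|n IH] w; first by rewrite !extD0 scaler0 addr0.
elim/ext_ind: w => [x y hx hy|u w].
  by rewrite ![extD _ _ (_ + _)]linD hx hy scalerDr addrACA.
rewrite !extD_rmul hE IH rmulP linD [rmul _ _ (c *: _)]linZ scalerDr.
by rewrite addrACA.
Qed.

(** The extension to the exterior algebra is a homomorphism of Lie algebras. The commutator is given
    pointwise, in the form in which [br_der] provides it. *)
Lemma extD_comm (f g h : {linear V -> V}) : (forall v, h v = f (g v) - g (f v)) ->
  forall n w, extD h n w = extD f n (extD g n w) - extD g n (extD f n w).
Proof.
move=> hE; elim=> [|n IH] w; first by rewrite !extD0 subrr.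
elim/ext_ind: w => [x y hx hy|u w].
  by rewrite !(linD (extD _ _)) hx hy opprD addrACA.
rewrite !extD_rmul !(linD (extD _ _)) !extD_rmul hE IH linB rmulD.
rewrite -[- g (f u)]scaleN1r rmulZ scaleN1r.
set a := rmul n u _; set b := rmul n u _; set c := rmul n (g u) _.
set d := rmul n (f u) _; set p := rmul n (f (g u)) _; set q := rmul n (g (f u)) _.
abelian.
Qed.

End ExteriorTheory.

#[global] Opaque rmul extD.

Section ExtMap.
Variables (k : fieldType) (V V' : lmodType k) (f : {linear V -> V'}).
Fact extmap_ex n : exists h : {linear extpow n V -> extpow n V'},
  forall v, h (wedge v) = wedge (f \o v).
Proof.
apply: ext_lift_ex => [v v' e|v i c x y|v i j ij e].
- by apply: eq_wedge => i /=; rewrite e.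
- have e z : wedge (f \o upd v i z) = wedge (upd (f \o v) i (f z)).
    by apply: eq_wedge => j; rewrite /upd /=; case: ifP.
  by rewrite !e linD linZ wedge_updP.
- by apply: (wedge_alt ij); rewrite /= e.
Qed.
Definition extmap n := sval (cid (extmap_ex n)).
Lemma extmap_wedge n v : extmap n (wedge v) = wedge (f \o v).
Proof. exact: svalP (cid (extmap_ex n)) v. Qed.
Lemma extmap_rmul n u w : extmap n.+1 (rmul n u w) = rmul n (f u) (extmap n w).
Proof.
elim/ext_wedge_ind: w => [|c x y h1 h2|v]; first by rewrite !lin0.
  by rewrite !linD ![_ (c *: _)]linZ ![extmap _ (c *: _)]linZ ![rmul _ _ (c *: _)]linZ h1 h2.
rewrite rmul_wedge !extmap_wedge rmul_wedge; apply: eq_wedge => i /=.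
by rewrite /snoc; case: unlift.
Qed.
End ExtMap.
#[global] Opaque extmap.

#[global] Opaque extpow.

(** * The Chevalley-Eilenberg complex of bimodules *)

Section Inner.
Variables (k : fieldType) (A : algType k) (x : A).
Fact inner_linear : linear (fun a : A => x * a - a * x).
Proof.
move=> c a b; rewrite mulrDr mulrDl -scalerAr -scalerAl scalerBr opprD.
by rewrite addrACA.
Qed.
Fact inner_leibniz a b :
  lin inner_linear (a * b) = lin inner_linear a * b + a * lin inner_linear b.
Proof. by rewrite !linE mulrBl mulrBr !mulrA addrA subrK. Qed.
Definition inner : derivation A := Derivation inner_leibniz.
Lemma innerE a : inner a = x * a - a * x. Proof. exact: linE. Qed.
End Inner.

Section InnerTheory.
Variables (k : fieldType) (A : algType k).
Implicit Types x y : A.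
Lemma innerP c x x' y : inner (c *: x + x') y = c *: inner x y + inner x' y.
Proof.
rewrite !innerE mulrDl mulrDr -scalerAl -scalerAr scalerBr opprD.
by rewrite addrACA.
Qed.
Lemma inner_xx x : inner x x = 0. Proof. by rewrite innerE subrr. Qed.
Lemma inner_scalar x c : inner x c%:A = 0.
Proof. by rewrite innerE -scalerAr -scalerAl mulr1 mul1r subrr. Qed.
Lemma inner_scalar_l c x y : inner (c%:A + x) y = inner x y.
Proof. by rewrite innerP [inner 1 y]innerE mul1r mulr1 subrr scaler0 add0r. Qed.
Lemma inner_der (δ : derivation A) x y : δ (inner x y) = inner (δ x) y + inner x (δ y).
Proof.
by rewrite !innerE linB !der_leibniz [δ y * x + _]addrC opprD addrACA.
Qed.
End InnerTheory.

(* [ed_br] is the bracket of the Lie algebra [V] for which [A] is a quotient of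
   the tensor algebra by relations [v w - w v = [v, w] + (a constant)]. *)
Record env_data (k : fieldType) (A : algType k) (V : lmodType k) := EnvData {
  ed_inc :> {linear V -> A};
  ed_br : V -> {linear V -> V};
  ed_sep : forall c v, ed_inc v = c%:A -> v = 0;
  ed_comm : forall v w, exists c, inner (ed_inc v) (ed_inc w) = c%:A + ed_inc (ed_br v w)
}.

Section Complex.
Variables (k : fieldType) (A : algType k) (V : lmodType k) (E : env_data A V).
Notation inc := (ed_inc E).
Notation br := (ed_br E).
Notation Λ n := (extpow n V).
Notation P n := (A ⊗ extpow n V ⊗ A).
Notation act := (@free_act k A (extpow _ V)).
(* The carriers are tensor products rather than [free_bimodule]s for efficiency. *)
Notation act_hom f := (forall a m b, f (act (a ⊗ₜ m ⊗ₜ b)) = act (a ⊗ₜ f m ⊗ₜ b)).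

(** Equations in [A] can thus be compared in their [V]-parts. In this way alternation of the
    bracket, its linearity in the first argument and its behaviour under derivations follow from
    those of the commutator. *)
Lemma ed_uniq c c' v v' : c%:A + inc v = c'%:A + inc v' -> v = v'.
Proof.
move=> h; apply/eqP; rewrite -subr_eq0; apply/eqP.
apply: (@ed_sep _ _ _ E (c' - c)); rewrite linB scalerBl.
by apply/eqP; rewrite subr_eq -addrAC -h addrAC subrr add0r.
Qed.

Lemma ed_brP c u u' v : br (c *: u + u') v = c *: br u v + br u' v.
Proof.
have [c1 h1] := ed_comm E u v; have [c2 h2] := ed_comm E u' v.
have [c3] := ed_comm E (c *: u + u') v; rewrite linD linZ innerP h1 h2.
rewrite scalerDr scalerA addrACA -scalerDl -(linZ inc) -(linD inc).
by move=> /esym/ed_uniq.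
Qed.

Lemma br_alt u : br u u = 0.
Proof.
have [c] := ed_comm E u u; rewrite inner_xx => h; apply: (@ed_uniq c 0).
by rewrite -h lin0 scale0r addr0.
Qed.

Lemma free_ind n (Pr : P n -> Prop) :
  (forall x y, Pr x -> Pr y -> Pr (x + y)) ->
  (forall a w b, Pr (a ⊗ₜ w ⊗ₜ b)) -> forall p, Pr p.
Proof.
move=> hD h; apply: tensor_ind => // x b; move: x; apply: tensor_ind => // x y hx hy.
by rewrite tpureDl; apply: hD.
Qed.

Definition cmul n u : {linear P n -> P n.+1} :=
  lin (linearP (tmap (tmap idfun (rmul n u)) idfun)).
Lemma cmul_pure n u a (w : Λ n) b : cmul n u (a ⊗ₜ w ⊗ₜ b) = a ⊗ₜ rmul n u w ⊗ₜ b.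
Proof. by rewrite linE; tsimp. Qed.

#[local] Opaque cmul.

Lemma cmul_hom n u : act_hom (cmul n u).
Proof.
move=> a m b; elim/free_ind: m => [x y hx hy|a' w b'].
  by rewrite !(tpureDr, tpureDl, linD) hx hy.
by rewrite free_act_pure !cmul_pure /= free_act_pure.
Qed.

Lemma cmul_cmul n u p : cmul n.+1 u (cmul n u p) = 0.
Proof.
elim/free_ind: p => [x y hx hy|a w b]; first by rewrite !linD hx hy addr0.
by rewrite !cmul_pure rmul_rmul tpure0r tpure0l.
Qed.

Lemma cmulP n c u u' p : cmul n (c *: u + u') p = c *: cmul n u p + cmul n u' p.
Proof.
elim/free_ind: p => [x y hx hy|a w b].
  by rewrite !linD /=; add_split hx hy.
by rewrite 3!cmul_pure rmulP tpureDr tpureZr tpureDl tpureZl /=.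
Qed.

Lemma cmul_ind n (Pr : P n.+1 -> Prop) :
  (forall x y, Pr x -> Pr y -> Pr (x + y)) ->
  (forall u p, Pr (cmul n u p)) -> forall p, Pr p.
Proof.
move=> hD h; apply: free_ind => // a w b.
elim/ext_ind: w => [x y hx hy|u w]; first by rewrite tpureDr tpureDl; apply: hD.
by rewrite -cmul_pure.
Qed.

(* [Θ_u p = u p - p u - D_u p], see [thetaE] below, where [D_u] extends the
   inner derivation of [u]. *)
Definition theta u n : {linear P n -> P n} :=
  lin (linearP (tmap (tmap (lin ((amul_bilin A).1 (inc u))) idfun) idfun \-
    tmap idfun (lin ((amul_bilin A).2 (inc u))) \-
    tmap (tmap idfun (extD (br u) n)) idfun)).
Lemma theta_pure u n a (w : Λ n) b :
  theta u n (a ⊗ₜ w ⊗ₜ b) = (a * inc u) ⊗ₜ w ⊗ₜ b - a ⊗ₜ w ⊗ₜ (inc u * b) -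
    a ⊗ₜ extD (br u) n w ⊗ₜ b.
Proof. by rewrite linE /=; tsimp; rewrite !linE. Qed.

#[local] Opaque theta.

Lemma theta_hom u n : act_hom (theta u n).
Proof.
move=> a m b; elim/free_ind: m => [x y hx hy|a' w b'].
  by rewrite !(tpureDr, tpureDl, linD) hx hy.
rewrite free_act_pure !theta_pure /= !tpureB /= !linB /= !free_act_pure.
by rewrite !mulrA.
Qed.

(** The derivation [D_u] kills [u], as [[u, u] = 0]. This makes the recursion for the differential
    alternating. *)
Lemma theta_cmul u n p : theta u n.+1 (cmul n u p) = cmul n u (theta u n p).
Proof.
elim/free_ind: p => [x y hx hy|a w b].
  by rewrite !linD /=; add_split hx hy.
by rewrite cmul_pure 2!theta_pure extD_rmul br_alt rmul0 addr0 2!linB 3!cmul_pure.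
Qed.

Lemma thetaP n c u u' p : theta (c *: u + u') n p = c *: theta u n p + theta u' n p.
Proof.
elim/free_ind: p => [x y hx hy|a w b].
  by rewrite !linD /=; add_split hx hy.
rewrite !theta_pure (extD_lin (ed_brP _ _ _)) linD linZ.
rewrite mulrDl mulrDr -scalerAl -scalerAr !(tpureD, tpureZ).
rewrite !scalerBr !opprD.
by rewrite [X in X + _ = _]addrACA [LHS]addrACA.
Qed.

(** The alternation check: for [w] ending in [u], the first term of the recursion contains
    [(-1)^n Θ_u p ∧ u], the second is [(-1)^(n+1) Θ_u (p ∧ u)], and these cancel by [theta_cmul]. *)
Fact cdifL_ex : exists d : forall n, {linear Λ n.+1 -> P n},
  (forall u w, d 0%N (rmul 0 u w) = theta u 0 (1 ⊗ₜ w ⊗ₜ 1)) /\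
  forall n u w, d n.+1 (rmul n.+1 u w) =
    cmul n u (d n w) + (-1) ^+ n.+1 *: theta u n.+1 (1 ⊗ₜ w ⊗ₜ 1).
Proof.
have tb n : bilin (fun u (w : Λ n) => theta u n (1 ⊗ₜ w ⊗ₜ 1)).
  split=> [w c u u'|u c w w']; first by rewrite thetaP.
  by rewrite tpureDr tpureZr tpureDl tpureZl linD linZ.
have [d0 d0E] := rlift_ex (tb 0%N) I.
pose g n (h : {linear Λ n.+1 -> P n}) u w :=
  cmul n u (h w) + (-1) ^+ n.+1 *: theta u n.+1 (1 ⊗ₜ w ⊗ₜ 1).
have [||d [hd0 hdS]] := @rec_family (fun n => {linear Λ n.+1 -> P n}) d0
  (fun n h => ralt (g n h)) (fun n h h' => forall u w, h' (rmul n.+1 u w) = g n h u w).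
- move=> u w; rewrite /g d0E expr1 scaleN1r -theta_cmul cmul_pure.
  by rewrite subrr.
- move=> n h gh; have [|h' hE] := @rlift_ex _ _ n.+1 _ (g n h) _ gh.
    split=> [w c u u'|u c w w']; rewrite /g.
      by rewrite cmulP (tb _).1 !scalerDr !scalerA [c * _]mulrC addrACA.
    by rewrite (linP h) (linP (cmul _ _)) (tb _).2 !scalerDr !scalerA [c * _]mulrC addrACA.
  exists h'; split=> // u w.
  rewrite /g hE /g linD linZ cmul_cmul add0r -theta_cmul cmul_pure.
  by rewrite -scalerDl [in X in _ + X]exprS mulN1r subrr scale0r.
- by exists d; split=> [u w|n u w]; [rewrite hd0 d0E | rewrite hdS].
Qed.

Definition cdifL := sval (cid cdifL_ex).
Lemma cdifL0 u w : cdifL 0 (rmul 0 u w) = theta u 0 (1 ⊗ₜ w ⊗ₜ 1).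
Proof. by rewrite /cdifL; case: cid => d []. Qed.
Lemma cdifLS n u w : cdifL n.+1 (rmul n.+1 u w) =
  cmul n u (cdifL n w) + (-1) ^+ n.+1 *: theta u n.+1 (1 ⊗ₜ w ⊗ₜ 1).
Proof. by rewrite /cdifL; case: cid => d []. Qed.

#[local] Opaque cdifL.

Definition ce_dif n : {linear P n.+1 -> P n} :=
  lin (linearP (act \o tmap (tmap idfun (cdifL n)) idfun)).
Lemma ce_dif_pure n a w b : ce_dif n (a ⊗ₜ w ⊗ₜ b) = act (a ⊗ₜ cdifL n w ⊗ₜ b).
Proof. by rewrite linE /=; tsimp. Qed.
Lemma free_act_act n a b (p : P n) b' a' :
  act (a ⊗ₜ act (b ⊗ₜ p ⊗ₜ b') ⊗ₜ a') = act ((a * b) ⊗ₜ p ⊗ₜ (b' * a')).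
Proof. exact: free_actA. Qed.
Lemma ce_dif_hom n : act_hom (ce_dif n).
Proof.
move=> a m b; elim/free_ind: m => [x y hx hy|a' w b'].
  by rewrite !(tpureDr, tpureDl, linD) hx hy.
by rewrite free_act_pure 2!ce_dif_pure free_act_act.
Qed.

Lemma ce_dif0 u p : ce_dif 0 (cmul 0 u p) = theta u 0 p.
Proof.
elim/free_ind: p => [x y hx hy|a w b].
  by rewrite !linD /=; add_split hx hy.
rewrite cmul_pure ce_dif_pure cdifL0 -theta_hom free_act_pure.
by rewrite mulr1 mul1r.
Qed.

Lemma ce_difS n u p : ce_dif n.+1 (cmul n.+1 u p) =
  cmul n u (ce_dif n p) + (-1) ^+ n.+1 *: theta u n.+1 p.
Proof.
elim/free_ind: p => [x y hx hy|a w b].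
  by rewrite !linD /=; add_split hx hy.
rewrite cmul_pure 2!ce_dif_pure cdifLS !(tpureD, tpureZ) linD linZ.
rewrite /= -cmul_hom -theta_hom free_act_pure.
by rewrite mulr1 mul1r.
Qed.

Section ExtendDerivation.
Variables (δ : derivation A) (f : {linear V -> V}).
Hypothesis hδ : forall v, exists c, δ (inc v) = c%:A + inc (f v).

(** Compare the [V]-parts after applying [δ] to the commutator of [u] and [v]; constants are central
    and drop out. When [δ] is inner this is the Jacobi identity. *)
Lemma br_der u v : br (f u) v = f (br u v) - br u (f v).
Proof.
have [c1 h1] := ed_comm E u v; have [c2 h2] := ed_comm E (f u) v.
have [c3 h3] := ed_comm E u (f v).
have [a1 e1] := hδ u; have [a2 e2] := hδ v; have [a3 e3] := hδ (br u v).
apply/eqP; rewrite eq_sym subr_eq; apply/eqP.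
have /(congr1 δ) := h1; rewrite inner_der e1 e2 inner_scalar_l [inner _ (_ + _)]linD.
rewrite inner_scalar add0r h2 h3 linD [δ c1%:A]linZ der1 scaler0 add0r e3.
by rewrite addrACA -scalerDl -(linD inc) => /esym/ed_uniq.
Qed.

Lemma extD_br u n (w : Λ n) :
  extD f n (extD (br u) n w) = extD (br u) n (extD f n w) + extD (br (f u)) n w.
Proof.
by rewrite (extD_comm (br_der u)) addrC subrK.
Qed.

(* The extension of [δ] to [A ⊗ Λ ⊗ A] that acts on [V] through [f]. *)
Definition cder n : {linear P n -> P n} :=
  lin (linearP (tsum (tsum δ (extD f n)) δ)).
Lemma cder_pure n a (w : Λ n) b :
  cder n (a ⊗ₜ w ⊗ₜ b) = δ a ⊗ₜ w ⊗ₜ b + a ⊗ₜ extD f n w ⊗ₜ b + a ⊗ₜ w ⊗ₜ δ b.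
Proof. by rewrite linE !tsum_pure tpureDl. Qed.

#[local] Opaque cder.

Lemma cder_act n a (p : P n) b :
  cder n (act (a ⊗ₜ p ⊗ₜ b)) = act (δ a ⊗ₜ p ⊗ₜ b) +
    act (a ⊗ₜ cder n p ⊗ₜ b) + act (a ⊗ₜ p ⊗ₜ δ b).
Proof.
tind p as x b'; tind x as a' w.
rewrite 4?free_act_pure 2!cder_pure !tpureD !linD /= 3!free_act_pure !der_leibniz !tpureD.
rewrite -!addrA; congr (_ + _); do 2![congr (_ + _)].
Qed.

Lemma cder_cmul n u p :
  cder n.+1 (cmul n u p) = cmul n u (cder n p) + cmul n (f u) p.
Proof.
elim/free_ind: p => [x y hx hy|a w b].
  by rewrite !linD /=; add_split hx hy.
rewrite cmul_pure !cder_pure extD_rmul !linD !cmul_pure tpureDr tpureDl.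
by rewrite !addrA [LHS]addrAC.
Qed.

Lemma cder_theta n u p :
  cder n (theta u n p) = theta u n (cder n p) + theta (f u) n p.
Proof.
elim/free_ind: p => [x y hx hy|a w b].
  by rewrite !linD /=; add_split hx hy.
(* The constant [c] cancels between the two outer terms of [theta]. *)
have [c h] := hδ u.
rewrite theta_pure !linB !cder_pure !linD !theta_pure extD_br !der_leibniz h /=.
rewrite !mulrDr !mulrDl -scalerAr -scalerAl mulr1 mul1r.
rewrite !(tpureDl, tpureDr, tpureZl, tpureZr).
abelian.
Qed.

(** By induction on the last factor: commuting [cder] with [cmul u] or with [theta u] produces the
    same correction, namely [u] replaced by [f u]. *)
Lemma cder_dif n p : cder n (ce_dif n p) = ce_dif n (cder n.+1 p).
Proof.
elim: n p => [|n IH] p; elim/cmul_ind: p => [x y hx hy|u p].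
- by rewrite !linD hx hy.
- by rewrite cder_cmul linD !ce_dif0 cder_theta.
- by rewrite !linD hx hy.
- rewrite cder_cmul linD 3!ce_difS linD linZ cder_theta cder_cmul IH.
  by rewrite scalerDr addrACA.
Qed.
End ExtendDerivation.

Lemma inner_inc u v : exists c, inner (inc u) (inc v) = c%:A + inc (br u v).
Proof. exact: ed_comm. Qed.

(** On [a ⊗ w ⊗ b] the inner derivation turns [u a] into [a u] and [b u] into [u b]. Hence the
    formula with [D_u], whose single terms are not bimodule maps, defines one. *)
Lemma thetaE u n p : theta u n p =
  act (inc u ⊗ₜ p ⊗ₜ 1) - act (1 ⊗ₜ p ⊗ₜ inc u) - cder (inner (inc u)) (br u) n p.
Proof.
elim/free_ind: p => [x y hx hy|a w b].
  rewrite !(tpureDr, tpureDl, linD) hx hy /=; abelian.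
rewrite theta_pure !free_act_pure cder_pure !innerE !mul1r !mulr1 !tpureB.
abelian.
Qed.

Lemma theta_dif u n p : theta u n (ce_dif n p) = ce_dif n (theta u n.+1 p).
Proof.
rewrite !thetaE !linB (cder_dif (inner_inc u)).
by rewrite -!ce_dif_hom.
Qed.

(** On [p ∧ u] the terms [Θ_u d p] and [d Θ_u p] occur with opposite signs, and [theta_dif] equates
    them. *)
Lemma ce_dif_dif n p : ce_dif n (ce_dif n.+1 p) = 0.
Proof.
elim: n p => [|n IH] p; elim/cmul_ind: p => [x y hx hy|u p];
  try by rewrite !linD hx hy addr0.
  by rewrite ce_difS linD linZ ce_dif0 theta_dif expr1 scaleN1r subrr.
rewrite ce_difS linD linZ ce_difS IH lin0 add0r theta_dif -scalerDl.
by rewrite [in X in _ + X]exprS mulN1r subrr scale0r.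
Qed.

Fact cunit_ex : exists e : {linear Λ 0 -> A}, forall v, e (wedge v) = 1.
Proof. by apply: ext_lift_ex => [//|v []|v []]. Qed.
Definition cunit := sval (cid cunit_ex).
Lemma cunit_wedge v : cunit (wedge v) = 1. Proof. exact: (svalP (cid cunit_ex)). Qed.
Lemma cunitC w a : cunit w * a = a * cunit w.
Proof.
move: w; apply: (ext0_ind (e := fun=> (0 : V))) => c.
by rewrite linZ cunit_wedge -scalerAl -scalerAr mul1r mulr1.
Qed.

Definition ce_aug : {linear P 0 -> A} :=
  lin (linearP (@amul k A \o tmap (@amul k A \o tmap idfun cunit) idfun)).
Lemma ce_aug_pure a w b : ce_aug (a ⊗ₜ w ⊗ₜ b) = a * cunit w * b.
Proof. by rewrite linE /=; tsimp; rewrite !amul_pure. Qed.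

Lemma ce_aug_hom a p b : ce_aug (act (a ⊗ₜ p ⊗ₜ b)) = a * ce_aug p * b.
Proof.
elim/free_ind: p => [x y hx hy|a' w b'].
  by rewrite !(tpureD, linD) hx hy mulrDr mulrDl.
by rewrite free_act_pure !ce_aug_pure !mulrA.
Qed.

Lemma ce_aug_dif p : ce_aug (ce_dif 0 p) = 0.
Proof.
elim/cmul_ind: p => [x y hx hy|u p]; first by rewrite !linD hx hy addr0.
rewrite ce_dif0; elim/free_ind: p => [x y hx hy|a w b].
  by rewrite !linD hx hy addr0.
rewrite theta_pure !linB !ce_aug_pure extD0 lin0 mulr0 mul0r subr0.
by rewrite -!mulrA [cunit w * (_ * _)]mulrA cunitC !mulrA subrr.
Qed.

Lemma ce_aug_der (δ : derivation A) f p :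
  ce_aug (cder δ f 0 p) = δ (ce_aug p).
Proof.
elim/free_ind: p => [x y hx hy|a w b]; first by rewrite !linD hx hy.
rewrite cder_pure !linD !ce_aug_pure extD0 lin0 mulr0 mul0r addr0.
have -> : δ (a * cunit w * b) = δ a * cunit w * b + a * cunit w * δ b; last by [].
rewrite !der_leibniz; have -> : δ (cunit w) = 0; last by rewrite mulr0 addr0.
move: w; apply: (ext0_ind (e := fun=> (0 : V))) => c.
by rewrite [cunit _]linZ cunit_wedge linZ der1 scaler0.
Qed.

Definition ce : acomplex (fun n => free_bimodule A (extpow n V)) :=
  @AComplex k A (fun n => free_bimodule A (extpow n V))
    ce_dif ce_aug ce_dif_hom ce_aug_hom ce_dif_dif ce_aug_dif.

End Complex.
#[global] Opaque cmul theta cder ce_dif cdifL cunit ce_aug.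

#[global] Opaque sigmaB sigmaQ xmul.

(** * The action on the twisted product *)

Section TwistedAction.
Variables (k : fieldType) (A : algType k) (B : xalg k) (δ : derivation A).
Let X : B := xalg_X B.
Variables (P : nat -> bimodule A) (D : forall i, {linear P i -> P i}).
Hypothesis DP : forall i a p a',
  D i (bim_act (a ⊗ₜ p ⊗ₜ a')) = bim_act (δ a ⊗ₜ p ⊗ₜ a') +
    bim_act (a ⊗ₜ D i p ⊗ₜ a') + bim_act (a ⊗ₜ p ⊗ₜ δ a').
Variables (Q : nat -> bimodule B) (σQ : forall j, {linear Q j ⊗ A -> A ⊗ Q j}).
Let τ : {linear B ⊗ A -> A ⊗ B} := sigmaB B δ.
Hypothesis σQl : forall j q a,
  σQ j (bim_l _ X q ⊗ₜ a) = tsum δ (bim_l _ X) (σQ j (q ⊗ₜ a)).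
Hypothesis σQr : forall j q a,
  σQ j (bim_r _ X q ⊗ₜ a) = tsum δ (bim_r _ X) (σQ j (q ⊗ₜ a)).
Hypothesis σQd : forall j q a, σQ j (q ⊗ₜ δ a) = tmap δ idfun (σQ j (q ⊗ₜ a)).
Hypothesis σQ1 : forall j q, σQ j (q ⊗ₜ 1) = 1 ⊗ₜ q.
Hypothesis σQc : forall j, compatible_r τ (σQ j).
Let σP i : {linear B ⊗ P i -> P i ⊗ B} := sigmaB B (D i).

Variables i j : nat.
Notation Y := (P i ⊗ Q j).
(** The bimodule axioms are reduced to relations among four operators: multiplication by [a] and by
    [x] on the left, by [b] and by [a] on the right. [twact1] and [twact_X] express the twisted
    action through them. *)
Definition opla a : {linear Y -> Y} := tmap (bim_l (P i) a) idfun.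
Definition opX : {linear Y -> Y} := tsum (D i) (bim_l (Q j) X).
Definition oprb b : {linear Y -> Y} := tmap idfun (bim_r (Q j) b).
Lemma right_act_ex : exists r : {linear P i ⊗ A -> P i}, forall p a, r (p ⊗ₜ a) = bim_r _ a p.
Proof.
exists (@bim_act k A (P i) \o tmap (lin ((tpure_bilin A (P i)).2 1)) idfun) => p a.
by rewrite /= tmap_pure linE bim_rE.
Qed.
Let right_act := sval (cid right_act_ex).
Lemma right_actE p a : right_act (p ⊗ₜ a) = bim_r _ a p.
Proof. exact: (svalP (cid right_act_ex)). Qed.

(* [y ↦ y a], moving [a] past the second factor first. *)
Definition opra (a : A) : {linear Y -> Y} :=
  lin (linearP (tmap right_act idfun \o @tassoc k (P i) A (Q j) \o
    tmap idfun (σQ j \o lin ((tpure_bilin (Q j) A).1 a)))).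
Lemma opra_pure a p q : opra a (p ⊗ₜ q) =
  tmap right_act idfun (tassoc (p ⊗ₜ σQ j (q ⊗ₜ a))).
Proof. by rewrite linE /=; tsimp; rewrite linE. Qed.

Lemma opla_pure a p q : opla a (p ⊗ₜ q) = bim_l _ a p ⊗ₜ q.
Proof. by rewrite /opla /= tmap_pure. Qed.
Lemma oprb_pure b p q : oprb b (p ⊗ₜ q) = p ⊗ₜ bim_r _ b q.
Proof. by rewrite /oprb /= tmap_pure. Qed.
Lemma opX_pure p q : opX (p ⊗ₜ q) = D i p ⊗ₜ q + p ⊗ₜ bim_l _ X q.
Proof. by rewrite /opX tsum_pure. Qed.

#[local] Opaque opra opla oprb opX.

Lemma der_bim_r a p : D i (bim_r _ a p) = bim_r _ a (D i p) + bim_r _ (δ a) p.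
Proof.
rewrite !bim_rE DP der1 -bim_rE /=.
have -> : bim_act (0 ⊗ₜ p ⊗ₜ a) = 0 :> P i by rewrite !tpure0l lin0.
by rewrite add0r !bim_rE.
Qed.
Lemma der_bim_l a p : D i (bim_l _ a p) = bim_l _ a (D i p) + bim_l _ (δ a) p.
Proof.
rewrite !bim_lE DP der1.
have -> : bim_act (a ⊗ₜ p ⊗ₜ 0) = 0 :> P i by rewrite !tpure0r lin0.
by rewrite addr0 addrC.
Qed.

Lemma opX_la a y : opX (opla a y) = opla a (opX y) + opla (δ a) y.
Proof.
tind y as p q; rewrite 2!opla_pure 2!opX_pure linD 2!opla_pure der_bim_l tpureDl.
abelian.
Qed.
Lemma opla_M a a' y : opla (a * a') y = opla a (opla a' y).
Proof. by tind y as p q; rewrite !opla_pure bim_lM. Qed.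
Lemma oprb_M b b' y : oprb (b * b') y = oprb b' (oprb b y).
Proof. by tind y as p q; rewrite !oprb_pure bim_rM. Qed.
Lemma oprb_la a b y : oprb b (opla a y) = opla a (oprb b y).
Proof. by tind y as p q; rewrite !(oprb_pure, opla_pure). Qed.
Lemma oprb_X b y : oprb b (opX y) = opX (oprb b y).
Proof.
by tind y as p q; rewrite oprb_pure 2!opX_pure linD !oprb_pure bim_lrC.
Qed.
Lemma opra_la a a' y : opra a (opla a' y) = opla a' (opra a y).
Proof.
tind y as p q; rewrite opla_pure !opra_pure.
move: (σQ j _) => z; tind z as a1 q1; tsimp.
by rewrite !right_actE opla_pure bim_lrC.
Qed.
Lemma opra_X a y : opra a (opX y) = opX (opra a y).
Proof.
tind y as p q; rewrite opX_pure linD !opra_pure σQl.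
move: (σQ j _) => z; tind z as a1 q1; tsimp.
rewrite !right_actE ?opX_pure ?right_actE der_bim_r tpureDl; abelian.
Qed.
(* The relation [a x = x a - δ a], on the right. *)
Lemma opra_rb a y : opra a (oprb X y) = oprb X (opra a y) + opra (δ a) y.
Proof.
tind y as p q; rewrite oprb_pure !opra_pure σQr σQd.
move: (σQ j _) => z; tind z as a1 q1; tsimp.
rewrite !right_actE ?oprb_pure; abelian.
Qed.
Lemma opra_M a a' y : opra (a * a') y = opra a' (opra a y).
Proof.
tind y as p q; rewrite !opra_pure.
have := compr_mul (σQc j) (q ⊗ₜ (a ⊗ₜ a')).
rewrite tmap_pure /= amul_pure => ->; tsimp.
move: (σQ j _) => z; tind z as a1 q1; tsimp; rewrite opra_pure.
move: (σQ j _) => z; tind z as a2 q2; tsimp.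
by rewrite !right_actE amul_pure bim_rM.
Qed.
Lemma opra1 y : opra 1 y = y.
Proof.
by tind y as p q; rewrite opra_pure σQ1; tsimp; rewrite right_actE bim_r1.
Qed.
Lemma oprb1 y : oprb 1 y = y.
Proof. by tind y as p q; rewrite oprb_pure bim_r1. Qed.
Lemma opla1 y : opla 1 y = y.
Proof. by tind y as p q; rewrite opla_pure bim_l1. Qed.

Fact twisted_act_linear : linear (twisted_act τ σP σQ (i := i) (j := j)).
Proof.
exact: linearP (tmap (@bim_act k A (P i)) (@bim_act k B (Q j)) \o
  tmap idfun (@tassoc k B (Q j) B) \o
  @tassoc k (A ⊗ P i) A (B ⊗ (Q j ⊗ B)) \o
  tmap idfun (@tassocV k A B (Q j ⊗ B) \o tmap τ idfun \o tmid (σQ j)) \o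
  @tassocV k (A ⊗ P i) (B ⊗ Q j) (A ⊗ B) \o
  tmap (tmid (σP i)) idfun).
Qed.
Definition twact := lin twisted_act_linear.
Lemma twactE z : twact z = twisted_act τ σP σQ z. Proof. exact: linE. Qed.

(* The last stage of [twisted_act], once [b] has passed [p]. *)
Definition twact_end a q a' b' : {linear P i ⊗ B -> Y} := lin (linearP (
  tmap (@bim_act k A (P i)) (@bim_act k B (Q j)) \o tmap idfun (@tassoc k B (Q j) B) \o
  @tassoc k (A ⊗ P i) A (B ⊗ (Q j ⊗ B)) \o
  tmap idfun (@tassocV k A B (Q j ⊗ B) \o tmap τ idfun \o tmid (σQ j)) \o
  @tassocV k (A ⊗ P i) (B ⊗ Q j) (A ⊗ B) \o
  lin ((tpure_bilin _ _).1 (a' ⊗ₜ b')) \o @tassoc k A (P i) (B ⊗ Q j) \o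
  lin ((tpure_bilin _ _).2 a) \o @tassocV k (P i) B (Q j) \o
  lin ((tpure_bilin _ _).1 q))).
Lemma twact_pure a b p q a' b' :
  twact ((a ⊗ₜ b) ⊗ₜ (p ⊗ₜ q) ⊗ₜ (a' ⊗ₜ b')) = twact_end a q a' b' (σP i (b ⊗ₜ p)).
Proof.
by rewrite twactE /twisted_act /= tmap_pure /= tmid_pure /twact_end [RHS]linE /= !linE.
Qed.

Lemma twact_end_pure a p b q a' b' : twact_end a q a' b' (p ⊗ₜ b) =
  tmap bim_act bim_act (tmap idfun (@tassoc k B (Q j) B) (tassoc ((a ⊗ₜ p) ⊗ₜ
    (tassocV (tmap τ idfun (tassoc (b ⊗ₜ tassocV (σQ j (q ⊗ₜ a') ⊗ₜ b')))))))).
Proof. by rewrite /twact_end [LHS]linE /= !linE; tsimp; rewrite tmid_pure. Qed.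

#[local] Opaque twact_end.

Lemma twact_end_l a q a' b' z : twact_end a q a' b' z = opla a (twact_end 1 q a' b' z).
Proof.
tind z as p b.
rewrite !twact_end_pure; move: (σQ j _) => y; tind y as a1 q1; tsimp.
move: (τ _) => y; tind y as a2 b2; tsimp.
by rewrite opla_pure !bim_lrE bim_l1.
Qed.

Lemma twact1 a y a' b' :
  twact ((a ⊗ₜ 1) ⊗ₜ y ⊗ₜ (a' ⊗ₜ b')) = opla a (oprb b' (opra a' y)).
Proof.
tind y as p q; rewrite twact_pure /σP sigmaB1 twact_end_pure opra_pure.
move: (σQ j _) => y; tind y as a1 q1; tsimp; rewrite /τ sigmaB1; tsimp.
by rewrite !right_actE oprb_pure opla_pure !bim_lrE bim_l1.
Qed.

Lemma twact_X a b y a' b' : twact ((a ⊗ₜ (X * b)) ⊗ₜ y ⊗ₜ (a' ⊗ₜ b')) =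
  opla a (opX (twact ((1 ⊗ₜ b) ⊗ₜ y ⊗ₜ (a' ⊗ₜ b')))).
Proof.
tind y as p q; rewrite !twact_pure twact_end_l; congr (opla a _).
rewrite /σP sigmaB_X -/(σP i); move: (σP i _) => z; tind z as p1 b1.
rewrite tsum_pure linD !twact_end_pure.
move: (σQ j _) => y; tind y as a1 q1; tsimp.
rewrite xmulE /τ sigmaB_X -/τ.
move: (τ _) => y; tind y as a2 b2; tsimp.
rewrite !bim_lrE !bim_l1 ?opX_pure der_bim_r xmulE bim_lM tpureDl; abelian.
Qed.

Lemma twact_la a b y v : twact ((a ⊗ₜ b) ⊗ₜ y ⊗ₜ v) = opla a (twact ((1 ⊗ₜ b) ⊗ₜ y ⊗ₜ v)).
Proof.
tind y as p q; tind v as a' b'.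
by rewrite !twact_pure twact_end_l.
Qed.

Lemma twact_eX b y v : twact ((1 ⊗ₜ (X * b)) ⊗ₜ y ⊗ₜ v) = opX (twact ((1 ⊗ₜ b) ⊗ₜ y ⊗ₜ v)).
Proof. by tind v as a' b'; rewrite twact_X opla1. Qed.

#[local] Opaque twact.

Variables (T : algType k) (iA : {linear A -> T}) (eB : {linear B -> T}).
Variable ψ : {linear A ⊗ B -> T}.
Hypothesis iA1 : iA 1 = 1.
Hypothesis iAM : forall a a', iA (a * a') = iA a * iA a'.
Hypothesis eB1 : eB 1 = 1.
Hypothesis eBM : forall b b', eB (b * b') = eB b * eB b'.
Hypothesis rel : forall a, eB X * iA a = iA a * eB X + iA (δ a).
Hypothesis ψE : forall a b, ψ (a ⊗ₜ b) = iA a * eB b.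
Hypothesis ψ_bij : bijective ψ.

Let ψinv_ex : exists g : {linear T -> A ⊗ B}, cancel ψ g /\ cancel g ψ.
Proof. by have [g gK Kg] := ψ_bij; exists (lin (can_linear gK Kg)); split=> z; rewrite linE. Qed.
Definition ψinv := sval (cid ψinv_ex).
Lemma ψK : cancel ψ ψinv. Proof. exact: (svalP (cid ψinv_ex)).1. Qed.
Lemma ψinvK : cancel ψinv ψ. Proof. exact: (svalP (cid ψinv_ex)).2. Qed.

Lemma T_pure (Pr : T -> Prop) : (forall x y, Pr x -> Pr y -> Pr (x + y)) ->
  (forall a b, Pr (iA a * eB b)) -> forall s, Pr s.
Proof.
move=> hD h s; rewrite -(ψinvK s); move: (ψinv s); apply: tensor_ind.
  by move=> a b; rewrite ψE.
by move=> x y hx hy; rewrite linD; apply: hD.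
Qed.

Lemma T_ind_l (Pr : T -> Prop) : Pr 1 ->
  (forall c x y, Pr x -> Pr y -> Pr (c *: x + y)) ->
  (forall a s, Pr s -> Pr (iA a * s)) ->
  (forall s, Pr s -> Pr (eB X * s)) -> forall s, Pr s.
Proof.
move=> h1 hD hA hX; apply: T_pure => [x y hx hy|a b].
  by rewrite -[x]scale1r; apply: hD.
apply: hA; elim/xalg_ind: b => [|b IH|c b b' h h'].
- by rewrite eB1.
- by rewrite eBM; apply: hX.
- by rewrite linD linZ; apply: hD.
Qed.

Lemma T_ind_r (Pr : T -> Prop) : Pr 1 ->
  (forall c x y, Pr x -> Pr y -> Pr (c *: x + y)) ->
  (forall a s, Pr s -> Pr (s * iA a)) ->
  (forall s, Pr s -> Pr (s * eB X)) -> forall s, Pr s.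
Proof.
move=> h1 hD hA hX; apply: T_pure => [x y hx hy|a b].
  by rewrite -[x]scale1r; apply: hD.
elim/xalg_ind: b => [|b IH|c b b' h h'].
- by rewrite eB1 mulr1 -[iA a]mul1r; apply: hA.
- by rewrite xalg_comm eBM mulrA; apply: hX.
- by rewrite linD linZ mulrDr -scalerAr; apply: hD.
Qed.

(** The left factor is taken in [T] and the right one kept in [A ⊗ B], so that each side has its own
    induction. *)
Let mixed s v y := twact (ψinv s ⊗ₜ y ⊗ₜ v).
Lemma mixed_pure a b v y : mixed (iA a * eB b) v y = twact (a ⊗ₜ b ⊗ₜ y ⊗ₜ v).
Proof. by rewrite /mixed -ψE ψK. Qed.
Lemma mixed_la a s v y : mixed (iA a * s) v y = opla a (mixed s v y).
Proof.
elim/T_pure: s => [s s' h h'|a' b].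
  by rewrite mulrDr /mixed !(linD, tpureDl) -!/(mixed _ _ _) h h'.
by rewrite mulrA -iAM !mixed_pure twact_la opla_M -twact_la.
Qed.
Lemma mixed_X s v y : mixed (eB X * s) v y = opX (mixed s v y).
Proof.
elim/T_pure: s => [s s' h h'|a b].
  by rewrite mulrDr /mixed !(linD, tpureDl) -!/(mixed _ _ _) h h'.
rewrite mulrA rel mulrDl -mulrA -eBM.
have FD x x' : mixed (x + x') v y = mixed x v y + mixed x' v y.
  by rewrite /mixed !(linD, tpureDl).
by rewrite FD !mixed_pure twact_la [in X in _ + X]twact_la twact_eX -opX_la -twact_la.
Qed.
Lemma mixed1 v y : mixed 1 v y = twact (1 ⊗ₜ 1 ⊗ₜ y ⊗ₜ v).
Proof. by rewrite -[1 in LHS]mulr1 -{1}iA1 -eB1 mixed_pure. Qed.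

Let lact s y := mixed s (1 ⊗ₜ 1) y.
Let ract s y := mixed 1 (ψinv s) y.

Lemma lact1 y : lact 1 y = y.
Proof. by rewrite /lact mixed1 twact1 opla1 oprb1 opra1. Qed.
Lemma ractE a b y : ract (iA a * eB b) y = oprb b (opra a y).
Proof. by rewrite /ract -ψE ψK mixed1 twact1 opla1. Qed.
Lemma lactP c s s' y : lact (c *: s + s') y = c *: lact s y + lact s' y.
Proof. by rewrite /lact /mixed !(tpureDl, tpureZl, linD, linZ). Qed.
Lemma ractP c s s' y : ract (c *: s + s') y = c *: ract s y + ract s' y.
Proof. by rewrite /ract /mixed [ψinv (_ + _)]linD [ψinv (_ *: _)]linZ tpureDr tpureZr linD linZ. Qed.
Lemma ractD s s' y : ract (s + s') y = ract s y + ract s' y.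
Proof. by rewrite -[s]scale1r ractP !scale1r. Qed.
Lemma ractPr s c y y' : ract s (c *: y + y') = c *: ract s y + ract s y'.
Proof. by rewrite /ract /mixed tpureDr tpureZr tpureDl tpureZl linD linZ. Qed.

Lemma lactM s s' y : lact (s * s') y = lact s (lact s' y).
Proof.
elim/T_ind_l: s => [|c x x' h h'|a s h|s h].
- by rewrite mul1r lact1.
- by rewrite mulrDl -scalerAl !lactP h h'.
- by rewrite -mulrA /lact !mixed_la -!/(lact _ _) h.
- by rewrite -mulrA /lact !mixed_X -!/(lact _ _) h.
Qed.

Lemma ract_X s y : ract (s * eB X) y = oprb X (ract s y).
Proof.
elim/T_pure: s => [s s' h h'|a b].
  by rewrite mulrDl !ractD h h' linD.
by rewrite -mulrA -eBM !ractE oprb_M.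
Qed.
Lemma ract_A s a y : ract (s * iA a) y = opra a (ract s y).
Proof.
elim/T_pure: s a => [s s' h h'|a' b] a; first by rewrite mulrDl !ractD linD h h'.
elim/xalg_ind: b a => [|b IH|c b b' h h'] a.
- rewrite eB1 mulr1 -iAM -[iA (_ * _)]mulr1 -[iA a' in RHS]mulr1 -eB1 !ractE.
  by rewrite !oprb1 opra_M.
(* Here [b x a = b a x + b δ(a)]; because of [δ(a)] the induction is general in [a]. *)
- rewrite xalg_comm eBM mulrA -mulrA rel mulrDr ractD [_ * (iA a * _)]mulrA ract_X IH IH.
  by rewrite ract_X opra_rb.
- rewrite linD linZ mulrDr mulrDl -!scalerAr -!scalerAl !ractP h h'.
  by rewrite linD linZ.
Qed.
Lemma ract1 y : ract 1 y = y.
Proof. by rewrite -[1]mulr1 -{1}iA1 -eB1 ractE oprb1 opra1. Qed.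
Lemma ractM s s' y : ract (s * s') y = ract s' (ract s y).
Proof.
elim/T_ind_r: s' => [|c x x' h h'|a s' h|s' h].
- by rewrite mulr1 ract1.
- by rewrite mulrDr -scalerAr !ractP h h'.
- by rewrite mulrA !ract_A h.
- by rewrite mulrA !ract_X h.
Qed.
Lemma lact_ract s s' y : ract s' (lact s y) = lact s (ract s' y).
Proof.
elim/T_ind_l: s => [|c x x' h h'|a s h|s h].
- by rewrite !lact1.
- by rewrite !lactP ractPr h h'.
- rewrite /lact !mixed_la -!/(lact _ _) -h; elim/T_pure: s' {h} => [t t' e e'|a' b].
    by rewrite !ractD e e' linD.
  by rewrite !ractE opra_la oprb_la.
- rewrite /lact !mixed_X -!/(lact _ _) -h; elim/T_pure: s' {h} => [t t' e e'|a' b].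
    by rewrite !ractD e e' linD.
  by rewrite !ractE opra_X oprb_X.
Qed.
(** The two-sided action is a composite of one-sided ones; as these commute by [lact_ract],
    associativity can be proved on each side separately. *)
Lemma mixedE s s' y : mixed s (ψinv s') y = lact s (ract s' y).
Proof.
elim/T_ind_l: s => [|c x x' h h'|a s h|s h].
- by rewrite lact1.
- by rewrite lactP -h -h' /mixed !(tpureDl, tpureZl, linD, linZ).
- by rewrite mixed_la h /lact mixed_la.
- by rewrite mixed_X h /lact mixed_X.
Qed.

Lemma twact_assoc u u' y v' v :
  twact (u ⊗ₜ twact (u' ⊗ₜ y ⊗ₜ v') ⊗ₜ v) =
  twact (ψinv (ψ u * ψ u') ⊗ₜ y ⊗ₜ ψinv (ψ v' * ψ v)).
Proof.
transitivity (mixed (ψ u) (ψinv (ψ v)) (mixed (ψ u') (ψinv (ψ v')) y)).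
  by rewrite /mixed !ψK.
by rewrite -[RHS]/(mixed _ _ _) !mixedE lactM ractM lact_ract.
Qed.

Lemma twact_unit y : twact (ψinv 1 ⊗ₜ y ⊗ₜ ψinv 1) = y.
Proof. by rewrite -[LHS]/(mixed _ _ _) mixedE lact1 ract1. Qed.

End TwistedAction.

#[global] Opaque twact twact_end opla oprb opra opX ψinv.

(* A map that commutes with the four one-sided multiplications commutes with
   the whole twisted action. *)
Lemma twact_nat (k : fieldType) (A : algType k) (B : xalg k) (δ : derivation A)
  (P : nat -> bimodule A) (D : forall i, {linear P i -> P i})
  (DP : forall i a p a',
    D i (bim_act (a ⊗ₜ p ⊗ₜ a')) = bim_act (δ a ⊗ₜ p ⊗ₜ a') +
      bim_act (a ⊗ₜ D i p ⊗ₜ a') + bim_act (a ⊗ₜ p ⊗ₜ δ a'))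
  (Q : nat -> bimodule B) (σQ : forall j, {linear Q j ⊗ A -> A ⊗ Q j})
  (i j : nat) (Z : lmodType k) (h : {linear P i ⊗ Q j -> Z})
  (la : A -> Z -> Z) (lX : Z -> Z) (rab : A -> B -> Z -> Z) :
  (forall a y, h (opla P Q i j a y) = la a (h y)) ->
  (forall y, h (opX D Q i j y) = lX (h y)) ->
  (forall a b y, h (oprb P Q i j b (opra P σQ i j a y)) = rab a b (h y)) ->
  forall (H : (A ⊗ B) -> Z -> (A ⊗ B) -> Z),
  (forall u v z z', H (u + v) z z' = H u z z' + H v z z') ->
  (forall c u z z', H (c *: u) z z' = c *: H u z z') ->
  (forall u v z z', H z' z (u + v) = H z' z u + H z' z v) ->
  (forall a z a' b, H (a ⊗ₜ 1) z (a' ⊗ₜ b) = la a (rab a' b z)) ->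
  (forall b z v, H (1 ⊗ₜ (xalg_X B * b)) z v = lX (H (1 ⊗ₜ b) z v)) ->
  (forall a b z v, H (a ⊗ₜ b) z v = la a (H (1 ⊗ₜ b) z v)) ->
  forall u y v, h (twact δ D σQ i j (u ⊗ₜ y ⊗ₜ v)) = H u (h y) v.
Proof.
move=> hla hlX hr H HD HZ HDr H1 HX Ha u y v.
move: v; apply: tensor_ind => [a' b'|v v' e e']; last by rewrite tpureDr !linD e e' HDr.
move: u; apply: tensor_ind => [a b|u u' e e']; last by rewrite !tpureDl !linD e e' HD.
rewrite twact_la hla Ha; congr (la _ _); elim/xalg_ind: b => [|b IH|c b1 b2 h1 h2].
- by rewrite twact1 hla hr H1.
- by rewrite twact_eX // hlX IH HX.
- by rewrite !(tpureDr, tpureZr, tpureDl, tpureZl, linD, linZ) HD HZ h1 h2.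
Qed.

(** * Freeness of the terms of the twisted product *)

Section OreTheta.
Variables (k : fieldType) (A : algType k) (B : xalg k) (δ : derivation A).
Variables (V : lmodType k) (f : {linear V -> V}).
Let P n := free_bimodule A (extpow n V).
Let D n : {linear P n -> P n} := cder δ f n.
Variables (Q : nat -> bimodule B) (σQ : forall j, {linear Q j ⊗ A -> A ⊗ Q j}).
Variables (T : algType k) (ψ : {linear A ⊗ B -> T}).
Hypothesis ψ_bij : bijective ψ.
Variables (i j : nat) (g : Q j).
Hypothesis σQg : forall a, σQ j (g ⊗ₜ a) = a ⊗ₜ g.
Notation W := (extpow i V).

Fact cins_linear : linear (fun w : W => (1 : A) ⊗ₜ w ⊗ₜ (1 : A)).
Proof. by move=> c w w'; rewrite tpureDr tpureZr tpureDl tpureZl. Qed.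
Definition cins : {linear W -> P i} := lin cins_linear.
Lemma cinsE w : cins w = 1 ⊗ₜ w ⊗ₜ 1. Proof. exact: linE. Qed.
Lemma cinsD w : cins (extD f i w) = D i (cins w).
Proof. by rewrite !cinsE /D cder_pure der1 !tpure0 addr0 add0r. Qed.

(** Bijectivity of this map means that [Q j] is free on [g]. *)
Definition genq : {linear B ⊗ B -> Q j} :=
  @bim_act k B (Q j) \o tmap (lin ((tpure_bilin B (Q j)).1 g)) idfun.
Lemma genq_pure b b' : genq (b ⊗ₜ b') = bim_act (b ⊗ₜ g ⊗ₜ b').
Proof. by rewrite /genq /= tmap_pure linE. Qed.
Hypothesis genq_bij : bijective genq.

(** The [T]-bimodule map that sends the generator [w] to [(1 ⊗ w ⊗ 1) ⊗ g]. *)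
Definition theta_g : {linear T ⊗ W ⊗ T -> P i ⊗ Q j} :=
  twact δ D σQ i j \o
  tmap (tmap (ψinv ψ_bij) (lin ((tpure_bilin (P i) (Q j)).1 g) \o cins)) (ψinv ψ_bij).
Lemma theta_g_pure s w s' : theta_g (s ⊗ₜ w ⊗ₜ s') =
  twact δ D σQ i j (ψinv ψ_bij s ⊗ₜ (cins w ⊗ₜ g) ⊗ₜ ψinv ψ_bij s').
Proof. by rewrite /theta_g /= tmap_pure /= tmap_pure /= linE. Qed.
Opaque theta_g cins genq.

(** The five factors [a], [b], [w], [a'], [b'], bracketed so that [b] can pass [w ⊗ a']. *)
Let Z := A ⊗ (B ⊗ (W ⊗ A)) ⊗ B.
Let alpha : {linear Z -> T ⊗ W ⊗ T} :=
  tmap (tmap ψ idfun) ψ \o @tassocV k (A ⊗ B ⊗ W) A B \o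
  tmap (tmap (@tassoc k A B W) idfun \o @tassoc k A (B ⊗ W) A \o
        tmap idfun (@tassoc k B W A)) idfun.
Let alpha_pure a b w a' b' : alpha (a ⊗ₜ (b ⊗ₜ (w ⊗ₜ a')) ⊗ₜ b') =
  ψ (a ⊗ₜ b) ⊗ₜ w ⊗ₜ ψ (a' ⊗ₜ b').
Proof. by rewrite /alpha /=; tsimp. Qed.
Let alpha_bij : bijective alpha.
Proof.
apply: bij_comp; last first.
  apply: tmap_bij; last exact: (Bijective (g := idfun)).
  apply: bij_comp; last by apply: tmap_bij; [exact: (Bijective (g := idfun))|exact: tassoc_bij].
  apply: bij_comp; last exact: tassoc_bij.
  by apply: tmap_bij; [exact: tassoc_bij|exact: (Bijective (g := idfun))].
apply: bij_comp; last exact: tassocV_bij.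
by do ![apply: tmap_bij => //]; exact: (Bijective (g := idfun)).
Qed.
Let beta : {linear Z -> A ⊗ ((W ⊗ A) ⊗ B) ⊗ B} :=
  tmap (tmap idfun (sigmaB B (tsum (extD f i) δ))) idfun.
Let beta_bij : bijective beta.
Proof.
do ![apply: tmap_bij; try exact: (Bijective (g := idfun))].
exact: sigmaB_bij.
Qed.
Let gamma : {linear A ⊗ ((W ⊗ A) ⊗ B) ⊗ B -> A ⊗ W ⊗ A ⊗ Q j} :=
  tmap (@tassoc k A W A) genq \o @tassocV k (A ⊗ (W ⊗ A)) B B \o
  tmap (@tassoc k A (W ⊗ A) B) idfun.
Let gamma_pure a w a' b b' : gamma (a ⊗ₜ ((w ⊗ₜ a') ⊗ₜ b) ⊗ₜ b') =
  (a ⊗ₜ w ⊗ₜ a') ⊗ₜ genq (b ⊗ₜ b').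
Proof. by rewrite /gamma /=; tsimp. Qed.
Let gamma_bij : bijective gamma.
Proof.
apply: bij_comp.
  by apply: bij_comp; [apply: tmap_bij => //; exact: tassoc_bij|exact: tassocV_bij].
by apply: tmap_bij; [exact: tassoc_bij|exact: (Bijective (g := idfun))].
Qed.

Let theta_alpha z : theta_g (alpha z) = gamma (beta z).
Proof.
tind z as y b'; tind y as a y; tind y as b y; tind y as w a'.
rewrite alpha_pure theta_g_pure !ψK twact_pure -(tmap_pure idfun cins).
rewrite [in LHS](sigmaB_nat cinsD).
have -> : beta (a ⊗ₜ (b ⊗ₜ (w ⊗ₜ a')) ⊗ₜ b') =
    a ⊗ₜ sigmaB B (tsum (extD f i) δ) (b ⊗ₜ (w ⊗ₜ a')) ⊗ₜ b'.
  by rewrite /beta /= tmap_pure /= tmap_pure.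
rewrite sigmaB_tensor; move: (sigmaB B _ _) => y; tind y as w1 b1; tsimp.
rewrite twact_end_pure σQg; tsimp; move: (sigmaB B _ _) => y; tind y as a2 b2; tsimp.
rewrite ?gamma_pure genq_pure; congr (_ ⊗ₜ _).
by rewrite cinsE; apply: etrans (free_act_pure _ _ _ _ _) _; rewrite mulr1 mul1r.
Qed.

(** Up to rebracketing and the identifications [ψ] and [genq], the map is the [σ] that moves [b]
    past [w ⊗ a'], with [a] and [b'] as spectators; [sigmaB_bij] applies. *)
Lemma theta_g_bij : bijective theta_g.
Proof.
have [a aK Ka] := alpha_bij.
have h : theta_g =1 (gamma \o beta) \o a.
  by move=> z; rewrite -[z in LHS]Ka; apply: theta_alpha.
apply: (eq_bij _ (fsym h)); apply: bij_comp; last by exists alpha.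
by apply: bij_comp; [exact: gamma_bij | exact: beta_bij].
Qed.
End OreTheta.

#[global] Opaque theta_g cins genq.

(** * The exterior powers of [V ⊕ k x] *)

Section ExteriorSplit.
Variables (k : fieldType) (V VS : lmodType k).
Variables (ι : {linear V -> VS}) (x : VS) (π : {linear VS -> V}) (ξ : VS -> k).
Hypothesis ξP : forall c u u', ξ (c *: u + u') = c * ξ u + ξ u'.
Hypothesis πι : forall v, π (ι v) = v.
Hypothesis πx : π x = 0.
Hypothesis ξι : forall v, ξ (ι v) = 0.
Hypothesis ξx : ξ x = 1.
Hypothesis split_x : forall u, u = ι (π u) + ξ u *: x.
Notation ΛS n := (extpow n VS).
Notation Λ n := (extpow n V).

(** The sign is that of [c ∧ x ∧ u = - c ∧ u ∧ x], by which [x] is kept in the last place. *)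
Fact contr_ex : exists c : forall n, {linear ΛS n.+1 -> Λ n},
  (forall u w, c 0%N (rmul 0 u w) = ξ u *: extmap π 0 w) /\
  forall n u w, c n.+1 (rmul n.+1 u w) =
    ξ u *: extmap π n.+1 w - rmul n (π u) (c n w).
Proof.
have tb n : bilin (fun u (w : ΛS n) => ξ u *: extmap π n w).
  split=> [w c u u'|u c w w']; first by rewrite ξP scalerDl scalerA.
  by rewrite linP scalerDr !scalerA mulrC.
have [c0 c0E] := rlift_ex (tb 0%N) I.
pose h n (c : {linear ΛS n.+1 -> Λ n}) u w :=
  ξ u *: extmap π n.+1 w - rmul n (π u) (c w).
have [||c [hc0 hcS]] := @rec_family (fun n => {linear ΛS n.+1 -> Λ n}) c0
  (fun n c => ralt (h n c)) (fun n c c' => forall u w, c' (rmul n.+1 u w) = h n c u w).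
- by move=> u w; rewrite /h c0E extmap_rmul linZ subrr.
- move=> n c gc; have [|c' cE] := @rlift_ex _ _ n.+1 _ (h n c) _ gc.
    split=> [w a u u'|u a w w']; rewrite /h.
      by rewrite (tb _).1 linP rmulP scalerBr; abelian.
    by rewrite (tb _).2 (linP c) (linP (rmul _ _)) scalerBr; abelian.
  exists c'; split=> // u w.
  by rewrite /h cE /h extmap_rmul linB linZ rmul_rmul subr0 subrr.
- by exists c; split=> [u w|n u w]; [rewrite hc0 c0E | rewrite hcS].
Qed.
(* The coefficient of [x] in the exterior algebra, [x] being put last. *)
Definition contr := sval (cid contr_ex).
Lemma contr0 u w : contr 0 (rmul 0 u w) = ξ u *: extmap π 0 w.
Proof. by rewrite /contr; case: cid => c []. Qed.
Lemma contrS n u w : contr n.+1 (rmul n.+1 u w) =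
    ξ u *: extmap π n.+1 w - rmul n (π u) (contr n w).
Proof. by rewrite /contr; case: cid => c []. Qed.

#[local] Opaque contr.

Lemma extmap_πι n w : extmap π n (extmap ι n w) = w.
Proof.
elim/ext_wedge_ind: w => [|c a b h1 h2|v]; first by rewrite !lin0.
  by rewrite !linP h1 h2.
by rewrite !extmap_wedge; apply: eq_wedge => i /=.
Qed.
Lemma contr_ι n w : contr n (extmap ι n.+1 w) = 0.
Proof.
elim: n w => [|n IH] w; elim/ext_ind: w => [a b h1 h2|u w];
  do ?by rewrite !linD h1 h2 addr0.
- by rewrite extmap_rmul contr0 ξι scale0r.
- by rewrite extmap_rmul contrS ξι scale0r IH lin0 subr0.
Qed.
Lemma extmap_πx n w : extmap π n.+1 (rmul n x w) = 0.
Proof. by rewrite extmap_rmul πx rmul0. Qed.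
Lemma contr_x n w : contr n (rmul n x w) = extmap π n w.
Proof.
case: n w => [|n] w; first by rewrite contr0 ξx scale1r.
by rewrite contrS ξx scale1r πx rmul0 subr0.
Qed.

Lemma ext_split0 (w : ΛS 0) : w = extmap ι 0 (extmap π 0 w).
Proof.
move: w; apply: (ext0_ind (e := fun=> (0 : VS))) => c.
by rewrite !linZ !extmap_wedge; congr (_ *: _); apply: eq_wedge => -[].
Qed.
Lemma ext_split n (w : ΛS n.+1) :
  w = extmap ι n.+1 (extmap π n.+1 w) + rmul n x (extmap ι n (contr n w)).
Proof.
elim: n w => [|n IH] w; elim/ext_ind: w => [a b h1 h2|u w].
- by rewrite !linD {1}h1 {1}h2; abelian.
- rewrite {1}(split_x u) rmulD rmulZ !extmap_rmul contr0 (linZ (extmap ι 0)).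
  by rewrite (linZ (rmul _ _)) -ext_split0.
- by rewrite !linD {1}h1 {1}h2; abelian.
- rewrite {1}(split_x u) rmulD rmulZ !extmap_rmul contrS linB linZ linB linZ.
  rewrite {1 2}[w]IH !linD extmap_rmul rmul_rmul [rmul n.+1 (ι _) (rmul n x _)]rmulC.
  by rewrite /= scaler0; abelian.
Qed.
End ExteriorSplit.
#[global] Opaque contr.

(* [cast_ext m n] is the identity if [m = n] (and a junk value otherwise). *)
Definition cast_ext (k : fieldType) (V : lmodType k) m n :
    {linear extpow m V -> extpow n V} :=
  match @eqP nat m n with
  | ReflectT e => eq_rect m (fun n => {linear extpow m V -> extpow n V}) idfun n e
  | _ => \0
  end.
Lemma cast_ext_id (k : fieldType) (V : lmodType k) n w : cast_ext V n n w = w.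
Proof. by rewrite /cast_ext; case: eqP => // e; rewrite (eq_axiomK e). Qed.
#[global] Opaque cast_ext.

(** * The twisted product complex of an Ore extension *)

Section FreeExt.
Variables (k : fieldType) (A : algType k) (W : lmodType k).
Definition free_ext (M : bimodule A) (h : {linear W -> M}) : {linear A ⊗ W ⊗ A -> M} :=
  lin (linearP (@bim_act k A M \o tmap (tmap idfun h) idfun)).
Lemma free_ext_pure (M : bimodule A) (h : {linear W -> M}) a w b :
  free_ext h (a ⊗ₜ w ⊗ₜ b) = bim_act (a ⊗ₜ h w ⊗ₜ b).
Proof. by rewrite linE /=; tsimp. Qed.
Lemma free_ext_hom (M : bimodule A) (h : {linear W -> M}) :
  @bim_hom k A (free_bimodule A W) M (free_ext h).
Proof.
move=> a m b; elim/tensor_ind: m => [m b'|x y hx hy]; last first.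
  by rewrite !(tpureDr, tpureDl, linD) hx hy.
elim/tensor_ind: m => [a' w|x y hx hy]; last first.
  by rewrite !(tpureDr, tpureDl, linD) hx hy.
rewrite (free_ext_pure h a' w b') bim_actA -free_ext_pure.
by congr (free_ext h _); apply: free_act_pure.
Qed.
End FreeExt.
#[global] Opaque free_ext.

Lemma tmap_twact (k : fieldType) (A : algType k) (B : xalg k) (δ : derivation A)
  (P : nat -> bimodule A) (D : forall i, {linear P i -> P i})
  (DP : forall i a p a',
    D i (bim_act (a ⊗ₜ p ⊗ₜ a')) = bim_act (δ a ⊗ₜ p ⊗ₜ a') +
      bim_act (a ⊗ₜ D i p ⊗ₜ a') + bim_act (a ⊗ₜ p ⊗ₜ δ a'))
  (Q : nat -> bimodule B) (σQ : forall j, {linear Q j ⊗ A -> A ⊗ Q j})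
  i i' j j' (d : {linear P i -> P i'}) (e : {linear Q j -> Q j'}) u y v :
  bim_hom d -> bim_hom e -> (forall p, d (D i p) = D i' (d p)) ->
  (forall q a, σQ j' (e q ⊗ₜ a) = tmap idfun e (σQ j (q ⊗ₜ a))) ->
  tmap d e (twact δ D σQ i j (u ⊗ₜ y ⊗ₜ v)) = twact δ D σQ i' j' (u ⊗ₜ tmap d e y ⊗ₜ v).
Proof.
move=> dh eh dD eσ.
pose H (u : A ⊗ B) z v : P i' ⊗ Q j' := twact δ D σQ i' j' (u ⊗ₜ z ⊗ₜ v).
have dl a p : d (bim_l _ a p) = bim_l _ a (d p) by rewrite !bim_lE dh.
have dr a p : d (bim_r _ a p) = bim_r _ a (d p) by rewrite !bim_rE dh.
have el a p : e (bim_l _ a p) = bim_l _ a (e p) by rewrite !bim_lE eh.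
have er a p : e (bim_r _ a p) = bim_r _ a (e p) by rewrite !bim_rE eh.
apply: (twact_nat DP (h := tmap d e) (la := fun a => opla P Q i' j' a)
  (lX := opX D Q i' j')
  (rab := fun a b z => oprb P Q i' j' b (opra P σQ i' j' a z)) _ _ _ (H := H)).
- by move=> a z; tind z as p q; rewrite /= opla_pure 2!tmap_pure opla_pure dl.
- move=> z; tind z as p q; rewrite opX_pure linD /= 3!tmap_pure opX_pure.
  by rewrite dD el.
- move=> a b z; tind z as p q; rewrite /= tmap_pure !opra_pure eσ.
  move: (σQ j _) => z; tind z as a1 q1; tsimp.
  by rewrite !right_actE !oprb_pure tmap_pure /= dr er.
- by move=> u1 u2 z z'; rewrite /H !(tpureDl, linD).
- by move=> c u1 z z'; rewrite /H !(tpureZl, linZ).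
- by move=> u1 u2 z z'; rewrite /H tpureDr linD.
- by move=> a z a' b; rewrite /H twact1.
- by move=> b z v'; rewrite /H; apply: (twact_eX DP).
- by move=> a b z v'; rewrite /H; apply: twact_la.
Qed.

Section TwistedAugmentation.
Variables (k : fieldType) (A : algType k) (B : xalg k) (δ : derivation A).
Let X : B := xalg_X B.
Let τ : {linear B ⊗ A -> A ⊗ B} := sigmaB B δ.
Variables (T : algType k) (iA : {linear A -> T}) (eB : {linear B -> T}).
Variable ψ : {linear A ⊗ B -> T}.
Hypothesis iA1 : iA 1 = 1.
Hypothesis iAM : forall a a', iA (a * a') = iA a * iA a'.
Hypothesis eB1 : eB 1 = 1.
Hypothesis eBM : forall b b', eB (b * b') = eB b * eB b'.
Hypothesis rel : forall a, eB X * iA a = iA a * eB X + iA (δ a).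
Hypothesis ψE : forall a b, ψ (a ⊗ₜ b) = iA a * eB b.

Lemma ψ_tsum y : ψ (tsum δ (xmul B) y) = eB X * ψ y.
Proof.
tind y as a b; last by rewrite mulrDr => *; congr (_ + _).
by rewrite tsum_pure linD !ψE xmulE eBM !mulrA rel mulrDl addrC.
Qed.
(** The map [τ] writes the product [b a] of [T] in normal form, with [A] on the left. *)
Lemma ψ_τ b a : ψ (τ (b ⊗ₜ a)) = eB b * iA a.
Proof.
elim/xalg_ind: b => [|b IH|c b b' h h'].
- by rewrite /τ sigmaB1 ψE eB1 mulr1 mul1r.
- by rewrite /τ sigmaB_X ψ_tsum -/τ IH eBM mulrA.
- by rewrite tpureDl tpureZl [τ _]linP [ψ _]linP [eB _]linP h h' mulrDl scalerAl.
Qed.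

Lemma twisted_mulψ u v : ψ (twisted_mul τ (u ⊗ₜ v)) = ψ u * ψ v.
Proof.
rewrite /twisted_mul; tind u as a b; last by rewrite mulrDl => *; congr (_ + _).
tind v as a' b'; last by rewrite mulrDr => *; congr (_ + _).
rewrite /= tmid_pure !ψE -mulrA [eB b * _]mulrA -ψ_τ.
move: (τ _) => z; tind z as a1 b1; last by rewrite mulrDl mulrDr => *; congr (_ + _).
by tsimp; rewrite !amul_pure !ψE iAM eBM !mulrA.
Qed.

Variables (P : nat -> bimodule A) (D : forall i, {linear P i -> P i}).
Hypothesis DP : forall i a p a',
    D i (bim_act (a ⊗ₜ p ⊗ₜ a')) = bim_act (δ a ⊗ₜ p ⊗ₜ a') +
      bim_act (a ⊗ₜ D i p ⊗ₜ a') + bim_act (a ⊗ₜ p ⊗ₜ δ a').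
Variables (Q : nat -> bimodule B) (σQ : forall j, {linear Q j ⊗ A -> A ⊗ Q j}).
Variables (KP : acomplex P) (KQ : acomplex Q).
Hypothesis aug_D : forall p, caug KP (D 0%N p) = δ (caug KP p).
Hypothesis σQ_aug : forall z,
  τ (tmap (caug KQ) idfun z) = tmap idfun (caug KQ) (σQ 0%N z).

Lemma aug_twact u y v : ψ (tmap (caug KP) (caug KQ) (twact δ D σQ 0 0 (u ⊗ₜ y ⊗ₜ v))) =
  ψ u * ψ (tmap (caug KP) (caug KQ) y) * ψ v.
Proof.
have dl a p : caug KP (bim_l _ a p) = a * caug KP p.
  by rewrite bim_lE caug_hom mulr1.
have dr a p : caug KP (bim_r _ a p) = caug KP p * a.
  by rewrite bim_rE caug_hom mul1r.
have el a p : caug KQ (bim_l _ a p) = a * caug KQ p.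
  by rewrite bim_lE caug_hom mulr1.
have er a p : caug KQ (bim_r _ a p) = caug KQ p * a.
  by rewrite bim_rE caug_hom mul1r.
apply: (twact_nat DP (h := ψ \o tmap (caug KP) (caug KQ)) (la := fun a z => iA a * z)
  (lX := fun z => eB X * z) (rab := fun a b z => z * iA a * eB b) _ _ _
  (H := fun u z v => ψ u * z * ψ v)).
- move=> a z; tind z as p q; last by rewrite mulrDr => *; congr (_ + _).
  by rewrite /= opla_pure 2!tmap_pure dl 2!ψE iAM mulrA.
- move=> z; tind z as p q; last by rewrite mulrDr => *; congr (_ + _).
  rewrite opX_pure /= linD /= 3!tmap_pure linD !ψE aug_D el eBM !mulrA rel.
  by rewrite mulrDl addrC.
- move=> a b z; tind z as p q; last by rewrite !mulrDl => *; congr (_ + _).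
  rewrite /= tmap_pure opra_pure ψE -[_ * _ * iA a]mulrA -ψ_τ.
  rewrite -[caug KQ q ⊗ₜ a](tmap_pure (caug KQ) idfun) σQ_aug.
  move: (σQ 0%N _) => z; tind z as a1 q1; last first.
    by rewrite mulrDr !mulrDl => *; congr (_ + _).
  tsimp; rewrite !right_actE !oprb_pure tmap_pure /= dr er !ψE iAM eBM.
  by rewrite !mulrA.
- by move=> u1 u2 z z'; rewrite linD !mulrDl.
- by move=> c u1 z z'; rewrite linZ !scalerAl.
- by move=> u1 u2 z z'; rewrite linD mulrDr.
- by move=> a z a' b; rewrite 2!ψE eB1 !mulr1 !mulrA.
- by move=> b z v'; rewrite 2!ψE iA1 !mul1r eBM !mulrA.
- by move=> a b z v'; rewrite 2!ψE iA1 mul1r !mulrA.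
Qed.
End TwistedAugmentation.

Section OreStep.
Variables (k : fieldType) (A : algType k) (V : lmodType k) (E : env_data A V).
Variables (δ : derivation A) (f : {linear V -> V}).
Hypothesis hδ : forall v, exists c, δ (E v) = c%:A + E (f v).
Variable B : xalg k.
Let X : B := xalg_X B.
Variables (Q : nat -> bimodule B) (KQ : acomplex Q).
Variable σQ : forall j, {linear Q j ⊗ A -> A ⊗ Q j}.
Let τ : {linear B ⊗ A -> A ⊗ B} := sigmaB B δ.
Hypothesis σQl : forall j q a,
  σQ j (bim_l _ X q ⊗ₜ a) = tsum δ (bim_l _ X) (σQ j (q ⊗ₜ a)).
Hypothesis σQr : forall j q a,
  σQ j (bim_r _ X q ⊗ₜ a) = tsum δ (bim_r _ X) (σQ j (q ⊗ₜ a)).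
Hypothesis σQd : forall j q a, σQ j (q ⊗ₜ δ a) = tmap δ idfun (σQ j (q ⊗ₜ a)).
Hypothesis σQ1 : forall j q, σQ j (q ⊗ₜ 1) = 1 ⊗ₜ q.
Hypothesis σQc : forall j, compatible_r τ (σQ j).
Hypothesis σQ_dif : forall j z,
    σQ j (tmap (cdif KQ j) idfun z) = tmap idfun (cdif KQ j) (σQ j.+1 z).
Hypothesis σQ_aug : forall z, τ (tmap (caug KQ) idfun z) = tmap idfun (caug KQ) (σQ 0%N z).
Variable g : forall j, Q j.
Hypothesis σQg : forall j a, σQ j (g j ⊗ₜ a) = a ⊗ₜ g j.
Hypothesis genq0_bij : bijective (genq (g 0%N)).
Hypothesis genq1_bij : bijective (genq (g 1%N)).
Hypothesis Qz : forall j (q : Q j.+2), q = 0.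
Hypothesis dg : cdif KQ 0 (g 1%N) = bim_l _ X (g 0%N) - bim_r _ X (g 0%N).
Hypothesis augg : caug KQ (g 0%N) = 1.

Variables (T : algType k) (iA : {linear A -> T}) (eB : {linear B -> T}).
Variable ψ : {linear A ⊗ B -> T}.
Hypothesis iA1 : iA 1 = 1.
Hypothesis iAM : forall a a', iA (a * a') = iA a * iA a'.
Hypothesis eB1 : eB 1 = 1.
Hypothesis eBM : forall b b', eB (b * b') = eB b * eB b'.
Hypothesis rel : forall a, eB X * iA a = iA a * eB X + iA (δ a).
Hypothesis ψE : forall a b, ψ (a ⊗ₜ b) = iA a * eB b.
Hypothesis ψ_bij : bijective ψ.

Variables (VS : lmodType k) (ES : env_data T VS).
Variables (ι : {linear V -> VS}) (x : VS) (π : {linear VS -> V}) (ξ : VS -> k).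
Hypothesis ξP : forall c u u', ξ (c *: u + u') = c * ξ u + ξ u'.
Hypothesis πι : forall v, π (ι v) = v.
Hypothesis πx : π x = 0.
Hypothesis ξι : forall v, ξ (ι v) = 0.
Hypothesis ξx : ξ x = 1.
Hypothesis split_x : forall u, u = ι (π u) + ξ u *: x.
Hypothesis ESι : forall v, ES (ι v) = iA (E v).
Hypothesis ESx : ES x = eB X.

Let P n := free_bimodule A (extpow n V).
Let D n : {linear P n -> P n} := cder δ f n.
Let DP i a p a' : D i (bim_act (a ⊗ₜ p ⊗ₜ a')) = bim_act (δ a ⊗ₜ p ⊗ₜ a') +
      bim_act (a ⊗ₜ D i p ⊗ₜ a') + bim_act (a ⊗ₜ p ⊗ₜ δ a').
Proof. exact: cder_act. Qed.
Let XS n := free_bimodule T (extpow n VS).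
Notation tot n := (Defs.total P Q n).
Notation ψi := (ψinv ψ_bij).
Notation twact i j := (twact δ D σQ i j).
Let KP := ce E.

Definition tproj n i j (e : (i + j)%N = n) : {linear tot n -> P i ⊗ Q j} :=
  lin (f := fun y : tot n => total_at y e) (fun c y y' => erefl).

Definition tact n (z : T ⊗ tot n ⊗ T) : tot n :=
  Total (fun i j e => twact i j (tmap (tmap ψi (tproj e)) ψi z)).
Fact tact_linear n : linear (@tact n).
Proof. by move=> c y y'; apply: total_ext => i j e; rewrite /= !linP. Qed.
Definition tactl n := lin (@tact_linear n).
Lemma tact_at n s (y : tot n) s' i j (e : (i + j)%N = n) :
  total_at (tactl n (s ⊗ₜ y ⊗ₜ s')) e = twact i j (ψi s ⊗ₜ total_at y e ⊗ₜ ψi s').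
Proof. by rewrite linE /= tmap_pure /= tmap_pure [tproj e y]linE. Qed.

Fact tact1 n (y : tot n) : tactl n (1 ⊗ₜ y ⊗ₜ 1) = y.
Proof.
apply: total_ext => i j e; rewrite tact_at.
exact: (twact_unit DP σQ1 iA1 iAM eB1 eBM rel ψE).
Qed.
Fact tactA n a b (y : tot n) b' a' :
  tactl n (a ⊗ₜ tactl n (b ⊗ₜ y ⊗ₜ b') ⊗ₜ a') = tactl n ((a * b) ⊗ₜ y ⊗ₜ (b' * a')).
Proof.
apply: total_ext => i j e; rewrite !tact_at.
rewrite (twact_assoc DP σQl σQr σQd σQ1 σQc iA1 iAM eB1 eBM rel ψE ψ_bij).
by rewrite !ψinvK.
Qed.
Definition total_bimodule n : bimodule T := @Bimodule k T (tot n) (tactl n) (@tact1 n) (@tactA n).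

Lemma tactE n u (y : tot n) v :
  @bim_act k T (total_bimodule n) (ψ u ⊗ₜ y ⊗ₜ ψ v) = total_act τ (fun i => sigmaB B (D i)) σQ u y v.
Proof.
by apply: total_ext => i j e; rewrite [LHS]tact_at !ψK twactE.
Qed.

(** All columns except [0] and [1] vanish by [Qz]. *)
Lemma tot_ext n (y y' : tot n) :
  (forall e : (n + 0)%N = n, total_at y e = total_at y' e) ->
  (forall i (e : (i + 1)%N = n), total_at y e = total_at y' e) -> y = y'.
Proof.
move=> h0 h1; apply: total_ext => i [|[|j]] e; [|exact: h1|].
  have ei : i = n by rewrite -e addn0.
  by case: n / ei y y' h0 h1 e => y y' h0 h1 e; apply: h0.
have z0 (z : P i ⊗ Q j.+2) : z = 0.
  by elim/tensor_ind: z => [p q|z z' -> ->]; rewrite ?addr0 // [q]Qz tpure0r.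
by rewrite [LHS]z0 [RHS]z0.
Qed.

(** Column [0] receives the part of a wedge without [x], column [1] the coefficient of [x]. The
    definition does not see the equation [i + j = n], hence [cast_ext]; only components with this
    equation occur in [cmap]. *)
Definition ccomp n i j : {linear extpow n VS -> P i ⊗ Q j} :=
  match j return {linear extpow n VS -> P i ⊗ Q j} with
  | 0 => lin ((tpure_bilin (P i) (Q 0)).1 (g 0%N)) \o cins A V i \o extmap π i \o
         cast_ext VS n i
  | 1 => lin ((tpure_bilin (P i) (Q 1)).1 (g 1%N)) \o cins A V i \o
         contr π ξP i \o cast_ext VS n i.+1
  | _ => \0
  end.
Fact cmap_linear n :
  linear (fun w : extpow n VS => Total (fun i j _ => ccomp n i j w) : total_bimodule n).
Proof. by move=> c w w'; apply: total_ext => i j e; apply: linP. Qed.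
Definition cmap n : {linear extpow n VS -> total_bimodule n} := lin (@cmap_linear n).
Definition ce_total n : {linear XS n -> total_bimodule n} := free_ext (cmap n).
Lemma ce_total_hom n : bim_hom (ce_total n). Proof. exact: free_ext_hom. Qed.

Lemma ce_total_pure n s w s' i j (e : (i + j)%N = n) :
  total_at (ce_total n (s ⊗ₜ w ⊗ₜ s')) e = twact i j (ψi s ⊗ₜ ccomp n i j w ⊗ₜ ψi s').
Proof.
by rewrite free_ext_pure -[bim_act _]/(tactl n _) tact_at [cmap n w]linE.
Qed.
Lemma ce_total_at0 n z (e : (n + 0)%N = n) : total_at (ce_total n z) e =
  theta_g δ f σQ ψ_bij n (g 0%N) (tmap (tmap idfun (extmap π n)) idfun z).
Proof.
rewrite -[LHS](linE (fun c y y' => erefl) (ce_total n z) : tproj e _ = _).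
tind z as y s'; tind y as s w.
rewrite tmap_pure /= tmap_pure theta_g_pure linE ce_total_pure /= linE cast_ext_id.
by [].
Qed.
Lemma ce_total_at1 n z (e : (n + 1)%N = n.+1) : total_at (ce_total n.+1 z) e =
  theta_g δ f σQ ψ_bij n (g 1%N) (tmap (tmap idfun (contr π ξP n)) idfun z).
Proof.
rewrite -[LHS](linE (fun c y y' => erefl) (ce_total n.+1 z) : tproj e _ = _).
tind z as y s'; tind y as s w.
rewrite tmap_pure /= tmap_pure theta_g_pure linE ce_total_pure /= linE cast_ext_id.
by [].
Qed.

Definition ce_incl n : {linear A ⊗ extpow n V ⊗ A -> T ⊗ extpow n VS ⊗ T} :=
  lin (linearP (tmap (tmap iA (extmap ι n)) iA)).
Lemma ce_incl_pure n a w b : ce_incl n (a ⊗ₜ w ⊗ₜ b) = iA a ⊗ₜ extmap ι n w ⊗ₜ iA b.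
Proof. by rewrite linE; tsimp. Qed.

Lemma ψi_iA a : ψi (iA a) = a ⊗ₜ 1.
Proof. by rewrite -[iA a]mulr1 -eB1 -ψE ψK. Qed.

Lemma twact_iA n j a w b : twact n j (ψi (iA a) ⊗ₜ (cins A V n w ⊗ₜ g j) ⊗ₜ ψi (iA b)) =
  (a ⊗ₜ w ⊗ₜ b) ⊗ₜ g j.
Proof.
rewrite !ψi_iA twact1 opra_pure σQg tassoc_pure tmap_pure right_actE oprb_pure opla_pure /=.
rewrite bim_r1 -bim_lrE cinsE; congr (_ ⊗ₜ _).
by apply: etrans (free_act_pure _ _ _ _ _) _; rewrite mulr1 mul1r.
Qed.

Lemma ce_total_incl0 n p (e : (n + 0)%N = n) : total_at (ce_total n (ce_incl n p)) e = p ⊗ₜ g 0%N.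
Proof.
rewrite ce_total_at0; tind p as y b; tind y as a w.
rewrite ce_incl_pure !(tmap_pure, tmap_pure) /= tmap_pure /= theta_g_pure extmap_πι //.
exact: twact_iA.
Qed.
Lemma ce_total_incl1 n p i (e : (i + 1)%N = n) : total_at (ce_total n (ce_incl n p)) e = 0.
Proof.
have en : i.+1 = n by rewrite -e addn1.
case: n / en p e => p e; rewrite ce_total_at1; elim/free_ind: p => [y z hy hz|a w b].
  by rewrite !linD hy hz addr0.
by rewrite ce_incl_pure tmap_pure /= tmap_pure /= contr_ι // !tpure0 lin0.
Qed.
Lemma ce_total_x0 n p (e : (n.+1 + 0)%N = n.+1) :
  total_at (ce_total n.+1 (cmul T n x (ce_incl n p))) e = 0.
Proof.
rewrite ce_total_at0; elim/free_ind: p => [y z hy hz|a w b].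
  by rewrite !linD hy hz addr0.
by rewrite ce_incl_pure cmul_pure tmap_pure /= tmap_pure /= extmap_πx // !tpure0 lin0.
Qed.
Lemma ce_total_x1 n p (e : (n + 1)%N = n.+1) :
  total_at (ce_total n.+1 (cmul T n x (ce_incl n p))) e = p ⊗ₜ g 1%N.
Proof.
rewrite ce_total_at1; tind p as y b; tind y as a w.
rewrite ce_incl_pure cmul_pure tmap_pure /= tmap_pure /= contr_x // extmap_πι //.
rewrite theta_g_pure; exact: twact_iA.
Qed.

Let th0_bij n : bijective (theta_g δ f σQ ψ_bij n (g 0%N)).
Proof. exact: theta_g_bij. Qed.
Let th1_bij n : bijective (theta_g δ f σQ ψ_bij n (g 1%N)).
Proof. exact: theta_g_bij. Qed.

(** [S0], [S1] and [J0], [J1] are the projections and inclusions of the summands without and with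
    [x]. *)
Let S0 n : {linear XS n -> T ⊗ extpow n V ⊗ T} := tmap (tmap idfun (extmap π n)) idfun.
Let S1 n : {linear XS n.+1 -> T ⊗ extpow n V ⊗ T} := tmap (tmap idfun (contr π ξP n)) idfun.
Let J0 n : {linear T ⊗ extpow n V ⊗ T -> XS n} := tmap (tmap idfun (extmap ι n)) idfun.
Let J1 n : {linear T ⊗ extpow n V ⊗ T -> XS n.+1} :=
  tmap (tmap idfun (rmul n x \o extmap ι n)) idfun.
Let S0J0 n z : S0 n (J0 n z) = z.
Proof. by tind z as y b; tind y as a w; rewrite /S0 /J0 /=; tsimp; rewrite extmap_πι. Qed.
Let S1J0 n z : S1 n (J0 n.+1 z) = 0.
Proof.
elim/free_ind: z => [y z hy hz|a w b]; first by rewrite !linD hy hz addr0.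
by rewrite /S1 /J0 /=; tsimp; rewrite contr_ι // !tpure0.
Qed.
Let S0J1 n z : S0 n.+1 (J1 n z) = 0.
Proof.
elim/free_ind: z => [y z hy hz|a w b]; first by rewrite !linD hy hz addr0.
by rewrite /S0 /J1 /=; tsimp; rewrite extmap_πx // !tpure0.
Qed.
Let S1J1 n z : S1 n (J1 n z) = z.
Proof.
tind z as y b; tind y as a w; rewrite /S1 /J1 /=; tsimp.
by rewrite contr_x // extmap_πι.
Qed.
Let split0 z : z = J0 0 (S0 0 z).
Proof. by tind z as y b; tind y as a w; rewrite /J0 /S0 /=; tsimp; rewrite -ext_split0. Qed.
Let splitS n z : z = J0 n.+1 (S0 n.+1 z) + J1 n (S1 n z).
Proof.
tind z as y b; tind y as a w; rewrite /J0 /J1 /S0 /S1 /=; tsimp.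
by rewrite {1}(ext_split ξP split_x w) tpureDr tpureDl.
Qed.
Let addn1E i : (i + 1)%N = i.+1. Proof. exact: addn1. Qed.

(** In each of the two columns the map is a bijective [theta_g] after the projection [S0] or [S1],
    and these projections split the source. *)
Lemma ce_total_bij n : bijective (ce_total n).
Proof.
apply: inj_surj_bij => [z z' h|y].
  have h0 : S0 n z = S0 n z'.
    apply: (bij_inj (th0_bij n)); rewrite -!(ce_total_at0 _ (addn0 n)).
    by rewrite h.
  case: n z z' h h0 => [|n] z z' h h0; first by rewrite [z]split0 h0 -split0.
  have h1 : S1 n z = S1 n z'.
    by apply: (bij_inj (th1_bij n)); rewrite -!(ce_total_at1 _ (addn1E n)) h.
  by rewrite [z]splitS h0 h1 -splitS.
have [z0 e0] := (bij_inj_surj (th0_bij n)).2 (total_at y (addn0 n)).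
case: n y z0 e0 => [|n] y z0 e0.
  exists (J0 0 z0); apply: tot_ext => [e|i e]; last by have := e; rewrite addn1.
  rewrite (eq_irrelevance e (addn0 _)); apply: etrans (ce_total_at0 _ _) _.
  by rewrite -e0; congr (theta_g _ _ _ _ _ _ _); apply: S0J0.
have [z1 e1] := (bij_inj_surj (th1_bij n)).2 (total_at y (addn1E n)).
exists (J0 n.+1 z0 + J1 n z1); apply: tot_ext => [e|i e].
  rewrite (eq_irrelevance e (addn0 _)); apply: etrans (ce_total_at0 _ _) _.
  rewrite -e0; congr (theta_g _ _ _ _ _ _ _); apply: etrans (linD (S0 _) _ _) _.
  by rewrite S0J0 S0J1 addr0.
have ei : i = n by apply: succn_inj; rewrite -e addn1.
case: _ / (esym ei) e => e.
rewrite (eq_irrelevance e (addn1E _)); apply: etrans (ce_total_at1 _ _) _.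
rewrite -e1; congr (theta_g _ _ _ _ _ _ _); apply: etrans (linD (S1 _) _ _) _.
by rewrite S1J0 S1J1 add0r.
Qed.

Fact iA_inner a b : inner (iA a) (iA b) = iA (inner a b).
Proof. by rewrite !innerE linB !iAM. Qed.
Fact iA_scalar c : iA c%:A = c%:A.
Proof. by rewrite linZ iA1. Qed.

Lemma br_ι u v : ed_br ES (ι u) (ι v) = ι (ed_br E u v).
Proof.
have [c1 h1] := ed_comm E u v; have [c2 h2] := ed_comm ES (ι u) (ι v).
apply: (@ed_uniq _ _ _ ES c2 c1).
by rewrite -h2 !ESι iA_inner h1 linD iA_scalar.
Qed.
Fact inner_x a : inner (eB X) (iA a) = iA (δ a).
Proof. by rewrite innerE rel addrC addKr. Qed.
Lemma br_x v : ed_br ES x (ι v) = ι (f v).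
Proof.
have [c1 h1] := hδ v; have [c2 h2] := ed_comm ES x (ι v).
apply: (@ed_uniq _ _ _ ES c2 c1).
by rewrite -h2 !ESι ESx inner_x h1 linD iA_scalar.
Qed.

Lemma extD_ι (h : {linear V -> V}) (h' : {linear VS -> VS}) :
  (forall v, h' (ι v) = ι (h v)) ->
  forall n w, extD h' n (extmap ι n w) = extmap ι n (extD h n w).
Proof.
move=> hh; elim=> [|n IH] w; first by rewrite !extD0 lin0.
elim/ext_ind: w => [y z hy hz|u w]; first by rewrite !linD hy hz.
by rewrite extmap_rmul !extD_rmul IH hh linD !extmap_rmul.
Qed.

Lemma ce_incl_cmul n u p : ce_incl n.+1 (cmul A n u p) = cmul T n (ι u) (ce_incl n p).
Proof. by tind p as y b; tind y as a w; rewrite cmul_pure 2!ce_incl_pure cmul_pure extmap_rmul. Qed.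
Lemma ce_incl_theta n u p : ce_incl n (theta E u n p) = theta ES (ι u) n (ce_incl n p).
Proof.
tind p as y b; tind y as a w.
rewrite ce_incl_pure 2!theta_pure 2!linB 3!ce_incl_pure 2!iAM ESι.
by rewrite -(extD_ι (br_ι u)).
Qed.
Lemma ce_incl_dif n p : ce_incl n (ce_dif E n p) = ce_dif ES n (ce_incl n.+1 p).
Proof.
elim: n p => [|n IH] p; elim/cmul_ind: p => [y z hy hz|u p].
- by rewrite !linD hy hz.
- by rewrite ce_incl_cmul 2!ce_dif0 ce_incl_theta.
- by rewrite !linD hy hz.
- by rewrite ce_incl_cmul 2!ce_difS linD linZ ce_incl_cmul ce_incl_theta IH.
Qed.
Lemma ce_incl_cder n p : cder (inner (ES x)) (ed_br ES x) n (ce_incl n p) = ce_incl n (D n p).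
Proof.
tind p as y b; tind y as a w.
rewrite ce_incl_pure 2!cder_pure 2!linD 3!ce_incl_pure ESx 2!inner_x.
by rewrite (extD_ι br_x).
Qed.

Let S_one : ψi 1 = 1 ⊗ₜ 1. Proof. by rewrite -iA1 ψi_iA. Qed.
Let S_X : ψi (eB X) = 1 ⊗ₜ X.
Proof. by rewrite -[eB X]mul1r -iA1 -ψE ψK. Qed.

Let twact_Xl i j y : twact i j (ψi (eB X) ⊗ₜ y ⊗ₜ ψi 1) = opX D Q i j y.
Proof.
rewrite S_X S_one -[X]mulr1 twact_eX; last exact: DP.
by apply: (congr1 (opX D Q i j)); rewrite twact1 (opra1 σQ1) oprb1 opla1.
Qed.
Let twact_Xr i j y : twact i j (ψi 1 ⊗ₜ y ⊗ₜ ψi (eB X)) = oprb P Q i j X y.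
Proof. by rewrite S_X S_one twact1 (opra1 σQ1) opla1. Qed.

Lemma ce_total_act n s z s' : ce_total n (free_act (s ⊗ₜ z ⊗ₜ s')) = tactl n (s ⊗ₜ ce_total n z ⊗ₜ s').
Proof. exact: ce_total_hom. Qed.

Lemma ce_total_theta n p : ce_total n (theta ES x n (ce_incl n p)) =
  tactl n (eB X ⊗ₜ ce_total n (ce_incl n p) ⊗ₜ 1) - tactl n (1 ⊗ₜ ce_total n (ce_incl n p) ⊗ₜ eB X) -
  ce_total n (ce_incl n (D n p)).
Proof. by rewrite thetaE 2!linB ce_incl_cder !ce_total_act ESx. Qed.

(** From the left [x] acts on [p ⊗ g] as [D p ⊗ g + p ⊗ x g]. The [D]-term of [Θ_x] cancels the
    first summand and [p ⊗ (x g - g x)] remains. *)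
Lemma ce_total_theta0 n p (e : (n + 0)%N = n) :
  total_at (ce_total n (theta ES x n (ce_incl n p))) e = p ⊗ₜ cdif KQ 0 (g 1%N).
Proof.
rewrite ce_total_theta /= !tact_at twact_Xl twact_Xr !ce_total_incl0 opX_pure oprb_pure dg tpureBr.
by abelian.
Qed.
Lemma ce_total_theta1 n p i (e : (i + 1)%N = n) :
  total_at (ce_total n (theta ES x n (ce_incl n p))) e = 0.
Proof. by rewrite ce_total_theta /= !tact_at twact_Xl twact_Xr !ce_total_incl1 !lin0 ?oppr0 ?addr0. Qed.

Let tdif n (y : tot n.+1) : tot n := total_dif KP KQ y.
Fact tdif_linear n : linear (@tdif n).
Proof.
move=> c y z; apply: total_ext => i j e /=.
rewrite !linP !scalerDr !scalerA [c * _]mulrC; abelian.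
Qed.
Definition tdifl n := lin (@tdif_linear n).

Lemma ce_total_dif_incl n p : ce_total n (ce_dif ES n (ce_incl n.+1 p)) = tdifl n (ce_total n.+1 (ce_incl n.+1 p)).
Proof.
rewrite -ce_incl_dif [RHS]linE; apply: tot_ext => [e|i e] /=.
  by rewrite ce_total_incl0 ce_total_incl0 ce_total_incl1 lin0 ?scaler0 addr0 tmap_pure.
have z0 (z : P i ⊗ Q 2) : z = 0.
  by elim/tensor_ind: z => [q q'|z z' -> ->]; rewrite ?addr0 // [q']Qz tpure0r.
by rewrite ce_total_incl1 ce_total_incl1 [total_at _ (total_eqS e)]z0 !lin0 ?scaler0 addr0.
Qed.

Let tQ2 i (z : P i ⊗ Q 2) : z = 0.
Proof.
by elim/tensor_ind: z => [q q'|z z' -> ->]; rewrite ?addr0 // [q']Qz tpure0r.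
Qed.

(** The sign [(-1)^n] of [Θ_x] on degree [n] is the sign of [1 ⊗ d] on [P n ⊗ Q 1] in the total
    complex. *)
Lemma ce_total_dif_x n p : ce_total n (ce_dif ES n (cmul T n x (ce_incl n p))) =
  tdifl n (ce_total n.+1 (cmul T n x (ce_incl n p))).
Proof.
rewrite [RHS]linE; case: n p => [|n] p; apply: tot_ext => [e|i e].
- rewrite ce_dif0 ce_total_theta0 /= ce_total_x0 ce_total_x1 lin0 add0r expr0 scale1r.
  by rewrite tmap_pure.
- by have := e; rewrite addn1.
- rewrite ce_difS -ce_incl_dif linD linZ /= ce_total_x0 ce_total_theta0 ce_total_x0 ce_total_x1 lin0.
  by rewrite tmap_pure.
- have ei : i = n by apply: succn_inj; rewrite -e addn1.
  case: _ / (esym ei) e => e.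
  rewrite ce_difS -ce_incl_dif linD linZ /= ce_total_x1 ce_total_theta1 ce_total_x1.
  rewrite [total_at _ (total_eqS e)]tQ2 !lin0 ?scaler0 !addr0.
  by rewrite tmap_pure.
Qed.

Lemma tdif_act n s y s' : tdifl n (tactl n.+1 (s ⊗ₜ y ⊗ₜ s')) = tactl n (s ⊗ₜ tdifl n y ⊗ₜ s').
Proof.
rewrite [LHS]linE [tdifl n y]linE; apply: total_ext => i j e.
rewrite tact_at /= !tact_at.
rewrite (tmap_twact DP (d := cdif KP i) (e := idfun)) //; last first.
- by move=> q a; rewrite /=; move: (σQ j _) => z; tind z as a1 q1; rewrite tmap_pure.
- by move=> p; rewrite [RHS](cder_dif hδ).
- exact: cdif_hom.
rewrite (tmap_twact DP (d := idfun) (e := cdif KQ j)) //; last first.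
- by move=> q a; rewrite -σQ_dif tmap_pure.
- exact: cdif_hom.
by rewrite tpureDr tpureZr tpureDl tpureZl linD linZ.
Qed.

Lemma ce_total_dif n z : ce_total n (ce_dif ES n z) = tdifl n (ce_total n.+1 z).
Proof.
elim/free_ind: z => [y z hy hz|s w s']; first by rewrite !linD hy hz.
have -> : s ⊗ₜ w ⊗ₜ s' = free_act (s ⊗ₜ (1 ⊗ₜ w ⊗ₜ 1) ⊗ₜ s').
  by rewrite free_act_pure mulr1 mul1r.
rewrite ce_dif_hom 2!ce_total_act tdif_act.
have -> : 1 ⊗ₜ w ⊗ₜ 1 = ce_incl n.+1 (1 ⊗ₜ extmap π n.+1 w ⊗ₜ 1) +
    cmul T n x (ce_incl n (1 ⊗ₜ contr π ξP n w ⊗ₜ 1)).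
  by rewrite 2!ce_incl_pure cmul_pure iA1 {1}(ext_split ξP split_x w) tpureDr tpureDl.
by rewrite !linD ce_total_dif_incl ce_total_dif_x.
Qed.

Lemma ce_total_aug z : ce_aug T VS z = ψ (total_aug KP KQ (ce_total 0 z)).
Proof.
rewrite /total_aug; elim/free_ind: z => [y z hy hz|s w s'].
  rewrite linD hy hz (linD (ce_total 0)) /= !linD //.
rewrite ce_total_pure /= cast_ext_id.
rewrite (aug_twact iA1 iAM eB1 eBM rel ψE DP (KP := ce E) (KQ := KQ) (ce_aug_der δ f) σQ_aug).
rewrite !ψinvK ce_aug_pure linE tmap_pure cinsE augg ψE eB1 mulr1.
rewrite [caug KP _]ce_aug_pure mul1r mulr1; congr (_ * _ * _).
move: w; apply: (ext0_ind (e := fun=> (0 : VS))) => c.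
rewrite !linZ extmap_wedge; congr (_ *: _).
by rewrite !cunit_wedge iA1.
Qed.

Lemma ore_tensor_iso : twisted_tensor_iso τ ψ.
Proof.
split; [exact: ψ_bij | by rewrite ψE iA1 eB1 mulr1 | ].
by move=> u v; apply: twisted_mulψ iAM eB1 eBM rel ψE u v.
Qed.

Lemma ce_twisted_product :
  is_twisted_product τ (ce E) KQ (fun i => sigmaB B (D i)) σQ ψ (ce ES).
Proof.
exists ce_total; split=> [n|n u z v|n z|z].
- exact: ce_total_bij.
- rewrite -tactE; exact: ce_total_hom.
- by rewrite [LHS]ce_total_dif linE.
- exact: ce_total_aug.
Qed.
End OreStep.

(** * Freeness *)

Section FiniteSpan.
Variables (k : fieldType).
Implicit Types V W N : lmodType k.

Definition fin_spanned W := exists (I : finType) (x : I -> W),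
  forall w, exists c : I -> k, w = \sum_i c i *: x i.

(** A basis by its universal property, the form that matches [bim_free]. *)
Definition is_basis W (I : Type) (e : I -> W) :=
  (forall N (f : I -> N), exists h : {linear W -> N}, forall i, h (e i) = f i) /\
  (forall N (h h' : {linear W -> N}), (forall i, h (e i) = h' (e i)) -> h =1 h').

(** A spanning family of minimal size is independent. *)
Lemma spanned_basis W : fin_spanned W -> exists n (e : 'I_n -> W), is_basis e.
Proof.
move=> [I [x0 sp0]].
pose sp n := `[< exists x : 'I_n -> W, forall w, exists c : 'I_n -> k,
  w = \sum_i c i *: x i >].
have spI : exists n, sp n.
  exists #|I|; apply/asboolP; exists (x0 \o enum_val) => w; have [c ->] := sp0 w.
  exists (c \o enum_val); rewrite (reindex (@enum_val I I)) //=.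
  by exists enum_rank => i _; rewrite (enum_valK, enum_rankK).
case: (ex_minnP spI) => n /asboolP[x spx] nmin; exists n, x.
have indep c : \sum_i c i *: x i = 0 -> forall i, c i = 0.
  move=> c0 i; apply: contrapT => /eqP ci.
  case: n i x spx nmin c c0 ci => [[]//|n] i x spx nmin c c0 ci.
  suff /nmin : sp n by rewrite ltnn.
  apply/asboolP; exists (x \o lift i) => w; have [d ->] := spx w.
  (* The relation [c], whose coefficient at [i] is invertible, eliminates [x i]. *)
  exists (fun j => d (lift i j) - d i / c i * c (lift i j)) => /=.
  have -> : \sum_i0 d i0 *: x i0 = \sum_j (d j - d i / c i * c j) *: x j.
    under [RHS]eq_bigr => j _ do rewrite scalerBl -scalerA.
    by rewrite sumrB -scaler_sumr c0 scaler0 subr0.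
  by rewrite (bigD1_ord i) //= divfK // subrr scale0r add0r.
pose co w := sval (cid (spx w)).
have coE w : w = \sum_i co w i *: x i by exact: svalP (cid (spx w)).
have coU w c : w = \sum_i c i *: x i -> forall i, co w i = c i.
  move=> e i; apply/eqP; rewrite -subr_eq0; apply/eqP.
  apply: (indep (fun i => co w i - c i)).
  under eq_bigr do rewrite scalerBl.
  by rewrite sumrB -coE -e subrr.
split=> [N f|N h h' hh' w].
  have hl : linear (fun w => \sum_i co w i *: f i).
    move=> c u v; rewrite scaler_sumr -big_split; apply: eq_bigr => i _.
    rewrite /= scalerA -scalerDl; congr (_ *: _).
    apply: (coU _ (fun i => c * co u i + co v i)).
    rewrite [in LHS](coE u) [in LHS](coE v) scaler_sumr -big_split.
    by apply: eq_bigr => j _; rewrite /= scalerA -scalerDl.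
  exists (lin hl) => i; rewrite linE (bigD1 i) //= big1 => [|j ji].
    rewrite (coU _ (fun j => (j == i)%:R)) ?eqxx ?scale1r ?addr0 //.
    rewrite (bigD1 i) //= eqxx scale1r big1 ?addr0 // => j /negPf ->.
    exact: scale0r.
  rewrite (coU _ (fun j => (j == i)%:R)) ?(negPf ji) ?scale0r //.
  rewrite (bigD1 i) //= eqxx scale1r big1 ?addr0 // => j' /negPf ->.
  exact: scale0r.
rewrite [w]coE !linear_sum; apply: eq_bigr => i _.
by rewrite !linZ hh'.
Qed.

Lemma kspan_spanned t V (x : 'I_t -> V) : fin_spanned (kspan x).
Proof.
exists 'I_t, (span_gen x) => w; have [c e] := asboolP _ (valP w).
exists c; apply: val_inj; rewrite e.
pose v : {linear kspan x -> V} := val.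
by rewrite -[RHS]/(v _) linear_sum; apply: eq_bigr => i _; rewrite linZ.
Qed.

Lemma extpow_spanned V n : fin_spanned V -> fin_spanned (extpow n V).
Proof.
move=> [I [x spx]]; elim: n => [|n [J [y spy]]].
  exists unit, (fun=> wedge (fun=> 0)) => w.
  move: w; apply: (ext0_ind (e := fun=> (0 : V))) => c.
  by exists (fun=> c); rewrite (bigD1 tt) //= big1 ?addr0 // => -[].
exists (I * J)%type, (fun ij => rmul n (x ij.1) (y ij.2)) => w.
elim/ext_ind: w => [u v [c ->] [d ->]|u w].
  exists (fun i => c i + d i); rewrite -big_split; apply: eq_bigr => i _.
  by rewrite scalerDl.
have [c ->] := spx u; have [d ->] := spy w.
exists (fun ij => c ij.1 * d ij.2).
rewrite linear_sum.
rewrite -(pair_big xpredT xpredT (fun i j => (c i * d j) *: rmul n (x i) (y j))) /=.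
rewrite exchange_big; apply: eq_bigr => j _.
have rmul_sum (r : seq I) v :
    rmul n (\sum_(i <- r) c i *: x i) v = \sum_(i <- r) c i *: rmul n (x i) v.
  elim: r => [|i r IH]; first by rewrite !big_nil rmul0.
  by rewrite !big_cons rmulP IH.
rewrite linZ rmul_sum scaler_sumr; apply: eq_bigr => i _.
by rewrite scalerA mulrC.
Qed.
End FiniteSpan.

Section Freeness.
Variables (k : fieldType) (A : algType k).

Lemma bim_free_free (W : lmodType k) : fin_spanned W -> bim_free (free_bimodule A W).
Proof.
move=> /spanned_basis[n [e [ex un]]].
exists 'I_n, (fun i => 1 ⊗ₜ e i ⊗ₜ 1) => N f; have [h hE] := ex N f.
exists (free_ext h); split=> [|i|h' h'h h'f].
- exact: free_ext_hom.
- by rewrite free_ext_pure bim_act1.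
- have h'W : h' \o tpurer (A ⊗ W) (1 : A) \o tpurel W (1 : A) =1 h.
    by apply: un => i; rewrite hE -h'f.
  apply: (tensor3_ext (f := h') (g := free_ext h)) => a w b.
  rewrite free_ext_pure -h'W -[bim_act _]h'h; congr (h' _).
  by apply: esym; apply: etrans (free_act_pure _ _ _ _ _) _; rewrite mulr1 mul1r.
Qed.

Lemma bim_free_env : bim_free (env_bimodule A).
Proof.
exists unit, (fun=> 1 ⊗ₜ 1) => N f.
pose h := lin (linearP (@bim_act k A N \o tmap (lin ((tpure_bilin A N).1 (f tt))) idfun)).
have hE a b : h (a ⊗ₜ b) = bim_act (a ⊗ₜ f tt ⊗ₜ b).
  by rewrite [LHS]linE /= tmap_pure linE.
exists h; split=> [a m b|[]|h' h'h h'f m]; last 2 first.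
- by rewrite hE bim_act1.
- tind m as a b; rewrite hE -(h'f tt) -[bim_act _]h'h; congr (h' _).
  by apply: esym; apply: etrans (env_act_pure _ _ _ _) _; rewrite mulr1 mul1r.
elim/tensor_ind: m => [a' b'|x y hx hy]; last first.
  by rewrite !(tpureDr, tpureDl, linD) hx hy.
rewrite hE bim_actA -hE; congr (h _).
exact: env_act_pure.
Qed.
Lemma bim_free_zero : bim_free (zero_bimodule A).
Proof.
exists void, (fun i => 0) => N f.
exists \0; split=> // [a m b|h' _ _ m]; first by rewrite /= bim_act0.
by rewrite [m]thinmx0 !lin0.
Qed.

Lemma bim_free_projective (M : bimodule A) : bim_free M -> bim_projective M.
Proof.
move=> [I [e fr]] N N' g f gh fh gs.
pose f0 i := sval (cid (gs (f (e i)))).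
have f0E i : g (f0 i) = f (e i) by exact: svalP (cid (gs (f (e i)))).
have [h [hh he _]] := fr N f0; exists h; split=> // m.
have [h1 [_ _ un]] := fr N' (fun i => f (e i)).
rewrite (un f) //; apply: (un (g \o h)) => [a p b|i]; last by rewrite /= he f0E.
by rewrite /= hh gh.
Qed.
End Freeness.

Lemma koszul_free (k : fieldType) n : bim_free (koszul_mod k n).
Proof.
case: n => [|[|n]]; [exact: bim_free_env | | exact: bim_free_zero].
exact: bim_free_free (kspan_spanned _).
Qed.

(** * Contracting homotopies *)

Section Contractible.
Variables (k : fieldType) (A : algType k).

(* The homotopy is only required to be [k]-linear. *)
Definition contractible (M : nat -> bimodule A) (K : acomplex M) : Prop :=
  exists (η : {linear A -> M 0%N}) (s : forall n, {linear M n -> M n.+1}),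
  [/\ forall a, caug K (η a) = a,
      forall x, cdif K 0 (s 0%N x) = x - η (caug K x) &
      forall n x, cdif K n.+1 (s n.+1 x) + s n (cdif K n x) = x].

Lemma contractible_resolution M (K : acomplex M) : contractible K -> resolution K.
Proof.
move=> [η [s [h1 h2 h3]]]; split=> [a|x h|n x h].
- by exists (η a).
- by exists (s 0%N x); rewrite h2 h lin0 subr0.
- by exists (s n.+1 x); rewrite -[RHS]h3 h lin0 addr0.
Qed.

Lemma bij_inverse (U V : lmodType k) (f : {linear U -> V}) : bijective f ->
  exists g : {linear V -> U}, cancel f g /\ cancel g f.
Proof. by case=> g gK Kg; exists (lin (can_linear gK Kg)); split=> z; rewrite linE. Qed.

Lemma contractible_iso M N (K : acomplex M) (L : acomplex N) :
  acomplex_iso K L -> contractible L -> contractible K.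
Proof.
move=> [φ [φb _ φd φa]] [η [s [h1 h2 h3]]].
pose ψ n := sval (cid (bij_inverse (φb n))).
have φK n : cancel (φ n) (ψ n) := (svalP (cid (bij_inverse (φb n)))).1.
have ψK n : cancel (ψ n) (φ n) := (svalP (cid (bij_inverse (φb n)))).2.
exists (ψ 0%N \o η), (fun n => ψ n.+1 \o s n \o φ n); split=> [a|x|n x] /=.
- by rewrite -φa ψK h1.
- by apply: (can_inj (φK 0%N)); rewrite φd ψK h2 linB ψK φa.
- by apply: (can_inj (φK n.+1)); rewrite linD φd !ψK φd h3.
Qed.
End Contractible.

Section TotalHomotopy.
Variables (k : fieldType) (A B : algType k) (τ : {linear B ⊗ A -> A ⊗ B}).
Variables (P : nat -> bimodule A) (Q : nat -> bimodule B).
Variables (KP : acomplex P) (KQ : acomplex Q).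
Variables (σP : forall i, {linear B ⊗ P i -> P i ⊗ B}).
Variables (σQ : forall j, {linear Q j ⊗ A -> A ⊗ Q j}).
Variables (T : algType k) (ψ : {linear A ⊗ B -> T}).
Variables (X : nat -> bimodule T) (L : acomplex X).
Notation tot n := (Defs.total P Q n).

Section Homotopy.
Variables (ηP : {linear A -> P 0%N}) (sP : forall n, {linear P n -> P n.+1}).
Variables (ηQ : {linear B -> Q 0%N}) (sQ : forall n, {linear Q n -> Q n.+1}).
Hypothesis ηP1 : forall a, caug KP (ηP a) = a.
Hypothesis sP0 : forall x, cdif KP 0 (sP 0 x) = x - ηP (caug KP x).
Hypothesis sPS : forall n x, cdif KP n.+1 (sP n.+1 x) + sP n (cdif KP n x) = x.
Hypothesis ηQ1 : forall a, caug KQ (ηQ a) = a.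
Hypothesis sQ0 : forall x, cdif KQ 0 (sQ 0 x) = x - ηQ (caug KQ x).
Hypothesis sQS : forall n x, cdif KQ n.+1 (sQ n.+1 x) + sQ n (cdif KQ n x) = x.

Definition proj0 : {linear P 0 -> P 0} := lin (linearP (ηP \o caug KP)).
Lemma proj0E p : proj0 p = ηP (caug KP p). Proof. exact: linE. Qed.
(** The homotopy [sP ⊗ 1 + ηε ⊗ sQ] of a tensor product of complexes, where [ε] is the augmentation.
    The second term lives in row [0] only, as [ηε] is zero in positive degrees, and therefore
    carries no sign. *)
Definition toth_at n (y : tot n) i j : (i + j)%N = n.+1 -> P i ⊗ Q j :=
  match i, j with
  | i.+1, j => fun e => tmap (sP i) idfun (total_at y (succn_inj e))
  | 0, j.+1 => fun e => tmap proj0 (sQ j) (total_at y (succn_inj e : (0 + j)%N = n))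
  | 0, 0 => fun=> 0
  end.
Definition toth n (y : tot n) : tot n.+1 := Total (@toth_at n y).
Fact toth_linear n : linear (@toth n).
Proof.
move=> c y z; apply: total_ext => -[|i] [|j] e //=; exact: linP.
Qed.
Definition tothl n := lin (@toth_linear n).

Definition totη (z : A ⊗ B) : tot 0 := Total (fun i j =>
  match i, j return (i + j)%N = 0%N -> P i ⊗ Q j with
  | 0, 0 => fun=> tmap ηP ηQ z | _, _ => fun=> 0 end).
Fact totη_linear : linear totη.
Proof.
by move=> c y z; apply: total_ext => -[|i] [|j] e //=; rewrite linP.
Qed.
Definition totηl := lin totη_linear.

Lemma totη_aug z : total_aug KP KQ (totηl z) = z.
Proof.
by rewrite linE /total_aug /=; tind z as a b; rewrite tmap_pure tmap_pure /= ηP1 ηQ1.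
Qed.

Lemma toth0 y : total_dif KP KQ (tothl 0 y) = y - totηl (total_aug KP KQ y).
Proof.
rewrite ![lin _ _]linE; apply: total_ext => -[|i] [|j] e //.
rewrite /= /total_aug (eq_irrelevance (succn_inj _) (erefl 0%N)).
rewrite (eq_irrelevance (succn_inj _) (erefl 0%N)) expr0 scale1r (eq_irrelevance e (erefl 0%N)).
move: (total_at y _) => z; tind z as p q; rewrite !tmap_pure /=.
by rewrite proj0E sP0 sQ0 tpureBl tpureBr; abelian.
Qed.

(** In row [0] one has [ε d = 0], and [d s = 1 - ηε] is completed to the identity by
    [ηε ⊗ (d s + s d)]. *)
Let key0 j (z1 : P 0 ⊗ Q j.+1) (z2 : P 1 ⊗ Q j) :
  tmap (cdif KP 0) idfun (tmap (sP 0) idfun z1) +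
    tmap idfun (cdif KQ j.+1) (tmap proj0 (sQ j.+1) z1) +
    tmap proj0 (sQ j) (tmap (cdif KP 0) idfun z2 + tmap idfun (cdif KQ j) z1) = z1.
Proof.
have z20 : tmap proj0 (sQ j) (tmap (cdif KP 0) idfun z2) = 0.
  elim/tensor_ind: z2 => [p q|x y hx hy]; last by rewrite !linD /= hx hy addr0.
  by rewrite !tmap_pure proj0E caug_cdif lin0 tpure0l.
rewrite linD /= z20 add0r; tind z1 as p q.
rewrite !tmap_pure /= proj0E sP0 tpureBl -addrA -tpureDr sQS; abelian.
Qed.

(** The mixed terms [sP ⊗ d] come from rows of opposite parity and cancel. *)
Let keyS i j (z1 : P i.+1 ⊗ Q j) (z2 : P i ⊗ Q j.+1) :
  tmap (cdif KP i.+1) idfun (tmap (sP i.+1) idfun z1) +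
    (-1) ^+ i.+1 *: tmap idfun (cdif KQ j) (tmap (sP i) idfun z2) +
    tmap (sP i) idfun (tmap (cdif KP i) idfun z1 + (-1) ^+ i *: tmap idfun (cdif KQ j) z2) = z1.
Proof.
have zz : tmap idfun (cdif KQ j) (tmap (sP i) idfun z2) =
    tmap (sP i) idfun (tmap idfun (cdif KQ j) z2).
  by tind z2 as p q; rewrite !tmap_pure.
rewrite linD linZ /= zz exprS mulN1r scaleNr addrACA addNr addr0.
by tind z1 as p q; rewrite !tmap_pure /= -tpureDl sPS.
Qed.

Let total_at_irr n (y : tot n) i j (e e' : (i + j)%N = n) : total_at y e = total_at y e'.
Proof. by rewrite (eq_irrelevance e e'). Qed.

Lemma tothS n y : total_dif KP KQ (tothl n.+1 y) + tothl n (total_dif KP KQ y) = y.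
Proof.
rewrite ![lin _ _]linE; apply: total_ext => -[|i] j e.
  case: j e => [//|j] e; pose e2 : (1 + j)%N = n.+1 := e.
  rewrite -[RHS](key0 (total_at y e) (total_at y e2)) /= expr0 !scale1r.
  have -> : total_at y (succn_inj (congr1 S e) : (0 + j.+1)%N = n.+1) = total_at y e
    by apply: total_at_irr.
  have -> : total_at y (succn_inj (total_eqS e) : (0 + j.+1)%N = n.+1) = total_at y e
    by apply: total_at_irr.
  have -> : total_at y (congr1 S (succn_inj e) : (1 + j)%N = n.+1) = total_at y e2
    by apply: total_at_irr.
  have -> // : total_at y (total_eqS (succn_inj e : (0 + j)%N = n) : (0 + j.+1)%N = n.+1) = total_at y e
    by apply: total_at_irr.
pose e2 : (i + j.+1)%N = n.+1 := etrans (addnS i j) e.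
rewrite -[RHS](keyS (total_at y e) (total_at y e2)) /=.
have -> : total_at y (succn_inj (congr1 S e) : (i.+1 + j)%N = n.+1) = total_at y e
    by apply: total_at_irr.
have -> : total_at y (succn_inj (total_eqS e) : (i + j.+1)%N = n.+1) = total_at y e2
    by apply: total_at_irr.
have -> : total_at y (congr1 S (succn_inj e) : (i.+1 + j)%N = n.+1) = total_at y e
    by apply: total_at_irr.
have -> // : total_at y (total_eqS (succn_inj e : (i + j)%N = n) : (i + j.+1)%N = n.+1) = total_at y e2
    by apply: total_at_irr.
Qed.
End Homotopy.

(** A [k]-linear homotopy ignores the twisted action, and without that action the complex is an
    ordinary tensor product. *)
Lemma twisted_product_contractible : bijective ψ ->
  is_twisted_product τ KP KQ σP σQ ψ L ->
  contractible KP -> contractible KQ -> contractible L.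
Proof.
move=> /bij_inverse[ψ' [ψK ψ'K]] [φ [φb _ φd φa]] [ηP [sP [hP1 hP2 hP3]]] [ηQ [sQ [hQ1 hQ2 hQ3]]].
pose ρ n := sval (cid (bij_inverse (φb n))).
have φK n : cancel (φ n) (ρ n) := (svalP (cid (bij_inverse (φb n)))).1.
have ρK n : cancel (ρ n) (φ n) := (svalP (cid (bij_inverse (φb n)))).2.
exists (ρ 0%N \o totηl ηP ηQ \o ψ'), (fun n => ρ n.+1 \o tothl ηP sP sQ n \o φ n).
split=> [a|x|n x] /=.
- by rewrite φa ρK totη_aug // ψ'K.
- by apply: (can_inj (φK 0%N)); rewrite φd ρK (toth0 hP2 hQ2) linB ρK φa ψK.
- by apply: (can_inj (φK n.+1)); rewrite linD φd !ρK φd (tothS hP2 hP3 hQ3).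
Qed.
End TotalHomotopy.

Section KoszulHomotopy.
Variables (k : fieldType) (B : algType k) (X : B).
Hypothesis B_ind : forall Pr : B -> Prop,
  Pr 1 -> (forall b, Pr b -> Pr (X * b)) ->
  (forall c x y, Pr x -> Pr y -> Pr (c *: x + y)) -> forall b, Pr b.
Hypothesis B_rec : forall (Z : lmodType k) (L : {linear Z -> Z}),
  exists e : B -> Z -> Z, [/\ bilin e, forall z, e 1 z = z &
    forall b z, e (X * b) z = L (e b z)].
Variables (V : lmodType k) (x : V) (v : {linear V -> B}).
Hypothesis vx : v x = X.
Hypothesis Vx : forall u, exists c, u = c *: x.
Variable d : {linear B ⊗ V ⊗ B -> B ⊗ B}.
Hypothesis dE : forall b u b', d (b ⊗ₜ u ⊗ₜ b') = (b * v u) ⊗ₜ b' - b ⊗ₜ (v u * b').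
Notation K1 := (B ⊗ V ⊗ B).

(** On monomials [s] sends [x^n ⊗ b'] to the sum of the [x^i ⊗ x ⊗ x^(n-1-i) b'] over [i < n]. *)
Fact koszul_s0_ex : exists s : {linear B ⊗ B -> K1},
  (forall b', s (1 ⊗ₜ b') = 0) /\
  forall b b', s ((X * b) ⊗ₜ b') =
    tmap (tmap (lin ((amul_bilin B).2 X)) idfun) idfun (s (b ⊗ₜ b')) +
    1 ⊗ₜ x ⊗ₜ (b * b').
Proof.
pose l : {linear K1 -> K1} := tmap (tmap (lin ((amul_bilin B).2 X)) idfun) idfun.
(* [B_rec] only iterates an endomorphism, so the pair of [s (b ⊗ b')] and [b b'] is iterated; the
   second entry supplies the term needed for the next step. *)
have Nl : linear (fun z : (K1 * B)%type => (l z.1 + 1 ⊗ₜ x ⊗ₜ z.2, X * z.2) : (K1 * B)%type).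
  move=> c [q b] [q' b'] /=; congr (_, _); last by rewrite mulrDr -scalerAr.
  by rewrite linP tpureDr tpureZr /= scalerDr addrACA.
have [e [[el er] e1 eX]] := B_rec (lin Nl).
have eP2 b b' : (e b (0, b')).2 = b * b'.
  elim/B_ind: b => [|b IH|c b1 b2 h1 h2]; first by rewrite e1 mul1r.
    by rewrite eX linE /= IH mulrA.
  by rewrite el /= h1 h2 mulrDl scalerAl.
have sb : bilin (fun b b' : B => (e b (0, b')).1).
  split=> [b' c b1 b2|b c b1 b2]; first by rewrite el.
  have -> : ((0 : K1), c *: b1 + b2) = c *: ((0 : K1), b1) + (0, b2).
    by rewrite -[RHS]/((c *: 0 + 0, c *: b1 + b2)) scaler0 addr0.
  by rewrite er.
exists (blift sb); split=> [b'|b b']; rewrite !blift_pure ?e1 //.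
by rewrite eX linE /= eP2.
Qed.

(** The sum defining [s] telescopes under [d]. That [s d] is the identity expresses exactness at the
    last nonzero term. *)
Lemma koszul_homotopy : exists s : {linear B ⊗ B -> K1},
  (forall z, d (s z) = z - 1 ⊗ₜ amul z) /\ forall q, s (d q) = q.
Proof.
have [s [s1 sX]] := koszul_s0_ex; exists s; split=> z.
  tind z as b b'.
  rewrite amul_pure; elim/B_ind: b => [|b IH|c b1 b2 h1 h2].
  - by rewrite s1 lin0 mul1r subrr.
  - rewrite sX linD dE mul1r vx -mulrA.
    have dl q : d (tmap (tmap (lin ((amul_bilin B).2 X)) idfun) idfun q) =
        tmap (lin ((amul_bilin B).2 X)) idfun (d q).
      tind q as y b2; tind y as b1 u.
      rewrite !tmap_pure /= !dE linB /= !tmap_pure /=.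
      by rewrite !linE !mulrA.
    rewrite dl IH linB /= !tmap_pure /= !linE mulr1 ?amul_pure ?mulrA; abelian.
  - rewrite tpureDl tpureZl !linP h1 h2 mulrDl -scalerAl tpureDr tpureZr.
    by rewrite scalerBr; abelian.
tind z as y b'; tind y as b u; have [c ->] := Vx u.
rewrite tpureZr tpureZl !linZ; congr (_ *: _); rewrite dE linB vx.
elim/B_ind: b => [|b IH|a b1 b2 h1 h2].
- by rewrite mul1r -[X in X ⊗ₜ _]mulr1 sX !s1 lin0 add0r mul1r subr0.
- rewrite -mulrA !sX opprD addrACA -linB IH mulrA subrr addr0.
  by rewrite /= !tmap_pure /= tmap_pure /= linE.
- rewrite mulrDl -scalerAl !(tpureDl, tpureZl) 2!(linP s) -h1 -h2 scalerBr; abelian.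
Qed.
End KoszulHomotopy.

(** Used for [m = 1], which every derivation kills. *)
Lemma sigma_fix (k : fieldType) (Q : xmod k) (M : lmodType k) (D : {linear M -> M}) m :
  D m = 0 -> forall q, sigma Q D (q ⊗ₜ m) = m ⊗ₜ q.
Proof.
move=> Dm; apply: xm_ind.
- by rewrite !(tpure0, lin0).
- by move=> c x y hx hy; rewrite !(tpureD, tpureZ, linD, linZ) hx hy.
- by move=> g hg; rewrite sigma_gen.
- by move=> q hq; rewrite sigma_xl hq tsum_pure Dm tpure0l add0r.
- by move=> q hq; rewrite sigma_xr hq tsum_pure Dm tpure0l add0r.
Qed.

Lemma tpurer_bij (k : fieldType) (U V : lmodType k) (x : V) (ξ : V -> k) :
  (forall c u v, ξ (c *: u + v) = c * ξ u + ξ v) -> ξ x = 1 ->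
  (forall v, v = ξ v *: x) ->
  bijective (lin ((tpure_bilin U V).1 x)).
Proof.
move=> ξP ξx xE.
have hb : bilin (fun (u : U) v => ξ v *: u).
  split=> [v c u u'|u c v v']; first by rewrite scalerDr !scalerA mulrC.
  by rewrite ξP scalerDl scalerA.
exists (blift hb) => z; first by rewrite linE blift_pure ξx scale1r.
by tind z as u v; rewrite linE blift_pure tpureZl -tpureZr -xE.
Qed.

(** * The Koszul resolution of a polynomial ring *)

Section ConcreteKoszul.
Variables (k : fieldType).
Let B : algType k := {poly k}.
Notation x := (span_gen (fun _ : 'I_1 => 'X : B) ord0).
Notation V := (kspan (fun _ : 'I_1 => 'X : B)).

Definition xcoef (v : V) : k := (val v : {poly k})`_1.
Lemma xcoefP c u v : xcoef (c *: u + v) = c * xcoef u + xcoef v.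
Proof. by rewrite /xcoef [val _]linP coefD coefZ. Qed.
Lemma xcoefx : xcoef x = 1. Proof. by rewrite /xcoef coefX. Qed.
Lemma xcoefE v : v = xcoef v *: x.
Proof.
apply: val_inj; have [c e] := asboolP _ (valP v); rewrite big_ord1 in e.
by rewrite [RHS](linZ (val : {linear V -> B})) /= /xcoef e coefZ coefX mulr1.
Qed.

Definition kgen j : koszul_mod k j :=
  match j with 0 => 1 ⊗ₜ 1 | 1 => 1 ⊗ₜ x ⊗ₜ 1 | _ => 0 end.
Lemma koszul_zero j (q : koszul_mod k j.+2) : q = 0.
Proof. exact: thinmx0. Qed.
Lemma koszul_dif_kgen : cdif (koszul k) 0 (kgen 1) =
  bim_l _ 'X (kgen 0) - bim_r _ 'X (kgen 0).
Proof.
have el : bim_l _ 'X (kgen 0) = ('X : B) ⊗ₜ (1 : B).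
  by rewrite bim_lE; apply: etrans (env_act_pure _ _ _ _) _; rewrite !mulr1.
have er : bim_r _ 'X (kgen 0) = (1 : B) ⊗ₜ ('X : B).
  by rewrite bim_rE; apply: etrans (env_act_pure _ _ _ _) _; rewrite !mul1r.
by rewrite el er [LHS]koszul_d1_pure mul1r mulr1.
Qed.
Lemma koszul_aug_kgen : caug (koszul k) (kgen 0) = 1.
Proof. by rewrite [LHS]amul_pure mulr1. Qed.
Lemma genq0_bij : bijective (genq (B := poly_xalg k) (kgen 0)).
Proof.
exists idfun => z; tind z as a b; rewrite /= ?genq_pure;
  by apply: etrans (env_act_pure _ _ _ _) _; rewrite mulr1 mul1r.
Qed.
Lemma genq1_bij : bijective (genq (B := poly_xalg k) (kgen 1)).
Proof.
apply: (eq_bij (f := tmap (lin ((tpure_bilin B V).1 x)) idfun)).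
  apply: tmap_bij; first exact: (@tpurer_bij k B V x xcoef xcoefP xcoefx xcoefE).
  by exists idfun.
move=> z; tind z as a b; rewrite genq_pure tmap_pure linE.
by apply: esym; apply: etrans (free_act_pure _ _ _ _ _) _; rewrite mulr1 mul1r.
Qed.

Lemma koszul_contractible : contractible (koszul k).
Proof.
have [s [h1 h2]] := @koszul_homotopy k B 'X (@poly_Xind k)
  (fun Z L => ex_intro _ (peval L) (And3 (peval_bilin L) (peval1 L) (pevalXl L)))
  V x (val : {linear V -> B}) erefl (fun u => ex_intro _ _ (xcoefE u))
  (koszul_d1 k) (@koszul_d1_pure k).
exists (lin ((tpure_bilin B B).2 1)).
exists (fun n => match n return {linear koszul_mod k n -> koszul_mod k n.+1} with
  0 => s | _ => \0 end); split=> [b|z|[|n] z].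
- by rewrite linE [LHS]amul_pure mul1r.
- by rewrite linE; apply: h1.
- by rewrite /= add0r; apply: h2.
- by rewrite [z]koszul_zero lin0 ?addr0.
Qed.

Variables (A : algType k) (δ : derivation A).
Let τ : {linear B ⊗ A -> A ⊗ B} := sigmaB (poly_xalg k) δ.
Definition ksigma j : {linear koszul_mod k j ⊗ A -> A ⊗ koszul_mod k j} :=
  sigma (xkoszul k j) δ.
Lemma ksigma_l j q a : ksigma j (bim_l _ 'X q ⊗ₜ a) =
  tsum δ (bim_l (koszul_mod k j) 'X) (ksigma j (q ⊗ₜ a)).
Proof. exact: (sigma_xl (Q := xkoszul k j)). Qed.
Lemma ksigma_r j q a : ksigma j (bim_r _ 'X q ⊗ₜ a) =
  tsum δ (bim_r (koszul_mod k j) 'X) (ksigma j (q ⊗ₜ a)).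
Proof. exact: (sigma_xr (Q := xkoszul k j)). Qed.
Lemma ksigma_der j q a : ksigma j (q ⊗ₜ δ a) = tmap δ idfun (ksigma j (q ⊗ₜ a)).
Proof. by rewrite -(tmap_pure idfun); apply: (sigma_D (Q := xkoszul k j)). Qed.
Lemma ksigma1 j q : ksigma j (q ⊗ₜ 1) = 1 ⊗ₜ q.
Proof. exact: (sigma_fix (Q := xkoszul k j) (der1 δ)). Qed.
Lemma ksigma_compat j : compatible_r τ (ksigma j).
Proof.
exact: (@compatible_rP k (poly_xalg k) A δ (koszul_mod k j) (@koszul_gen k j)
  (@koszul_ind k j) (@koszul_sigma k j)).
Qed.
Lemma ksigma_gen j a : ksigma j (kgen j ⊗ₜ a) = a ⊗ₜ kgen j.
Proof.
case: j => [|[|j]]; last by rewrite !(tpure0, lin0).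
  exact: (sigma_gen (Q := xkoszul k 0)).
by apply: (sigma_gen (Q := xkoszul k 1)); exists x.
Qed.
(** On the generator: [x ⊗ 1] and [1 ⊗ x] pass [m] with the same correction [D m ⊗ (1 ⊗ 1)], for
    [D = δ], so their difference passes unchanged. *)
Lemma ksigma_dif j z : ksigma j (tmap (cdif (koszul k) j) idfun z) =
  tmap idfun (cdif (koszul k) j) (ksigma j.+1 z).
Proof.
apply: (sigma_natQ (Q := xkoszul k j.+1) (Q' := xkoszul k j)).
- by move=> q; rewrite /= !bim_lE; apply: (cdif_hom (koszul k)).
- by move=> q; rewrite /= !bim_rE; apply: (cdif_hom (koszul k)).
move=> g m; case: j z g => [|j] z g; last first.
  by rewrite /= !(tpure0, lin0).
move=> [w ->]; rewrite {1 2}[w]xcoefE tpureZr tpureZl !linZ.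
rewrite -[1 ⊗ₜ x ⊗ₜ 1]/(kgen 1) koszul_dif_kgen.
rewrite !(tpureZl, tpureZr) !linZ; congr (_ *: _).
rewrite tpureBl linB.
transitivity (ksigma 0 (bim_l (koszul_mod k 0) 'X (kgen 0) ⊗ₜ m) -
  ksigma 0 (bim_r (koszul_mod k 0) 'X (kgen 0) ⊗ₜ m)); first by [].
by rewrite ksigma_l ksigma_r ksigma_gen !tsum_pure tpureBr; abelian.
Qed.
Lemma ksigma_aug z : τ (tmap (caug (koszul k)) idfun z) =
  tmap idfun (caug (koszul k)) (ksigma 0 z).
Proof.
apply: (sigma_natQ (Q := xkoszul k 0) (Q' := xreg (poly_xalg k))).
- by move=> q; rewrite /= !bim_lE [LHS](caug_hom (koszul k)) mulr1 [RHS]linE.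
- by move=> q; rewrite /= !bim_rE [LHS](caug_hom (koszul k)) mul1r [RHS]linE [RHS]mulrC.
move=> g m ->; rewrite [caug _ _]koszul_aug_kgen.
exact: (sigma_gen (Q := xreg (poly_xalg k))).
Qed.
End ConcreteKoszul.

#[global] Opaque ksigma.

(** * The Ore extension as a twisted tensor product *)

Section OreFacts.
Variables (k : fieldType) (A : algType k) (δ : derivation A).
Let B : algType k := {poly k}.
Notation T := (ore δ).

Lemma ore_eval1 : ore_eval δ 1 = 1. Proof. exact: rmorph1. Qed.
Lemma ore_evalM (b b' : B) : ore_eval δ (b * b') = ore_eval δ b * ore_eval δ b'.
Proof. exact: rmorphM. Qed.
Lemma ore_evalX : ore_eval δ 'X = ore_x δ.
Proof. exact: horner_algX. Qed.
Lemma ore_evalXn i : ore_eval δ 'X^i = ore_x δ ^+ i.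
Proof. by apply: etrans (rmorphXn (horner_alg (ore_x δ)) i 'X) _; rewrite /= horner_algX. Qed.
Lemma ore_eval_rel a : ore_eval δ 'X * ore_inc δ a =
  ore_inc δ a * ore_eval δ 'X + ore_inc δ (δ a).
Proof. by rewrite ore_evalX ore_rel. Qed.
Lemma ore_psiE a (b : B) : ore_psi δ (a ⊗ₜ b) = ore_inc δ a * ore_eval δ b.
Proof.
apply: etrans (amul_pure _ _); congr (amul _); exact: tmap_pure.
Qed.

(** The inverse of [ore_psi]: coefficients stand on the left both in the Ore extension and in [A ⊗
    k[x]]. *)
Let inv (p : {poly A}) : A ⊗ B := \sum_(i < size p) p`_i ⊗ₜ ('X^i : B).
Let inv_wide n (p : {poly A}) : (size p <= n)%N -> inv p = \sum_(i < n) p`_i ⊗ₜ ('X^i : B).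
Proof.
move=> le_pn; rewrite /inv (big_ord_widen n (fun i => p`_i ⊗ₜ ('X^i : B))) //.
rewrite big_mkcond; apply: eq_bigr => i _; case: ltnP => // le_pi.
by rewrite nth_default // tpure0l.
Qed.
Let invD p q : inv (p + q) = inv p + inv q.
Proof.
pose n := maxn (size (p + q)) (maxn (size p) (size q)).
rewrite !(@inv_wide n) ?leq_max ?leqnn ?orbT // -big_split.
by apply: eq_bigr => i _; rewrite coefD tpureDl.
Qed.
Let inv_psi z : inv (ore_psi δ z) = z.
Proof.
elim/tensor_ind: z => [a b|x y hx hy]; last by rewrite linD [LHS]invD hx hy.
pose q : {poly A} := \poly_(i < size b) (b`_i *: a).
have -> : ore_psi δ (a ⊗ₜ b) = q.
  rewrite ore_psiE -[b in LHS]coefK poly_def /q poly_def linear_sum mulr_sumr.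
  apply: eq_bigr => i _; rewrite linZ -scalerAr scalerAl -linZ.
  by rewrite /= ore_evalXn; apply: ore_monomial.
rewrite (@inv_wide (size b)) ?size_poly // -[b in RHS]coefK poly_def tpure_sumr.
apply: eq_bigr => i _; rewrite coef_poly ltn_ord tpureZl tpureZr //.
Qed.
Lemma ore_psi_bij : bijective (ore_psi δ).
Proof.
exists inv => [z|p]; first exact: inv_psi.
rewrite /inv linear_sum -[RHS](coefK (p : {poly A})) poly_def.
apply: eq_bigr => i _; rewrite ore_psiE ore_evalXn.
exact: ore_monomial.
Qed.
End OreFacts.
Section StepGeneric.
Variables (k : fieldType) (A : algType k) (V : lmodType k) (E : env_data A V).
Variables (δ : derivation A) (f : {linear V -> V}).
Hypothesis hδ : forall v, exists c, δ (E v) = c%:A + E (f v).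
Let τ : {linear {poly k} ⊗ A -> A ⊗ {poly k}} := sigmaB (poly_xalg k) δ.
Let P n := free_bimodule A (extpow n V).
Definition psigma i : {linear {poly k} ⊗ P i -> P i ⊗ {poly k}} :=
  sigmaB (poly_xalg k) (cder δ f i).

Lemma ce_projective : fin_spanned V -> contractible (ce E) ->
  projective_resolution (ce E).
Proof.
move=> sV cE; split; first exact: contractible_resolution.
by move=> n; apply/bim_free_projective/bim_free_free/extpow_spanned.
Qed.

Lemma koszul_projective : projective_resolution (koszul k).
Proof.
split; first exact: contractible_resolution (koszul_contractible k).
by move=> n; apply/bim_free_projective/koszul_free.
Qed.

Lemma compatible_resolution_lP : fin_spanned V -> contractible (ce E) ->
  compatible_resolution_l τ (ce E) psigma.
Proof.
move=> sV cE; split; first exact: ce_projective.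
- move=> i; apply: (@compatible_lP k (poly_xalg k) A δ (P i) (cder δ f i)).
  exact: cder_act.
- move=> i; apply: (@sigmaB_nat k (poly_xalg k) _ _ (cder δ f i.+1) (cder δ f i) (cdif (ce E) i)).
  by move=> m; apply: esym; apply: (cder_dif hδ).
- apply: (@sigmaB_nat k (poly_xalg k) _ _ (cder δ f 0) δ (caug (ce E))).
  by move=> m; apply: ce_aug_der.
Qed.

Lemma compatible_resolution_rP :
  compatible_resolution_r τ (koszul k) (ksigma δ).
Proof.
split; first exact: koszul_projective.
- exact: ksigma_compat.
- exact: ksigma_dif.
- exact: ksigma_aug.
Qed.

Variables (VS : lmodType k) (ES : env_data (ore δ) VS).
Variables (ι : {linear V -> VS}) (x : VS) (π : {linear VS -> V}) (ξ : VS -> k).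
Hypothesis ξP : forall c u u', ξ (c *: u + u') = c * ξ u + ξ u'.
Hypothesis πι : forall v, π (ι v) = v.
Hypothesis πx : π x = 0.
Hypothesis ξι : forall v, ξ (ι v) = 0.
Hypothesis ξx : ξ x = 1.
Hypothesis split_x : forall u, u = ι (π u) + ξ u *: x.
Hypothesis ESι : forall v, ES (ι v) = ore_inc δ (E v).
Hypothesis ESx : ES x = ore_x δ.

Lemma ore_twisted_product :
  is_twisted_product τ (ce E) (koszul k) psigma (ksigma δ) (ore_psi δ) (ce ES).
Proof.
apply: (@ce_twisted_product k A V E δ f hδ (poly_xalg k) _ (koszul k) (ksigma δ)
  (@ksigma_l k A δ) (@ksigma_r k A δ) (@ksigma_der k A δ) (@ksigma1 k A δ)
  (@ksigma_compat k A δ) (@ksigma_dif k A δ) (@ksigma_aug k A δ) (@kgen k)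
  (@ksigma_gen k A δ) (genq0_bij k) (genq1_bij k) (@koszul_zero k)
  (koszul_dif_kgen k) (koszul_aug_kgen k) (ore δ) (ore_inc δ) (ore_eval δ)
  (ore_psi δ) erefl (@ore_incM k A δ) (ore_eval1 δ) (ore_evalM δ) (ore_eval_rel δ) (ore_psiE δ)
  (ore_psi_bij δ) VS ES ι x π ξ ξP πι πx ξι ξx split_x ESι).
by apply: etrans ESx _; rewrite -(ore_evalX δ).
Qed.

Lemma ore_tensor_isoP : twisted_tensor_iso τ (ore_psi δ).
Proof.
apply: (@ore_tensor_iso k A δ (poly_xalg k) (ore δ) (ore_inc δ) (ore_eval δ)
  (ore_psi δ) erefl (@ore_incM k A δ) (ore_eval1 δ) (ore_evalM δ) (ore_eval_rel δ) (ore_psiE δ)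
  (ore_psi_bij δ)).
Qed.
End StepGeneric.

Lemma algC_eq0 (k : fieldType) (A : algType k) (c : k) : c%:A = 0 :> A -> c = 0.
Proof.
move=> h; apply/eqP; apply: contraT => c0; have /eqP[] := oner_neq0 A.
by rewrite -[1]scale1r -(mulVf c0) -scalerA h scaler0.
Qed.

(** * Filtered iterated Ore extensions *)

Section SpanStep.
Variables (k : fieldType) (t : nat) (A : gen_alg k t) (δ : derivation A).
Notation S := (gen_ore δ).
Notation V := (kspan (ga_x A)).
Notation VS := (kspan (ga_x S)).
Notation x := (span_gen (ga_x S) ord_max).
Let valA : {linear V -> A} := val.
Let valS : {linear VS -> S} := val.

Lemma ga_x_max : ga_x S ord_max = ore_x δ.
Proof. by rewrite /= unlift_none. Qed.
Lemma ga_x_lift i : ga_x S (lift ord_max i) = ore_inc δ (ga_x A i).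
Proof. by rewrite /= liftK. Qed.

Fact span_inc_ex v : exists u : VS, valS u = ore_inc δ (valA v).
Proof.
have [c e] := asboolP _ (valP v).
exists (\sum_i c i *: span_gen (ga_x S) (lift ord_max i)).
rewrite [valA v]e (linear_sum valS) (linear_sum (ore_inc δ)).
by apply: eq_bigr => i _; rewrite !linZ; congr (_ *: _); apply: ga_x_lift.
Qed.
Let ι0 v := sval (cid (span_inc_ex v)).
Let ι0E v : valS (ι0 v) = ore_inc δ (valA v).
Proof. exact: svalP (cid (span_inc_ex v)). Qed.
Fact span_inc_linear : linear ι0.
Proof.
move=> c u v; apply: val_inj; rewrite -!/(valS _) ι0E !linP.
by rewrite !ι0E.
Qed.
Definition span_inc : {linear V -> VS} := lin span_inc_linear.
Notation ι := span_inc.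
Lemma span_incE v : val (ι v) = ore_inc δ (val v).
Proof. by rewrite /span_inc linE; apply: ι0E. Qed.

Lemma span_ore_dec u : exists vc : V * k, u = ι vc.1 + vc.2 *: x.
Proof.
have [c e] := asboolP _ (valP u).
exists (\sum_i c (lift ord_max i) *: span_gen (ga_x A) i, c ord_max).
apply: val_inj; rewrite e -[RHS]/(valS _) linD linZ [valS (ι _)]span_incE.
rewrite (bigD1_ord ord_max) //= addrC; congr (_ + _).
rewrite -[X in ore_inc δ X]/(valA _) (linear_sum valA) (linear_sum (ore_inc δ)).
by apply: eq_bigr => i _; rewrite !linZ; congr (_ *: _); apply: ga_x_lift.
Qed.

Lemma ore_inc_x_eq0 a (c : k) : ore_inc δ a + c *: ore_x δ = 0 -> a = 0 /\ c = 0.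
Proof.
rewrite -[c *: _]/(c%:A *: ('X : {poly A})) => h.
have /(congr1 (fun p : {poly A} => p`_0)) := h.
rewrite coefD coefC coefZ coefX mulr0 addr0 coef0 => ->; split=> //.
have /(congr1 (fun p : {poly A} => p`_1)) := h.
rewrite coefD coefC coefZ coefX mulr1 add0r coef0.
exact: algC_eq0.
Qed.

Lemma span_ore_eq0 v c : ι v + c *: x = 0 -> v = 0 /\ c = 0.
Proof.
move=> /(congr1 valS); rewrite linD linZ lin0 [valS (ι _)]span_incE.
rewrite [valS x]ga_x_max => /ore_inc_x_eq0[h ->]; split=> //.
exact: val_inj.
Qed.

Let dec u := sval (cid (span_ore_dec u)).
Let decE u : u = ι (dec u).1 + (dec u).2 *: x.
Proof. exact: svalP (cid (span_ore_dec u)). Qed.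
Let dec_uniq u v c : u = ι v + c *: x -> (dec u).1 = v /\ (dec u).2 = c.
Proof.
move=> h; have := decE u; rewrite [in LHS]h => /eqP; rewrite -subr_eq0 opprD addrACA.
rewrite -linB -scalerBl => /eqP/span_ore_eq0[/eqP h1 /eqP h2].
by move: h1 h2; rewrite !subr_eq0 => /eqP -> /eqP ->.
Qed.
Let dec_lin c u u' : (dec (c *: u + u')).1 = c *: (dec u).1 + (dec u').1 /\
  (dec (c *: u + u')).2 = c * (dec u).2 + (dec u').2.
Proof.
apply: dec_uniq; rewrite {1}[u]decE {1}[u']decE linP scalerDr scalerDl scalerA.
by rewrite addrACA.
Qed.
Fact span_proj_linear : linear (fun u => (dec u).1).
Proof. by move=> c u u'; have [] := dec_lin c u u'. Qed.
Definition span_proj : {linear VS -> V} := lin span_proj_linear.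
Definition span_coef u : k := (dec u).2.
Notation π := span_proj.
Notation ξ := span_coef.
Lemma span_coefP c u u' : ξ (c *: u + u') = c * ξ u + ξ u'.
Proof. by have [] := dec_lin c u u'. Qed.
Lemma span_split u : u = ι (π u) + ξ u *: x.
Proof. by rewrite [π u]linE -decE. Qed.
Lemma span_proj_inc v : π (ι v) = v.
Proof.
by rewrite linE; have [] := @dec_uniq (ι v) v 0; rewrite ?scale0r ?addr0.
Qed.
Lemma span_coef_inc v : ξ (ι v) = 0.
Proof.
by have [] := @dec_uniq (ι v) v 0; rewrite ?scale0r ?addr0.
Qed.
Lemma span_proj_x : π x = 0.
Proof. by rewrite linE; have [] := @dec_uniq x 0 1; rewrite ?scale1r ?lin0 ?add0r. Qed.
Lemma span_coef_x : ξ x = 1.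
Proof. by have [] := @dec_uniq x 0 1; rewrite ?scale1r ?lin0 ?add0r. Qed.

Variable E : env_data A V.
Hypothesis EE : forall v, E v = val v.
Hypothesis fδ : forall i : 'I_t, exists (c : k) (v : V), δ (ga_x A i) = c%:A + val v.

Fact span_der_ex v : exists w c, δ (E v) = c%:A + E w.
Proof.
rewrite EE; have [c ->] := asboolP _ (valP v).
elim: (index_enum _) => [|i r [w [d IH]]].
  by exists 0, 0; rewrite big_nil !lin0 scale0r addr0.
have [d' [w' e]] := fδ i; exists (c i *: w' + w), (c i * d' + d).
rewrite big_cons linD linZ IH e [E (_ + _)]linP !EE.
by rewrite scalerDr scalerA addrACA -scalerDl.
Qed.
Let f0 v := sval (cid (span_der_ex v)).
Let f0E v : exists c, δ (E v) = c%:A + E (f0 v) := svalP (cid (span_der_ex v)).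
Fact span_der_linear : linear f0.
Proof.
move=> c u v; have [a1 h1] := f0E u; have [a2 h2] := f0E v.
have [a3] := f0E (c *: u + v); rewrite [E (c *: u + v)]linP linP h1 h2.
rewrite scalerDr scalerA addrACA -scalerDl -linP.
by move=> /esym/ed_uniq.
Qed.
Definition span_der : {linear V -> V} := lin span_der_linear.
Lemma span_derE v : exists c, δ (E v) = c%:A + E (span_der v).
Proof. by have [c h] := f0E v; exists c; rewrite [span_der v]linE. Qed.

(** The semidirect product of [V] and [k x], with [x] acting by [span_der]: the bracket of [u + c x]
    and [v + d x] is [[u, v] + c f v - d f u]. *)
Let br0 u u' : VS := ι (ed_br E (π u) (π u')) + ξ u *: ι (span_der (π u')) -
  ξ u' *: ι (span_der (π u)).
Fact br0_linear u : linear (br0 u).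
Proof.
move=> c v w; rewrite /br0 !linP span_coefP /= scalerDl scalerBr scalerDr.
by rewrite -[(c * _) *: _]scalerA; abelian.
Qed.

Lemma inner_antisym (R : algType k) (a b : R) : inner a b = - inner b a.
Proof. by rewrite !innerE opprB. Qed.
Lemma inner_split (R : algType k) (a b y : R) c d :
  inner (a + c *: y) (b + d *: y) = inner a b + c *: inner y b - d *: inner y a.
Proof.
rewrite [a + _]addrC innerP (linD (inner y)) (linD (inner a)) (linZ (inner y)).
rewrite (linZ (inner a)) inner_xx scaler0 addr0 [inner a y]inner_antisym scalerN.
abelian.
Qed.
Lemma ore_inc_inner a b : inner (ore_inc δ a) (ore_inc δ b) = ore_inc δ (inner a b).
Proof. by rewrite !innerE linB /= !ore_incM. Qed.
Lemma ore_x_inner a : inner (ore_x δ) (ore_inc δ a) = ore_inc δ (δ a).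
Proof. by rewrite innerE ore_rel addrC addKr. Qed.

Lemma valS_split u : valS u = ore_inc δ (E (π u)) + ξ u *: ore_x δ.
Proof.
rewrite {1}[u]span_split linD linZ; congr (_ + _ *: _); last exact: ga_x_max.
by rewrite EE; apply: span_incE.
Qed.

Fact ore_comm u v : exists c, inner (valS u) (valS v) = c%:A + valS (br0 u v).
Proof.
have [c1 h1] := ed_comm E (π u) (π v).
have [c2 h2] := span_derE (π u); have [c3 h3] := span_derE (π v).
(* The constants combine by the same formula as the vectors in [br0]. *)
exists (c1 + ξ u * c3 - ξ v * c2).
have vι w : valS (ι w) = ore_inc δ (E w) by rewrite EE; apply: span_incE.
have incA c : ore_inc δ (c%:A) = c%:A by rewrite linZ.
rewrite 2!valS_split inner_split 2!ore_x_inner ore_inc_inner.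
have -> : valS (br0 u v) = ore_inc δ (E (ed_br E (π u) (π v))) +
    ξ u *: ore_inc δ (E (span_der (π v))) - ξ v *: ore_inc δ (E (span_der (π u))).
  by rewrite /br0 (linB valS) (linD valS) 2!(linZ valS) !vι.
have incE c w : ore_inc δ (c%:A + E w) = c%:A + ore_inc δ (E w).
  by rewrite -(incA c); apply: (linD (ore_inc δ)).
rewrite h1 h2 h3 !incE scalerBl scalerDl !scalerDr -!scalerA; abelian.
Qed.

Lemma ore_env_data : exists ES : env_data S VS, forall u, ES u = val u.
Proof.
unshelve eexists (@EnvData k S VS valS (fun u => lin (br0_linear u)) _ _).
- move=> c u; rewrite valS_split => h.
  (* A scalar has no term in [x], so [u] comes from [V], where the separation property of [E]
     applies. *)
  have /ore_inc_x_eq0[h1 h2] : ore_inc δ (E (π u) - c%:A) + ξ u *: ore_x δ = 0.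
    by rewrite linB addrAC h linZ subrr.
  rewrite [u]span_split h2 scale0r addr0.
  have /ed_sep -> : E (π u) = c%:A by apply/eqP; rewrite -subr_eq0 h1.
  by rewrite lin0.
- by move=> u v; have [c h] := ore_comm u v; exists c; rewrite linE.
- by [].
Qed.

(** Contractibility is carried along to make [ce E] a resolution, as [compatible_resolution_l]
    demands at the next stage. *)
Lemma ore_step (ES : env_data S VS) : (forall u, ES u = val u) ->
  iterated_twisted_product (ce E) -> contractible (ce E) ->
  iterated_twisted_product (ce ES) /\ contractible (ce ES).
Proof.
move=> ESE itp ctr.
have tp := @ore_twisted_product k A V E δ span_der span_derE VS ES ι x π ξ
  span_coefP span_proj_inc span_proj_x span_coef_inc span_coef_x span_split.
have {}tp : is_twisted_product (sigmaB (poly_xalg k) δ) (ce E) (koszul k)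
    (psigma δ span_der) (ksigma δ) (ore_psi δ) (ce ES).
  apply: tp => [v|]; last by apply: etrans (ESE x) ga_x_max.
  by rewrite EE; apply: etrans (ESE _) (span_incE v).
split; last first.
  exact: (twisted_product_contractible (ore_psi_bij δ) tp ctr (koszul_contractible k)).
apply: (ITPTwist (δ := δ) (τ := sigmaB (poly_xalg k) δ) (σP := psigma δ span_der)
  (σQ := ksigma δ) itp _ _ _ _ _ tp).
- exact: (@twistingP k (poly_xalg k) A δ).
- move=> a; rewrite -[X in sigmaB _ _ (X ⊗ₜ _)]mulr1.
  apply: etrans (@sigmaB_X k (poly_xalg k) A δ 1 a) _.
  by rewrite sigmaB1 tsum_pure xmulE mulr1 addrC.
- exact: ore_tensor_isoP.
- exact: compatible_resolution_lP span_derE (kspan_spanned _) ctr.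
- exact: compatible_resolution_rP.
Qed.
End SpanStep.

(** * The base case of one variable *)

Section ExteriorRankOne.
Variables (k : fieldType) (V : lmodType k) (x : V).
Hypothesis Vx : forall v, exists c, v = c *: x.

Lemma ext_rank_one n (w : extpow n.+2 V) : w = 0.
Proof.
elim/ext_ind: w => [u v -> ->|u w]; first exact: addr0.
elim/ext_ind: w => [y z hy hz|u' w]; first by rewrite linD hy hz addr0.
have [c ->] := Vx u; have [c' ->] := Vx u'.
by rewrite !rmulZ linZ rmul_rmul !scaler0.
Qed.

Fact ext1_ex : exists l : {linear extpow 1 V -> V}, forall v, l (wedge v) = v ord0.
Proof.
apply: ext_lift_ex => [v v' e|v i c y z|v i j].
- exact: e.
- by rewrite /upd [i]ord1 eqxx.
- by rewrite [i]ord1 [j]ord1.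
Qed.
Definition ext1 := sval (cid ext1_ex).
Lemma ext1_wedge v : ext1 (wedge v) = v ord0. Proof. exact: svalP (cid ext1_ex) v. Qed.
Lemma ext1_rmul u c : ext1 (rmul 0 u (c *: wedge (fun=> 0))) = c *: u.
Proof.
rewrite !linZ rmul_wedge ext1_wedge; congr (_ *: _).
by apply: etrans (snoc_max _ u); congr (snoc _ _ _); apply: val_inj.
Qed.
Lemma ext1_bij : bijective ext1.
Proof.
exists (fun u => rmul 0 u (wedge (fun=> 0))) => [w|u].
  elim/ext_ind: w => [a b ha hb|u w]; first by rewrite linD rmulD ha hb.
  move: w; apply: (ext0_ind (e := fun=> (0 : V))) => c.
  by rewrite ext1_rmul rmulZ linZ.
by rewrite -[wedge _]scale1r ext1_rmul scale1r.
Qed.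
End ExteriorRankOne.

Section BaseIso.
Variables (k : fieldType) (B : algType k) (V : lmodType k) (E : env_data B V).
Definition ce0_iso : {linear B ⊗ extpow 0 V ⊗ B -> B ⊗ B} :=
  lin (linearP (tmap (@amul k B \o tmap idfun (cunit B V)) idfun)).
Lemma ce0_iso_pure a w b : ce0_iso (a ⊗ₜ w ⊗ₜ b) = (a * cunit B V w) ⊗ₜ b.
Proof. by rewrite linE /=; tsimp; rewrite amul_pure. Qed.
Definition ce1_iso : {linear B ⊗ extpow 1 V ⊗ B -> B ⊗ V ⊗ B} :=
  lin (linearP (tmap (tmap idfun (ext1 V)) idfun)).
Lemma ce1_iso_pure a w b : ce1_iso (a ⊗ₜ w ⊗ₜ b) = a ⊗ₜ ext1 V w ⊗ₜ b.
Proof. by rewrite linE /=; tsimp. Qed.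

Lemma ce0_iso_bij : bijective ce0_iso.
Proof.
exists (tmap (lin ((tpure_bilin B (extpow 0 V)).1 (wedge (fun=> 0)))) idfun) => z.
  elim/free_ind: z => [y z hy hz|a w b]; first by rewrite !linD /= hy hz.
  rewrite ce0_iso_pure tmap_pure linE /=; move: w.
  apply: (ext0_ind (e := fun=> (0 : V))) => c.
  by rewrite linZ cunit_wedge -scalerAr mulr1 tpureZl -tpureZr.
by tind z as a b; rewrite tmap_pure linE /= ce0_iso_pure cunit_wedge mulr1.
Qed.
Lemma ce1_iso_bij : bijective ce1_iso.
Proof.
apply: (eq_bij (f := tmap (tmap idfun (ext1 V)) idfun)) => [|z]; last by rewrite linE.
by do ![apply: tmap_bij; try exact: (Bijective (g := idfun))]; apply: ext1_bij.
Qed.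

Lemma ce0_iso_hom : @bim_hom k B (free_bimodule B (extpow 0 V)) (env_bimodule B) ce0_iso.
Proof.
move=> a m b; rewrite /=; elim/free_ind: m => [y z hy hz|a' w b'].
  by rewrite !(tpureDr, tpureDl, linD) hy hz.
by rewrite free_act_pure 2!ce0_iso_pure env_act_pure mulrA.
Qed.
Lemma ce1_iso_hom : @bim_hom k B (free_bimodule B (extpow 1 V)) (free_bimodule B V) ce1_iso.
Proof.
move=> a m b; rewrite /=; elim/free_ind: m => [y z hy hz|a' w b'].
  by rewrite !(tpureDr, tpureDl, linD) hy hz.
by rewrite free_act_pure 2!ce1_iso_pure free_act_pure.
Qed.

Lemma ce_iso_dif (v : V -> B) (d : {linear B ⊗ V ⊗ B -> B ⊗ B}) :
  (forall u, E u = v u) ->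
  (forall b u b', d (b ⊗ₜ u ⊗ₜ b') = (b * v u) ⊗ₜ b' - b ⊗ₜ (v u * b')) ->
  forall z, ce0_iso (ce_dif E 0 z) = d (ce1_iso z).
Proof.
move=> Ev dE z; elim/cmul_ind: z => [y z hy hz|u z]; first by rewrite !linD hy hz.
rewrite ce_dif0; elim/free_ind: z => [y z hy hz|a w b]; first by rewrite !linD hy hz.
move: w; apply: (ext0_ind (e := fun=> (0 : V))) => c.
rewrite cmul_pure ce1_iso_pure ext1_rmul dE -Ev (linZ E) theta_pure extD0.
rewrite tpure0r tpure0l subr0 linB 2!ce0_iso_pure linZ cunit_wedge.
by rewrite -!scalerAr -scalerAl !mulr1 !(tpureZl, tpureZr).
Qed.
Lemma ce_iso_aug z : amul (ce0_iso z) = ce_aug B V z.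
Proof.
elim/free_ind: z => [y z hy hz|a w b]; first by rewrite !linD /= hy hz.
by rewrite ce0_iso_pure ce_aug_pure amul_pure.
Qed.
End BaseIso.
#[global] Opaque ce0_iso ce1_iso.

Section BaseCase.
Variable k : fieldType.
Let B : algType k := {poly k}.
Notation V := (kspan (ga_x (gen_poly k))).

Lemma poly_env_data : exists E : env_data (gen_poly k) V, forall v, E v = val v.
Proof.
unshelve eexists (@EnvData k (gen_poly k) V (val : {linear V -> B}) (fun=> \0) _ _) => //.
- move=> c v h; rewrite [v]xcoefE /xcoef [val v]h.
  rewrite -[c%:A]/(c *: (1 : {poly k})) coefZ coef1 mulr0.
  exact: scale0r.
- by move=> v w; exists 0; rewrite innerE [X in X - _]mulrC subrr scale0r add0r lin0.
Qed.

Variable E : env_data (gen_poly k) V.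
Hypothesis EE : forall v, E v = val v.

Lemma ce_koszul_iso : acomplex_iso (ce E) (koszul k).
Proof.
have V1 v : exists c, v = c *: span_gen (ga_x (gen_poly k)) ord0.
  by exists (xcoef v); apply: xcoefE.
have P0 n (z : B ⊗ extpow n.+2 V ⊗ B) : z = 0.
  elim/free_ind: z => [y z -> ->|a w b]; first exact: addr0.
  by rewrite (ext_rank_one V1 w) tpure0r tpure0l.
exists (fun n => match n return {linear B ⊗ extpow n V ⊗ B -> koszul_mod k n} with
  0 => ce0_iso B V | 1 => ce1_iso B V | _ => \0 end); split.
- move=> [|[|n]]; [exact: ce0_iso_bij | exact: ce1_iso_bij |].
  by exists (fun=> 0) => z; rewrite ?[z]koszul_zero ?[z]P0.
- move=> [|[|n]]; [exact: ce0_iso_hom | exact: ce1_iso_hom |].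
  by move=> a m b; rewrite [LHS]koszul_zero [RHS]koszul_zero.
- move=> [|n] z; first exact: (ce_iso_dif (v := val) EE (@koszul_d1_pure k)).
  have -> : z = 0 by apply: P0.
  by rewrite !lin0.
- exact: ce_iso_aug.
Qed.

Lemma gen_poly_ce : iterated_twisted_product (ce E) /\ contractible (ce E).
Proof.
split; first exact: ITPKoszul ce_koszul_iso.
exact: contractible_iso ce_koszul_iso (koszul_contractible k).
Qed.
End BaseCase.

(** Existence of [E] is proved alongside, because the data for [S] are built from those for [A]; the
    second half holds for every [E], so it applies to whichever data are chosen at the next
    stage. *)
Lemma filtered_ce (k : fieldType) (t : nat) (S : gen_alg k t) :
  filtered_iterated_ore S ->
  (exists E : env_data S (kspan (ga_x S)), forall v, E v = val v) /\
  forall E : env_data S (kspan (ga_x S)), (forall v, E v = val v) ->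
    iterated_twisted_product (ce E) /\ contractible (ce E).
Proof.
elim=> {t S} [|t A δ _ [[E EE] IH] fδ].
  by split; [exact: poly_env_data | exact: gen_poly_ce].
have [itp ctr] := IH E EE.
by split; [exact: ore_env_data EE fδ | move=> ES ESE; exact: ore_step EE fδ ES ESE itp ctr].
Qed.

(** The recorded elements [ga_der] are commutators in [S], which relates them to the bracket. Later
    inclusions of the tower preserve both. *)
Lemma filtered_rel (k : fieldType) (t : nat) (S : gen_alg k t) :
  filtered_iterated_ore S -> forall i j : 'I_t, (i < j)%N ->
  inner (ga_x S j) (ga_x S i) = ga_der S j i.
Proof.
elim=> {t S} [|t A δ _ IH _] i j; first by rewrite !ord1.
case: (unliftP ord_max j) => [j' ->|->]; case: (unliftP ord_max i) => [i' ->|->].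
- rewrite !lift_max => /IH h.
  by rewrite !ga_x_lift ore_inc_inner h /= !liftK.
- by rewrite lift_max /= ltnNge ltnW.
- by move=> _; rewrite ga_x_max ga_x_lift ore_x_inner /= unlift_none liftK.
- by rewrite ltnn.
Qed.

(** * The differential on wedges *)

Section ExtDWedge.
Variables (k : fieldType) (V : lmodType k).

Lemma wedge_split n (w : 'I_n.+1 -> V) (v : 'I_n -> V) u :
  (forall i, w (lift ord_max i) = v i) -> w ord_max = u -> wedge w = rmul n u (wedge v).
Proof.
move=> hv <-; rewrite wedge_rmul; congr (rmul _ _ _).
exact: eq_wedge.
Qed.

Lemma extD_wedge (f : {linear V -> V}) n (v : 'I_n -> V) :
  extD f n (wedge v) = \sum_i wedge (upd v i (f (v i))).
Proof.
elim: n v => [|n IH] v; first by rewrite extD0 big_ord0.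
rewrite wedge_rmul extD_rmul IH (bigD1_ord ord_max) //= [LHS]addrC linear_sum.
congr (_ + _).
  apply: esym; apply: wedge_split => [i|]; rewrite /upd ?eqxx //.
  by rewrite [_ == _]eq_sym (negPf (neq_lift _ _)).
apply: eq_bigr => i _; rewrite /=; apply: esym; apply: wedge_split => [j|]; rewrite /upd.
  by rewrite (inj_eq lift_inj).
by rewrite (negPf (neq_lift _ _)).
Qed.
End ExtDWedge.

Lemma lift_lift_max n (i : 'I_n.+1) (m : 'I_n) :
  lift (lift ord_max i) (lift ord_max m) = lift ord_max (lift i m) :> 'I_n.+2.
Proof.
have b n' (m' : 'I_n') : bump n' m' = m' by rewrite /bump leqNgt ltn_ord.
apply: val_inj; rewrite /= !(b n m) (b n.+1 i).
exact: esym (b _ (lift i m)).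
Qed.

Lemma lift_max_max n (i : 'I_n.+1) : lift (lift ord_max i) ord_max = ord_max :> 'I_n.+2.
Proof.
apply: val_inj; rewrite /= /bump [(n.+1 <= i)%N]leqNgt ltn_ord add0n.
by rewrite -ltnS ltn_ord.
Qed.

Lemma sum_lift_max (W : nmodType) n (P : pred 'I_n.+1) (F : 'I_n.+1 -> W) :
  ~~ P ord_max ->
  \sum_(i | P i) F i = \sum_(i | P (lift ord_max i)) F (lift ord_max i).
Proof.
move=> Pm; rewrite big_mkcond (bigD1_ord ord_max) //= (negPf Pm) add0r.
by rewrite [RHS]big_mkcond.
Qed.

Section Formula.
Variables (k : fieldType) (A : algType k) (V : lmodType k) (E : env_data A V).

(* Both sums split off the terms of the last index [u = v ord_max]; the others
   are obtained from those for the remaining vectors by multiplying by [u]. *)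
Lemma ce_dif_wedge n (v : 'I_n.+1 -> V) :
  ce_dif E n (1 ⊗ₜ wedge v ⊗ₜ 1) =
  \sum_(i < n.+1) (-1) ^+ i *:
    (E (v i) ⊗ₜ wedge (fun m => v (lift i m)) ⊗ₜ 1 -
     1 ⊗ₜ wedge (fun m => v (lift i m)) ⊗ₜ E (v i)) +
  \sum_(j < n.+1) \sum_(i < n.+1 | (i < j)%N) (-1) ^+ j.+1 *:
    (1 ⊗ₜ wedge (fun m => if lift j m == i then ed_br E (v j) (v i)
                          else v (lift j m)) ⊗ₜ 1).
Proof.
elim: n v => [|n IH] v; rewrite wedge_rmul -cmul_pure.
  rewrite ce_dif0 theta_pure extD0 tpure0r tpure0l subr0 mulr1 mul1r.
  rewrite 2!big_ord1 big_pred0 ?addr0; last by move=> i; rewrite ord1.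
  rewrite expr0 scale1r; have -> : ord_max = ord0 :> 'I_1 by apply: val_inj.
  by congr (_ ⊗ₜ _ ⊗ₜ _ - _ ⊗ₜ _ ⊗ₜ _); apply: eq_wedge => -[].
rewrite ce_difS IH theta_pure extD_wedge mulr1 mul1r.
set u := v ord_max; set w := v \o lift ord_max.
rewrite [X in _ = X + _](bigD1_ord ord_max) //= [X in _ = _ + X](bigD1_ord ord_max) //=.
have sgn (i : 'I_n.+1) : bump n.+1 i = i by rewrite /bump leqNgt ltn_ord.
have E1 (i : 'I_n.+1) : cmul A n u ((-1) ^+ i *:
    (E (w i) ⊗ₜ wedge (fun m : 'I_n => w (lift i m)) ⊗ₜ 1 -
     1 ⊗ₜ wedge (fun m : 'I_n => w (lift i m)) ⊗ₜ E (w i))) =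
  (-1) ^+ bump n.+1 i *:
    (E (v (lift ord_max i)) ⊗ₜ wedge (fun m : 'I_n.+1 => v (lift (lift ord_max i) m)) ⊗ₜ 1 -
     1 ⊗ₜ wedge (fun m : 'I_n.+1 => v (lift (lift ord_max i) m)) ⊗ₜ E (v (lift ord_max i))).
  rewrite linZ linB 2!cmul_pure sgn.
  rewrite (@wedge_split _ _ _ (fun m : 'I_n.+1 => v (lift (lift ord_max i) m)) (fun m : 'I_n => w (lift i m)) u) //.
    by move=> m; rewrite lift_lift_max.
  by rewrite lift_max_max.
have E2 (j i : 'I_n.+1) : cmul A n u ((-1) ^+ j.+1 *:
    (1 ⊗ₜ wedge (fun m : 'I_n => if lift j m == i then ed_br E (w j) (w i)
                          else w (lift j m)) ⊗ₜ 1)) =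
  (-1) ^+ (bump n.+1 j).+1 *:
    (1 ⊗ₜ wedge (fun m : 'I_n.+1 => if lift (lift ord_max j) m == lift ord_max i
        then ed_br E (v (lift ord_max j)) (v (lift ord_max i))
        else v (lift (lift ord_max j) m)) ⊗ₜ 1).
  rewrite linZ cmul_pure sgn; congr (_ *: (_ ⊗ₜ _ ⊗ₜ _)).
  apply: esym; apply: wedge_split => [m|].
    by rewrite lift_lift_max (inj_eq lift_inj).
  by rewrite lift_max_max (negPf (neq_lift _ _)).
have E2S (j : 'I_n.+1) : cmul A n u (\sum_(i < n.+1 | (i < j)%N) (-1) ^+ j.+1 *:
    (1 ⊗ₜ wedge (fun m : 'I_n => if lift j m == i then ed_br E (w j) (w i)
                          else w (lift j m)) ⊗ₜ 1)) =
  \sum_(i < n.+2 | (i < bump n.+1 j)%N) (-1) ^+ (bump n.+1 j).+1 *: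
    (1 ⊗ₜ wedge (fun m : 'I_n.+1 => if lift (lift ord_max j) m == i
        then ed_br E (v (lift ord_max j)) (v i)
        else v (lift (lift ord_max j) m)) ⊗ₜ 1).
  rewrite (@sum_lift_max _ _ (fun i : 'I_n.+2 => (i < bump n.+1 j)%N)); last first.
    by rewrite sgn -leqNgt; apply: ltnW (ltn_ord j).
  rewrite linear_sum; apply: eq_big => [i|i _]; last exact: E2.
  by rewrite /= !sgn.
(* The terms with [j] last stem from [- D_u] in [Θ_u], whence the sign. *)
have E3 : \sum_(i < n.+2 | (i < n.+1)%N) (-1) ^+ n.+2 *:
    (1 ⊗ₜ wedge (fun m : 'I_n.+1 => if lift ord_max m == i
        then ed_br E (v ord_max) (v i) else v (lift ord_max m)) ⊗ₜ 1) =
  - ((-1) ^+ n.+1 *: (1 ⊗ₜ (\sum_(i < n.+1) wedge (upd w i (ed_br E u (w i)))) ⊗ₜ 1))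
    :> A ⊗ extpow n.+1 V ⊗ A.
  rewrite (@sum_lift_max _ _ (fun i : 'I_n.+2 => (i < n.+1)%N)) ?ltnn //.
  rewrite tpure_sumr tpure_suml scaler_sumr -sumrN.
  apply: eq_big => [i|i _]; first by rewrite /= sgn ltn_ord.
  rewrite exprS mulN1r scaleNr; congr (- (_ *: (_ ⊗ₜ _ ⊗ₜ _))).
  by apply: eq_wedge => m; rewrite (inj_eq lift_inj).
rewrite E3 linD 2!(linear_sum (cmul A n u)) (eq_bigr _ (fun i _ => E1 i)).
rewrite (eq_bigr _ (fun j _ => E2S j)) [_ *: (_ - _ - _)]scalerBr; abelian.
Qed.
End Formula.

Theorem theorem4p2 (k : fieldType) (t : nat) (S : gen_alg k t)
    (hS : filtered_iterated_ore S)
    (dbar : 'I_t -> 'I_t -> kspan (ga_x S))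
    (hdbar : forall i j : 'I_t, (i < j)%N ->
       exists c : k, ga_der S j i = c%:A + val (dbar j i)) :
  exists K : acomplex (fun n => free_bimodule S (extpow n (kspan (ga_x S)))),
    [/\ iterated_twisted_product K,
        free_resolution K,
        forall a b : S,
          caug K (a ⊗ₜ wedge (fun _ : 'I_0 => 0 : kspan (ga_x S)) ⊗ₜ b) = a * b
      & forall (n : nat) (l : 'I_n.+1 -> 'I_t),
          (forall i j : 'I_n.+1, (i < j)%N -> (l i < l j)%N) ->
          cdif K n
            (1 ⊗ₜ wedge (fun i : 'I_n.+1 => span_gen (ga_x S) (l i)) ⊗ₜ 1) =
          \sum_(i < n.+1) (-1) ^+ i *:
            (let w := wedge (fun m : 'I_n => span_gen (ga_x S) (l (lift i m))) in
             ga_x S (l i) ⊗ₜ w ⊗ₜ 1 - 1 ⊗ₜ w ⊗ₜ ga_x S (l i)) +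
          \sum_(j < n.+1) \sum_(i < n.+1 | (i < j)%N) (-1) ^+ j.+1 *:
            (1 ⊗ₜ wedge (fun m : 'I_n =>
                     if lift j m == i then dbar (l j) (l i)
                     else span_gen (ga_x S) (l (lift j m))) ⊗ₜ 1)].
Proof.
have [[E EE] h] := filtered_ce hS; have [itp ctr] := h E EE.
exists (ce E); split=> //.
- split; first exact: contractible_resolution.
  by move=> n; apply/bim_free_free/extpow_spanned/kspan_spanned.
- move=> a b; apply: etrans (ce_aug_pure _ _ _) _.
  by rewrite cunit_wedge mulr1.
- move=> n l hl; rewrite [LHS]ce_dif_wedge.
  (* Both sides are the [V]-part of the commutator of two generators; [hdbar] speaks of ordered
     pairs, and [l] is increasing. *)
  have br (i j : 'I_n.+1) : (i < j)%N -> ed_br E (span_gen (ga_x S) (l j)) (span_gen (ga_x S) (l i)) =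
      dbar (l j) (l i).
    move=> /hl ij; have [c e] := hdbar _ _ ij.
    have [c' e'] := ed_comm E (span_gen (ga_x S) (l j)) (span_gen (ga_x S) (l i)).
    apply: (@ed_uniq _ _ _ E c' c); rewrite -e' !EE /= -e.
    exact: filtered_rel.
  congr (_ + _); first by apply: eq_bigr => i _; rewrite EE.
  apply: eq_bigr => j _; apply: eq_bigr => i ij; congr (_ *: (_ ⊗ₜ _ ⊗ₜ _)).
  by apply: eq_wedge => m; rewrite br.
Qed.
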